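(* Let $(M,\sigma,\psi_{\pm})$ be a six-dimensional manifold with an $\mathrm{SU}(3)$-structure admitting a two-torus symmetry. Assume the $T^2$-action is effective on $M$. Let $p$ be a point in $M$ and $H_p$ its stabiliser in $T^2$. 1. If $\dim H_p = 2$ then $H_p = T^2$ and there is a neighbourhood $W$ of $p$ in $M$ with the following properties: the stabiliser of each point of $W\setminus\{p\}$ is either trivial or a circle $\mathbb{S}^1 < T^2$, and the set of points in $W$ with one-dimensional stabilisers is a disjoint union of three totally geodesic two-dimensional submanifolds which are complex with respect to $J$ and whose closures only meet at $p$. 2. If $\dim H_p = 1$ then $H_p$ is a circle $\mathbb{S}^1 < T^2$ and there is a neighbourhood $W$ of the orbit through $p$ in $M$ with the following properties: the stabiliser of each point of $W$ is either trivial or $H_p$, and the set of points $\{q\in W : \mathrm{Stab}_{T^2}(q)=H_p\}$ is a smooth totally geodesic submanifold of dimension two which is complex with respect to $J$. 3. If $\dim H_p = 0$ and $H_p$ is non-trivial, then $H_p\cong\mathbb{Z}_k$ for some $k>1$. The $T^2$-orbit $E$ through $p$ is a totally geodesic two-dimensional submanifold, complex with respect to $J$, and there is a neighbourhood $W$ of this orbit such that $T^2$ acts freely on $W\setminus E$.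
   Context: Manifolds are assumed connected. An $\mathrm{SU}(3)$-structure on a six-manifold $M$ consists of a Riemannian metric $g$, a $g$-orthogonal almost complex structure $J$ (not necessarily integrable), the two-form $\sigma = g(J\cdot,\cdot)$ and a complex $(3,0)$-form $\psi_{\mathbb{C}}=\psi_+ + i\psi_-$, such that at each point $p$ there is an orthonormal basis $\{E_i,JE_i\}_{i=1,2,3}$ of $T_pM$ with dual basis $\{e^i,Je^i\}_{i=1,2,3}$ satisfying $\sigma=\sum_i e^i\wedge Je^i$ and $\psi_{\mathbb{C}}=(e^1+iJe^1)\wedge(e^2+iJe^2)\wedge(e^3+iJe^3)$. No differential equation on $\sigma,\psi_\pm$ is assumed (in particular $M$ need not be nearly Kähler). A two-torus symmetry is a smooth action of $T^2=\mathbb{S}^1\times\mathbb{S}^1$ on $M$ preserving $\sigma$ and $\psi_\pm$ (hence also $g$ and $J$). ''Totally geodesic'' refers to the metric $g$; a submanifold is complex with respect to $J$ if its tangent spaces are $J$-invariant. *)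

(* Defs.v *)
From HB Require Import structures.
From mathcomp Require Import all_boot all_order all_algebra.
From mathcomp Require Import all_classical all_reals all_analysis.
From mathcomp Require Import complex.

Set Implicit Arguments.
Unset Strict Implicit.
Unset Printing Implicit Defensive.

Import Order.TTheory GRing.Theory Num.Theory.
Import numFieldNormedType.Exports.

Local Open Scope classical_set_scope.
Local Open Scope ring_scope.

(* Meant for open D.  In finite dimension, the C^k regularity of x |-> 'd f x
   is that of x |-> 'd f x v for all the vectors v. *)
Fixpoint Ck_on (R : realType) (U V : normedModType R) (k : nat)
    (D : set U) (f : U -> V) : Prop :=
  match k with
  | 0%N => forall x, D x -> {for x, continuous f}
  | k'.+1 => forall x, D x ->
      differentiable f x /\ forall v, Ck_on k' D (fun y => 'd f y v)
  end.

Definition smooth_on (R : realType) (U V : normedModType R)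
  (D : set U) (f : U -> V) : Prop := forall k, Ck_on k D f.

(* Only the values of chart_map on chart_dom, and those of chart_inv on the
   image of chart_dom, are meaningful. *)
Record chart (R : realType) (n : nat) (M : Type) := Chart {
  chart_dom : set M;
  chart_map : M -> 'rV[R]_n;
  chart_inv : 'rV[R]_n -> M }.

Definition chart_img (R : realType) (n : nat) (M : Type) (c : chart R n M) :
  set 'rV[R]_n := chart_map c @` chart_dom c.

Definition is_chart (R : realType) (n : nat) (M : topologicalType)
    (c : chart R n M) : Prop :=
  [/\ open (chart_dom c), open (chart_img c),
      forall p, chart_dom c p -> chart_inv c (chart_map c p) = p,
      forall p, chart_dom c p -> {for p, continuous (chart_map c)}
    & forall x, chart_img c x -> {for x, continuous (chart_inv c)}].

Definition transition (R : realType) (n : nat) (M : Type)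
  (c c' : chart R n M) : 'rV[R]_n -> 'rV[R]_n := chart_map c' \o chart_inv c.

Definition compatible (R : realType) (n : nat) (M : Type)
    (c c' : chart R n M) : Prop :=
  smooth_on (chart_map c @` (chart_dom c `&` chart_dom c')) (transition c c')
  /\
  smooth_on (chart_map c' @` (chart_dom c `&` chart_dom c')) (transition c' c).

Record manifold (R : realType) (n : nat) := Manifold {
  mfd_space :> topologicalType;
  mfd_hausdorff : hausdorff_space mfd_space;
  mfd_countable : @second_countable mfd_space;
  mfd_connected : connected [set: mfd_space];
  atlas : set (chart R n mfd_space);
  atlas_chart : forall c, atlas c -> is_chart c;
  atlas_cover : forall p, exists2 c, atlas c & chart_dom c p;
  atlas_compatible : forall c c', atlas c -> atlas c' -> compatible c c';
  atlas_maximal : forall c, is_chart c ->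
    (forall c', atlas c' -> compatible c c') -> atlas c }.

Definition chart_at (R : realType) (n : nat) (M : manifold R n)
  (c : chart R n M) (p : M) : Prop := atlas c /\ chart_dom c p.

(* Tangent vectors at p are given by their row of components in a chart at p;
   since 'J f x acts on rows by right multiplication, so does the differential
   of a change of charts.  A covariant tensor field of degree k gives, in each
   chart c and at each point p, a function of k tangent vectors, the rows of a
   k x n matrix. *)
Definition cotensor (R : realType) (n k : nat) (M : manifold R n) :=
  chart R n M -> M -> 'M[R]_(k, n) -> R.

Definition multilinear (R : realType) (n k : nat) (f : 'M[R]_(k, n) -> R) :=
  forall (i : 'I_k) (a b : R) (A B C : 'M[R]_(k, n)),
    row i A = a *: row i B + b *: row i C ->
    row' i B = row' i A -> row' i C = row' i A ->
    f A = a * f B + b * f C.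

Definition is_cotensor (R : realType) (n k : nat) (M : manifold R n)
    (T : cotensor k M) : Prop :=
  [/\ forall c p, chart_at c p -> multilinear (T c p),
      forall c c' p A, chart_at c p -> chart_at c' p ->
        T c' p (A *m 'J (transition c c') (chart_map c p)) = T c p A
    & forall c A, atlas c ->
        smooth_on (chart_img c) (fun x => T c (chart_inv c x) A : R^o)].

(* A field of endomorphisms of the tangent spaces: u |-> u *m J c p. *)
Definition endo_field (R : realType) (n : nat) (M : manifold R n) :=
  chart R n M -> M -> 'M[R]_n.

Definition is_endo_field (R : realType) (n : nat) (M : manifold R n)
    (J : endo_field M) : Prop :=
  (forall c c' p, chart_at c p -> chart_at c' p ->
     let D := 'J (transition c c') (chart_map c p) in
     J c p *m D = D *m J c' p)
  /\
  (forall c (u : 'rV[R]_n), atlas c ->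
     smooth_on (chart_img c) (fun x => u *m J c (chart_inv c x))).

Definition ev2 (R : realType) (n : nat) (f : 'M[R]_(2, n) -> R)
  (u v : 'rV[R]_n) : R := f (col_mx u v : 'M[R]_(1 + 1, n)).

Definition is_riemannian (R : realType) (n : nat) (M : manifold R n)
    (g : cotensor 2 M) : Prop :=
  [/\ is_cotensor g,
      forall c p u v, chart_at c p -> ev2 (g c p) u v = ev2 (g c p) v u
    & forall c p u, chart_at c p -> u != 0 -> 0 < ev2 (g c p) u u].

(* (f^* T)(p) = T(p), for f continuous at p. *)
Definition preserves_at (R : realType) (n k : nat) (M : manifold R n)
    (T : cotensor k M) (f : M -> M) (p : M) : Prop :=
  forall c c' A, chart_at c p -> chart_at c' (f p) ->
    T c' (f p)
      (A *m 'J (chart_map c' \o f \o chart_inv c) (chart_map c p)) = T c p A.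

(* The rows of E are E_1, E_2, E_3 and those of the frame are E_1, E_2, E_3,
   J E_1, J E_2, J E_3.  The components of v in that frame are
   v *m invmx (su3_frame J E): the first three are the e^i(v) and the last
   three are the (J e^i)(v), for the dual basis {e^i, J e^i}. *)
Definition su3_frame (R : realType) (J : 'M[R]_6) (E : 'M[R]_(3, 6)) :
  'M[R]_6 := (col_mx E (E *m J) : 'M[R]_(3 + 3, 6)).

Definition coframe_re (R : realType) (k : nat) (F : 'M[R]_6)
  (A : 'M[R]_(k, 6)) : 'M[R]_(k, 3) := lsubmx (A *m invmx F : 'M[R]_(k, 3 + 3)).

Definition coframe_im (R : realType) (k : nat) (F : 'M[R]_6)
  (A : 'M[R]_(k, 6)) : 'M[R]_(k, 3) := rsubmx (A *m invmx F : 'M[R]_(k, 3 + 3)).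

(* The forms are normalised by (a_1 /\ .. /\ a_k)(v_1, .., v_k) =
   \det (a_j(v_i)). *)
Definition su3_adapted (R : realType) (J : 'M[R]_6) (g s : 'M[R]_(2, 6) -> R)
    (psip psim : 'M[R]_(3, 6) -> R) (E : 'M[R]_(3, 6)) : Prop :=
  let F := su3_frame J E in
  [/\ forall i j, ev2 g (row i F) (row j F) = (i == j)%:R,
      forall A : 'M[R]_(2, 6),
        s A = \sum_(i < 3) \det (\matrix_(a < 2, b < 2)
                (if b == 0 then coframe_re F A a i else coframe_im F A a i))
    & forall A : 'M[R]_(3, 6),
        (psip A +i* psim A)%C =
        \det (\matrix_(a < 3, b < 3)
                (coframe_re F A a b +i* coframe_im F A a b)%C)].

Record su3_structure (R : realType) (M : manifold R 6) := SU3Structure {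
  su3_g : cotensor 2 M;
  su3_J : endo_field M;
  su3_sigma : cotensor 2 M;
  su3_psip : cotensor 3 M;
  su3_psim : cotensor 3 M;
  su3_riemannian : is_riemannian su3_g;
  su3_endo : is_endo_field su3_J;
  su3_almost_complex : forall c p, chart_at c p ->
    su3_J c p *m su3_J c p = - 1%:M;
  su3_orthogonal : forall c p u v, chart_at c p ->
    ev2 (su3_g c p) (u *m su3_J c p) (v *m su3_J c p) = ev2 (su3_g c p) u v;
  su3_sigma_cotensor : is_cotensor su3_sigma;
  su3_sigmaE : forall c p u v, chart_at c p ->
    ev2 (su3_sigma c p) u v = ev2 (su3_g c p) (u *m su3_J c p) v;
  su3_psip_cotensor : is_cotensor su3_psip;
  su3_psim_cotensor : is_cotensor su3_psim;
  su3_adapted_frame : forall c p, chart_at c p -> exists E,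
    su3_adapted (su3_J c p) (su3_g c p) (su3_sigma c p)
      (su3_psip c p) (su3_psim c p) E }.

Definition gram (R : realType) (n : nat) (M : manifold R n) (g : cotensor 2 M)
    (c : chart R n M) (x : 'rV[R]_n) : 'M[R]_n :=
  \matrix_(i, j) ev2 (g c (chart_inv c x)) (delta_mx 0 i) (delta_mx 0 j).

Definition christoffel (R : realType) (n : nat) (M : manifold R n)
    (g : cotensor 2 M) (c : chart R n M) (x : 'rV[R]_n) (i j k : 'I_n) : R :=
  let dg (a b d : 'I_n) := 'D_(delta_mx 0 a) (fun y => gram g c y b d : R^o) x in
  2^-1 * \sum_(l < n) (invmx (gram g c x)) k l * (dg i j l + dg j i l - dg l i j).

(* The components in the chart c of nabla_X Y, for the vector fields whose
   components in c are X and Y. *)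
Definition nabla (R : realType) (n : nat) (M : manifold R n) (g : cotensor 2 M)
    (c : chart R n M) (X Y : 'rV[R]_n -> 'rV[R]_n) (x : 'rV[R]_n) : 'rV[R]_n :=
  'D_(X x) Y x +
  \row_k \sum_(i < n) \sum_(j < n) christoffel g c x i j k * X x 0 i * Y x 0 j.

(* Embedded submanifolds, given by slice charts; as all manifolds, they are
   connected. *)
Definition is_submanifold (R : realType) (n : nat) (M : manifold R n) (k : nat)
    (N : set M) : Prop :=
  [/\ (k <= n)%N, N !=set0, connected N
    & forall q, N q -> exists2 c, chart_at c q &
        forall x, chart_dom c x ->
          (N x <-> forall j : 'I_n, (k <= j)%N -> chart_map c x 0 j = 0)].

(* The tangent space of N at q, in the chart c: the velocities at q of the
   smooth curves in N. *)
Definition tangent (R : realType) (n : nat) (M : manifold R n) (N : set M)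
    (c : chart R n M) (q : M) : set 'rV[R]_n :=
  [set v | exists (e : R) (gam : R^o -> 'rV[R]_n),
     [/\ 0 < e, gam 0 = chart_map c q,
         forall t, ball (0 : R^o) e t ->
           chart_img c (gam t) /\ N (chart_inv c (gam t)),
         smooth_on (ball (0 : R^o) e) gam
       & 'D_1 gam 0 = v]].

(* nabla_X Y is tangent to N for all vector fields X, Y that are tangent to N:
   the second fundamental form of N vanishes. *)
Definition totally_geodesic (R : realType) (n : nat) (M : manifold R n)
    (g : cotensor 2 M) (N : set M) : Prop :=
  forall c (X Y : 'rV[R]_n -> 'rV[R]_n), atlas c ->
    smooth_on (chart_img c) X -> smooth_on (chart_img c) Y ->
    (forall q, N q -> chart_dom c q ->
       tangent N c q (X (chart_map c q)) /\ tangent N c q (Y (chart_map c q))) ->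
    forall q, N q -> chart_dom c q ->
      tangent N c q (nabla g c X Y (chart_map c q)).

Definition complex_submanifold (R : realType) (n : nat) (M : manifold R n)
    (J : endo_field M) (N : set M) : Prop :=
  forall c q v, N q -> chart_at c q ->
    tangent N c q v -> tangent N c q (v *m J c q).

Definition totally_geodesic_complex_surface (R : realType) (M : manifold R 6)
    (S : su3_structure M) (N : set M) : Prop :=
  [/\ is_submanifold 2 N, totally_geodesic (su3_g S) N
    & complex_submanifold (su3_J S) N].

Definition S1 (R : realType) : set R[i] := [set z | `|z| = 1].

(* T^2 as a subset of the product ring, whose product is componentwise. *)
Definition T2 (R : realType) : set (R[i] * R[i]) :=
  [set a | S1 a.1 /\ S1 a.2].

Definition cis (R : realType) (t : R) : R[i] := (cos t +i* sin t)%C.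

Definition texp (R : realType) (X : 'rV[R]_2) : R[i] * R[i] :=
  (cis (X 0 0), cis (X 0 1)).

(* act is only meaningful on T2.  As texp is a
   surjective local diffeomorphism from R^2 to T^2, the map (a, p) |-> act a p
   is smooth when (X, p) |-> act (texp X) p is. *)
Record torus_action (R : realType) (n : nat) (M : manifold R n) := TorusAction {
  act :> R[i] * R[i] -> M -> M;
  act1 : forall p, act 1 p = p;
  actM : forall a b p, T2 a -> T2 b -> act (a * b) p = act a (act b p);
  act_continuous :
    continuous (fun Xp : 'rV[R]_2 * M => act (texp Xp.1) Xp.2);
  act_smooth : forall c c', atlas c -> atlas c' ->
    smooth_on [set Xx : 'rV[R]_2 * 'rV[R]_n | chart_img c Xx.2 /\
                 chart_dom c' (act (texp Xx.1) (chart_inv c Xx.2))]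
      (fun Xx => chart_map c' (act (texp Xx.1) (chart_inv c Xx.2))) }.

Definition two_torus_symmetry (R : realType) (M : manifold R 6)
    (S : su3_structure M) (act : torus_action M) : Prop :=
  forall a p, T2 a ->
    [/\ preserves_at (su3_sigma S) (act a) p,
        preserves_at (su3_psip S) (act a) p
      & preserves_at (su3_psim S) (act a) p].

Definition effective (R : realType) (n : nat) (M : manifold R n)
    (act : torus_action M) : Prop :=
  forall a, T2 a -> (forall p, act a p = p) -> a = 1.

Definition stab (R : realType) (n : nat) (M : manifold R n)
  (act : torus_action M) (p : M) : set (R[i] * R[i]) :=
  [set a | T2 a /\ act a p = p].

Definition torbit (R : realType) (n : nat) (M : manifold R n)
  (act : torus_action M) (p : M) : set M := (fun a => act a p) @` @T2 R.

Definition lie_algebra (R : realType) (H : set (R[i] * R[i])) : set 'rV[R]_2 :=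
  [set X | forall t : R, H (texp (t *: X))].

(* A closed subgroup H of T^2 is a Lie subgroup; its dimension is that of its
   Lie algebra, a subspace of R^2. *)
Definition has_dim (R : realType) (H : set (R[i] * R[i])) (d : nat) : Prop :=
  exists A : 'M[R]_2, \rank A = d /\
    lie_algebra H = [set X | (X <= A)%MS].

Definition real_coords (R : realType) (a : R[i] * R[i]) : 'rV[R]_4 :=
  \row_i [:: complex.Re a.1; complex.Im a.1;
             complex.Re a.2; complex.Im a.2]`_i.

(* H is the image of an injective homomorphism of Lie groups S^1 -> T^2. *)
Definition is_circle (R : realType) (H : set (R[i] * R[i])) : Prop :=
  exists f : R[i] -> R[i] * R[i],
    [/\ forall z w, S1 z -> S1 w -> f (z * w) = f z * f w,
        forall z w, S1 z -> S1 w -> f z = f w -> z = w,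
        smooth_on [set: R^o] (fun t : R^o => real_coords (f (cis t))),
        f @` @S1 R = H
      & H `<=` @T2 R].

(* For 1 < k, as 'Z_0 and 'Z_1 are Z/2. *)
Definition iso_Zk (R : realType) (H : set (R[i] * R[i])) (k : nat) : Prop :=
  exists f : 'Z_k -> R[i] * R[i],
    [/\ forall x y, f (x + y) = f x * f y, injective f & range f = H].

(* Main.v *)
Require Import Defs.
From HB Require Import structures.
From mathcomp Require Import all_boot all_order all_algebra fingroup perm.
From mathcomp Require Import all_classical all_reals all_analysis.
From mathcomp Require Import complex ring lra.

Set Implicit Arguments.
Unset Strict Implicit.
Unset Printing Implicit Defensive.

Import Order.TTheory GRing.Theory Num.Theory.
Import numFieldNormedType.Exports.

Local Open Scope classical_set_scope.
Local Open Scope ring_scope.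

(* A stabiliser acts on its tangent space by commuting matrices preserving [sigma] and
   [psi]; as [psi] determines [J], and [sigma] with [J] determines [g], they lie in SU(3)
   and are diagonal in a common complex basis, with weights [chi_0 chi_1 chi_2 = 1].
   Averaging a chart over the stabiliser makes the action itself diagonal on a polydisc of
   C^3.  In such a polydisc, an element fixing an open set has all its weights equal to 1
   and fixes the whole polydisc; so, M being connected, an element all of whose weights at
   some point are 1 acts trivially, and is 1 by effectiveness.  Hence two weights equal to
   1 already force the element to be 1, and
   - at a fixed point, the points with a nontrivial stabiliser lie on the three complex
     axes, and each stabiliser is the kernel of one weight, on which another is injective;
   - otherwise the tangent space of the orbit supplies a weight equal to 1 on the whole
     stabiliser, each of the other two is injective, and a slice transverse to the orbit
     reduces a neighbourhood of the orbit to the linear action of the stabiliser.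
   The surfaces are fixed-point sets of isometries, and are totally geodesic because
   isometries preserve the Christoffel symbols. *)

(** A stabiliser is at first only a closed subgroup, possibly finite, so the averaging must work
    without structure on it: it uses a finitely additive mean, which sees nothing but bounds.
    Smoothness of an averaged chart therefore rests on estimates uniform over a compact set of lifts
    to R^2. The mean is twisted by the inverse weights, so that the averaged coordinates become
    equivariant for the diagonal action instead of invariant.

    That the stabiliser is a circle or cyclic is decided last: an injective weight embeds it in the
    unit circle, where a one-parameter subgroup makes it everything and discreteness makes it
    finite.

    Near an orbit, slice points must be moved linearly by the stabiliser. This asks for a complement
    of the orbit direction that is invariant, obtained as the kernel of an equivariant generalised
    inverse of the infinitesimal action.

    Total geodesy concerns fields that are tangent to the surface along it only. Once tangent
    vectors are identified with the fixed vectors of the isotropy representation, the needed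
    identities can be differentiated along curves of fixed points. *)

Lemma diff_epsP (R : realType) (U V : normedModType R) (f : U -> V)
    (df : {linear U -> V}) (x : U) : continuous df ->
  (forall e, 0 < e -> \forall h \near 0, `|f (h + x) - f x - df h| <= e * `|h|) ->
  differentiable f x /\ 'd f x = df :> (U -> V).
Proof.
move=> dfc H.
have E : f \o shift x = cst (f x) + df +o_ 0 id.
  apply/eqaddoP => e e0; have := H e e0; apply: filterS => h.
  by rewrite !fctE /= opprD addrA.
have dE := diff_unique dfc E.
by split=> //; apply/diff_locallyP; rewrite dE.
Qed.

Lemma diff_eps (R : realType) (U V : normedModType R) (f : U -> V) (x : U)
    (e : R) : differentiable f x -> 0 < e ->
  \forall h \near 0, `|f (h + x) - f x - 'd f x h| <= e * `|h|.
Proof.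
move=> /diff_locallyP[_ /eqaddoP H] e0; have := H e e0; apply: filterS => h.
by rewrite !fctE /= opprD addrA.
Qed.

Lemma near_eq_diff (R : realType) (U V : normedModType R) (f g : U -> V) (x : U) :
  (\forall y \near x, f y = g y) -> differentiable f x ->
  differentiable g x /\ 'd g x = 'd f x :> (U -> V).
Proof.
move=> fg df; apply: diff_epsP => [|e e0]; first exact: diff_continuous.
have fgx : f x = g x by exact: nbhs_singleton fg.
have : \forall h \near 0, f (h + x) = g (h + x).
  by move: fg; rewrite (near_shift 0) subr0.
apply: filterS2 (diff_eps df e0) => h.
by rewrite -fgx => + <-.
Qed.

(** * Differentiation rules, evaluated at a vector *)

Section DiffPointwise.
Context {R : realType}.
Implicit Types U V W : normedModType R.

Lemma diffD_ptw U V (f g : U -> V) x : differentiable f x -> differentiable g x ->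
  differentiable (fun y => f y + g y) x /\
  forall v, 'd (fun y => f y + g y) x v = 'd f x v + 'd g x v.
Proof.
move=> df dg; split=> [|v]; first exact: (differentiableD df dg).
by have := diffD df dg => /(congr1 (fun F : U -> V => F v)).
Qed.

Lemma diffB_ptw U V (f g : U -> V) x : differentiable f x -> differentiable g x ->
  differentiable (fun y => f y - g y) x /\
  forall v, 'd (fun y => f y - g y) x v = 'd f x v - 'd g x v.
Proof.
move=> df dg; split=> [|v]; first exact: (differentiableB df dg).
by have := diffB df dg => /(congr1 (fun F : U -> V => F v)).
Qed.

Lemma diff_comp_ptw U V W (f : U -> V) (g : V -> W) x :
  differentiable f x -> differentiable g (f x) ->
  differentiable (fun y => g (f y)) x /\
  forall v, 'd (fun y => g (f y)) x v = 'd g (f x) ('d f x v).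
Proof.
move=> df dg; split=> [|v]; first exact: (differentiable_comp df dg).
by have := diff_comp df dg => /(congr1 (fun F : U -> W => F v)).
Qed.

Lemma diff_id_ptw U (x : U) : differentiable (fun y => y) x /\
  forall v, 'd (fun y => y) x v = v.
Proof.
have di : is_diff x id (id : U -> U) by exact: is_diff_id.
split=> [|v]; first exact: (ex_diff (is_diff_def := di)).
by have := diff_val (is_diff_def := di) => /(congr1 (fun F : U -> U => F v)).
Qed.

Lemma diff_cst_ptw U V (c : V) (x : U) : differentiable (fun _ : U => c) x /\
  forall v, 'd (fun _ : U => c) x v = 0.
Proof.
split=> [|v]; first exact: differentiable_cst.
by have := diff_cst c x => /(congr1 (fun F : U -> V => F v)).
Qed.

Lemma diff_lin_ptw U V (L : {linear U -> V}) (x : U) : continuous L ->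
  differentiable L x /\ forall v, 'd L x v = L v.
Proof.
move=> cL; split=> [|v]; first exact: linear_differentiable.
by have := diff_lin x cL => /(congr1 (fun F : U -> V => F v)).
Qed.

Lemma diff_pair_ptw U V W (f : U -> V) (g : U -> W) x :
  differentiable f x -> differentiable g x ->
  differentiable (fun y => (f y, g y)) x /\
  forall v, 'd (fun y => (f y, g y)) x v = ('d f x v, 'd g x v).
Proof.
move=> df dg; split=> [|v]; first exact: differentiable_pair.
by have := diff_pair df dg => /(congr1 (fun F : U -> V * W => F v)).
Qed.

Lemma near_eq_diff_ptw U V (f g : U -> V) (x : U) :
  (\forall y \near x, f y = g y) -> differentiable f x ->
  differentiable g x /\ forall v, 'd g x v = 'd f x v.
Proof.
move=> fg df; have [dg E] := near_eq_diff fg df; split=> // v.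
exact: (congr1 (fun F : U -> V => F v) E).
Qed.

Lemma diff_line_ptw U (x h : U) (t : R^o) :
  differentiable (fun s : R^o => x + s *: h) t /\
  forall a, 'd (fun s : R^o => x + s *: h) t a = a *: h.
Proof.
have dl : is_diff (t : R^o) (fun s : R^o => x + s *: h) (fun s => s *: h).
  by apply: is_diff_eq; rewrite funeqE => s /=; rewrite !fctE add0r.
split=> [|a]; first exact: (ex_diff (is_diff_def := dl)).
by have := diff_val (is_diff_def := dl) => /(congr1 (fun F : R^o -> U => F a)).
Qed.

End DiffPointwise.

(** * Maps of class C^k *)

Section Ck.
Context {R : realType}.
Implicit Types U V W : normedModType R.

Lemma Ck_onS U V k (D : set U) (f : U -> V) : Ck_on k.+1 D f -> Ck_on k D f.
Proof.
elim: k f => [|k IH] f H x Dx.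
  by have [df _] := H x Dx; exact: differentiable_continuous df.
by have [df Hv] := H x Dx; split=> [|v]; [exact: df|apply: IH; exact: Hv].
Qed.

Lemma Ck_on_le U V j k (D : set U) (f : U -> V) :
  (j <= k)%N -> Ck_on k D f -> Ck_on j D f.
Proof.
elim: k => [|k IH]; first by rewrite leqn0 => /eqP ->.
by rewrite leq_eqVlt => /predU1P[->//|jk] /Ck_onS; exact: IH.
Qed.

Lemma Ck_on_sub U V k (D D' : set U) (f : U -> V) :
  D' `<=` D -> Ck_on k D f -> Ck_on k D' f.
Proof.
move=> DD'; elim: k f => [|k IH] f H x /DD' Dx; first exact: H.
by have [df Hv] := H x Dx; split=> [|v]; [exact: df|apply: IH; exact: Hv].
Qed.

Lemma Ck_on_eq U V k (D : set U) (f g : U -> V) : open D ->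
  {in D, f =1 g} -> Ck_on k D f -> Ck_on k D g.
Proof.
move=> oD; elim: k f g => [|k IH] f g fg H x Dx.
  have nfg : \forall y \near x, f y = g y.
    by apply: filterS (open_nbhs_nbhs (conj oD Dx)) => y Dy; apply: fg; rewrite inE.
  have K : f y @[y --> x] --> f x := H x Dx.
  rewrite fg ?inE// in K; change (g y @[y --> x] --> g x).
  by apply: cvg_trans K; apply: near_eq_cvg.
have nfg y : D y -> differentiable g y /\ 'd g y = 'd f y :> (U -> V).
  move=> Dy; apply: near_eq_diff; last by case: (H y Dy).
  by apply: filterS (open_nbhs_nbhs (conj oD Dy)) => z Dz; apply: fg; rewrite inE.
have [df Hv] := H x Dx; split=> [|v]; first by case: (nfg x Dx).
apply: IH (Hv v) => y; rewrite inE => Dy.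
by have [_ ->] := nfg y Dy.
Qed.

Lemma Ck_on_cst U V k (D : set U) (c : V) : Ck_on k D (cst c).
Proof.
elim: k c => [|k IH] c x Dx; first exact: cvg_cst.
split=> [|v]; first exact: differentiable_cst.
have -> : (fun y => 'd (cst c : U -> V) y v) = cst (0 : V).
  by apply/funext => y; rewrite diff_cst.
exact: IH.
Qed.

(** The induction step of most regularity proofs below: a formula [df], valid on [D] only, stands
    for ['d f]. Openness of [D] is what allows the exchange, derivatives being local. *)
Lemma Ck_on_step U V k (D : set U) (f : U -> V) (df : U -> U -> V) : open D ->
  (forall x, D x -> differentiable f x) ->
  (forall x v, D x -> 'd f x v = df x v) ->
  (forall v, Ck_on k D (df ^~ v)) -> Ck_on k.+1 D f.
Proof.
move=> oD Df dfE H x Dx; split=> [|v]; first exact: Df.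
by apply: Ck_on_eq (H v) => // y; rewrite inE => Dy; rewrite dfE.
Qed.

Lemma Ck_on_diff U V k (D : set U) (f : U -> V) x :
  Ck_on k.+1 D f -> D x -> differentiable f x.
Proof. by move=> H /H[]. Qed.

Lemma Ck_on_d U V k (D : set U) (f : U -> V) v :
  Ck_on k.+1 D f -> Ck_on k D (fun y => 'd f y v).
Proof.
(* In [Ck_on] the regularity of the derivative sits under the quantifier over the points of [D], so
   a point is needed to extract it; over an empty [D] everything holds. *)
move=> H; have [[x Dx]|D0] := pselect (D !=set0).
  by have [_ Hv] := H x Dx; exact: Hv.
by case: k H => [|k] H x Dx; case: D0; exists x.
Qed.

Lemma Ck_on_lin U V W k (D : set U) (f : U -> V) (L : {linear V -> W}) :
  open D -> continuous L -> Ck_on k D f -> Ck_on k D (L \o f).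
Proof.
move=> oD cL; elim: k f => [|k IH] f H.
  by move=> x Dx; apply: continuous_comp; [exact: H|exact: cL].
have dL y : differentiable L y by exact: linear_differentiable.
apply: (Ck_on_step (df := fun x v => L ('d f x v))) => // [x Dx|x v Dx|v].
- by apply: differentiable_comp => //; exact: Ck_on_diff H Dx.
- by rewrite diff_comp ?diff_lin//; exact: Ck_on_diff H Dx.
- by apply: IH; exact: Ck_on_d.
Qed.

Lemma Ck_on_id k U (D : set U) : open D -> Ck_on k D (@idfun U).
Proof.
move=> oD; case: k => [|k]; first by move=> x Dx; exact: cvg_id.
apply: (Ck_on_step (df := fun x v => v)) => // [x v Dx|v].
- by rewrite diff_val.
- exact: Ck_on_cst.
Qed.

Lemma Ck_on_linear U V k (D : set U) (L : {linear U -> V}) :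
  open D -> continuous L -> Ck_on k D L.
Proof. by move=> oD cL; apply: (@Ck_on_lin _ _ _ _ _ idfun) => //; exact: Ck_on_id. Qed.

Lemma Ck_on_add U V k (D : set U) (f g : U -> V) : open D ->
  Ck_on k D f -> Ck_on k D g -> Ck_on k D (f + g).
Proof.
move=> oD; elim: k f g => [|k IH] f g Hf Hg.
  by move=> x Dx; apply: continuousD; [exact: Hf|exact: Hg].
apply: (Ck_on_step (df := fun x v => 'd f x v + 'd g x v)) => [//|x Dx|x v Dx|v].
- by apply: differentiableD; [exact: Ck_on_diff Hf Dx|exact: Ck_on_diff Hg Dx].
- by rewrite diffD//; [exact: Ck_on_diff Hf Dx|exact: Ck_on_diff Hg Dx].
- by apply: IH; exact: Ck_on_d.
Qed.

Lemma Ck_on_sum U V k (D : set U) (I : Type) (r : seq I) (P : pred I)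
    (f : I -> U -> V) : open D ->
  (forall i, P i -> Ck_on k D (f i)) -> Ck_on k D (fun x => \sum_(i <- r | P i) f i x).
Proof.
move=> oD H.
have -> : (fun x => \sum_(i <- r | P i) f i x) = \sum_(i <- r | P i) f i.
  by apply/funext => x; rewrite fct_sumE.
elim/big_rec: _ => [|i g Pi Hg]; first exact: (@Ck_on_cst _ _ _ _ 0).
by apply: Ck_on_add => //; exact: H.
Qed.

Lemma diff_scale U V (f : U -> R^o) (g : U -> V) x :
  differentiable f x -> differentiable g x ->
  differentiable (fun y => f y *: g y) x /\
  forall v, 'd (fun y => f y *: g y) x v = f x *: 'd g x v + ('d f x v : R) *: g x.
Proof.
move=> df dg.
have B : bilinear_for (GRing.Scale.Law.clone _ _ *:%R _)
    (GRing.Scale.Law.clone _ _ *:%R _) (@GRing.scale R V : R^o -> V -> V).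
  split=> [u'|u] a y z /=; first by rewrite scalerDl scalerA.
  by rewrite scalerDr !scalerA mulrC.
pose b : {bilinear R^o -> V -> V} :=
  HB.pack (@GRing.scale R V : R^o -> V -> V) (bilinear_isBilinear.Build _ _ _ _ _ _ _ B).
have cb : continuous (fun p : R^o * V => b p.1 p.2).
  by move=> [p q]; exact: (@scale_continuous _ V (p, q)).
have -> : (fun y => f y *: g y) = (fun p => b p.1 p.2) \o (fun y => (f y, g y)) by [].
have dp := differentiable_pair df dg.
have dbp : differentiable (fun p : R^o * V => b p.1 p.2) (f x, g x).
  exact: differentiable_bilin.
split=> [|v]; first exact: differentiable_comp.
rewrite diff_comp//= (diff_bilin (f := b) (f x, g x) cb) diff_pair//=.
Qed.

Lemma Ck_on_scale U V k (D : set U) (f : U -> R^o) (g : U -> V) : open D ->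
  Ck_on k D f -> Ck_on k D g -> Ck_on k D (fun x => f x *: g x).
Proof.
move=> oD; elim: k f g => [|k IH] f g Hf Hg.
  by move=> x Dx; apply: continuousZ; [exact: Hf|exact: Hg].
apply: (Ck_on_step
    (df := fun x v => f x *: 'd g x v + ('d f x v : R) *: g x)) => // [x Dx|x v Dx|v].
- by apply: (diff_scale _ _).1; [exact: Ck_on_diff Hf Dx|exact: Ck_on_diff Hg Dx].
- by apply: (diff_scale _ _).2; [exact: Ck_on_diff Hf Dx|exact: Ck_on_diff Hg Dx].
- apply: Ck_on_add => //.
  + by apply: IH; [exact: Ck_onS|exact: Ck_on_d].
  + by apply: IH; [exact: Ck_on_d|exact: Ck_onS].
Qed.

Lemma Ck_on_pair U V W k (D : set U) (f : U -> V) (g : U -> W) : open D ->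
  Ck_on k D f -> Ck_on k D g -> Ck_on k D (fun x => (f x, g x)).
Proof.
move=> oD; elim: k f g => [|k IH] f g Hf Hg.
  by move=> x Dx; apply: cvg_pair; [exact: Hf|exact: Hg].
apply: (Ck_on_step (df := fun x v => ('d f x v, 'd g x v))) => // [x Dx|x v Dx|v].
- by apply: differentiable_pair; [exact: Ck_on_diff Hf Dx|exact: Ck_on_diff Hg Dx].
- by rewrite diff_pair//; [exact: Ck_on_diff Hf Dx|exact: Ck_on_diff Hg Dx].
- by apply: IH; exact: Ck_on_d.
Qed.

(* The chain rule keeps [Ck_on] in finite dimension only, where ['d g (f x) v] is a sum
   over a basis of products of scalar functions of [x] by derivatives of [g]. *)
Definition finite_basis V := exists n (e : 'I_n -> V) (l : 'I_n -> {linear V -> R^o}),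
  (forall i, continuous (l i)) /\ forall v, v = \sum_i (l i v : R) *: e i.

Lemma Ck_on_comp U V W k (D : set U) (E : set V) (f : U -> V) (g : V -> W) :
  finite_basis V -> open D -> open E -> (forall x, D x -> E (f x)) ->
  Ck_on k D f -> Ck_on k E g -> Ck_on k D (g \o f).
Proof.
move=> [n [e [l [cl lE]]]] oD oE DE; elim: k g => [|k IH] g Hf Hg.
  by move=> x Dx; apply: continuous_comp; [exact: Hf|exact/Hg/DE].
apply: (Ck_on_step
  (df := fun x v => \sum_i (l i ('d f x v) : R) *: 'd g (f x) (e i))) => // [x Dx|x v Dx|v].
- by apply: differentiable_comp; [exact: Ck_on_diff Hf Dx|exact/(Ck_on_diff Hg)/DE].
- rewrite diff_comp/=; [|exact: Ck_on_diff Hf Dx|exact/(Ck_on_diff Hg)/DE].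
  by rewrite {1}[X in 'd g (f x) X]lE linear_sum; apply: eq_bigr => i _; rewrite linearZ.
- apply: Ck_on_sum => // i _; apply: Ck_on_scale => //.
  + by apply: (@Ck_on_lin _ _ _ _ _ _ (l i)) => //; exact: Ck_on_d.
  + by apply: (IH (fun y => 'd g y (e i))); [exact: Ck_onS|exact: Ck_on_d].
Qed.

Lemma finite_basis_R : finite_basis (R^o).
Proof.
exists 1%N, (fun=> 1), (fun=> idfun); split=> [_|v]; first by move=> x; exact: cvg_id.
by rewrite big_ord1 /= /GRing.scale/= mulr1.
Qed.

Definition coordl m n (i : 'I_m) (j : 'I_n) (A : 'M[R]_(m, n)) : R^o := A i j.

Lemma coordl_linear m n i j : linear (@coordl m n i j).
Proof. by move=> a A B; rewrite /coordl !mxE. Qed.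

HB.instance Definition _ m n i j :=
  GRing.isLinear.Build _ _ _ _ (@coordl m n i j) (@coordl_linear m n i j).

Lemma coordl_continuous m n i j : continuous (@coordl m n i j).
Proof. exact: coord_continuous. Qed.

Lemma finite_basis_rV n : finite_basis 'rV[R]_n.
Proof.
exists n, (delta_mx 0), (fun i => @coordl 1 n 0 i).
split=> [i|v]; first exact: coordl_continuous.
exact: row_sum_delta.
Qed.

Lemma finite_basis_prod V W : finite_basis V -> finite_basis W -> finite_basis (V * W)%type.
Proof.
move=> [n [e [l [cl lE]]]] [m [e' [l' [cl' lE']]]].
exists (n + m)%N.
exists (fun i => match fintype.split i with inl j => (e j, 0) | inr j => (0, e' j) end).
exists (fun i => match fintype.split i with inl j => (l j \o fst)%FUN : {linear _ -> _} | inr j => (l' j \o snd)%FUN end).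
split=> [i|[v w]].
  case: (fintype.split i) => j /= x; apply: continuous_comp; try exact: cl; try exact: cl'.
  - exact: cvg_fst.
  - exact: cvg_snd.
rewrite big_split_ord/=.
under eq_bigr do rewrite (unsplitK (inl _))/=.
under [X in _ = _ + X]eq_bigr do rewrite (unsplitK (inr _))/=.
rewrite {1}(lE v) {1}(lE' w).
have fst_lin I (r : seq I) (F : I -> V * W) : (\sum_(i <- r) F i).1 = \sum_(i <- r) (F i).1.
  by elim/big_rec2: _ => // i y1 y2 _ <-.
have snd_lin I (r : seq I) (F : I -> V * W) : (\sum_(i <- r) F i).2 = \sum_(i <- r) (F i).2.
  by elim/big_rec2: _ => // i y1 y2 _ <-.
rewrite [RHS]surjective_pairing /= !fst_lin !snd_lin /=.
congr (_, _).
  by rewrite [X in _ + X]big1 ?addr0// => i _; rewrite scaler0.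
by rewrite [X in X + _]big1 ?add0r// => i _; rewrite scaler0.
Qed.

Lemma Ck_on_mul U k (D : set U) (f g : U -> R^o) : open D ->
  Ck_on k D f -> Ck_on k D g -> Ck_on k D (fun x => f x * g x : R^o).
Proof. by move=> oD Hf Hg; exact: (Ck_on_scale (g := g)). Qed.

Lemma Ck_on_prod U k (D : set U) (I : Type) (r : seq I) (P : pred I)
    (f : I -> U -> R^o) : open D ->
  (forall i, P i -> Ck_on k D (f i)) ->
  Ck_on k D (fun x => \prod_(i <- r | P i) f i x : R^o).
Proof.
move=> oD H; elim: r => [|i r IH].
  under eq_fun do rewrite big_nil; exact: Ck_on_cst.
under eq_fun do rewrite big_cons.
by have := H i; case: (P i) => [/(_ isT) Hi|_]; [exact: Ck_on_mul|exact: IH].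
Qed.

Lemma Ck_on_inv U k (D : set U) (f : U -> R^o) : open D ->
  (forall x, D x -> f x != 0) -> Ck_on k D f -> Ck_on k D (fun x => (f x)^-1 : R^o).
Proof.
move=> oD f0; elim: k => [|k IH] Hf.
  by move=> x Dx; apply: continuousV; [exact: f0|exact: Hf].
have Hf' := IH (Ck_onS Hf).
apply: (Ck_on_step (df := fun x v => - ((f x)^-1 * (f x)^-1) * 'd f x v)) => [//|x Dx|x v Dx|v].
- by apply: differentiableV; [exact: Ck_on_diff Hf Dx|exact: f0].
- rewrite (@diffV _ _ f); [|exact: Ck_on_diff Hf Dx|exact: f0].
  by rewrite /= -exprVn expr2.
- apply: Ck_on_mul => //; last exact: Ck_on_d.
  rewrite (_ : (fun _ => _) = fun x => (-1 : R) *: ((f x)^-1 * (f x)^-1) : R^o); last first.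
    by apply/funext => x; rewrite scaleN1r.
  by apply: Ck_on_scale => //; [exact: Ck_on_cst|exact: Ck_on_mul].
Qed.

Lemma Ck_on_coord U k (D : set U) m n (f : U -> 'M[R]_(m, n)) i j :
  open D -> Ck_on k D f -> Ck_on k D (fun x => f x i j : R^o).
Proof. by move=> oD Hf; apply: (Ck_on_lin (L := @coordl m n i j)) => //; exact: coordl_continuous. Qed.

Lemma Ck_on_rV U k (D : set U) n (f : U -> 'rV[R]_n) : open D ->
  (forall j, Ck_on k D (fun x => f x 0 j : R^o)) -> Ck_on k D f.
Proof.
move=> oD H.
rewrite (_ : f = fun x => \sum_j (f x 0 j : R^o) *: (delta_mx 0 j : 'rV[R]_n)); last first.
  by apply/funext => x; exact: row_sum_delta.
by apply: Ck_on_sum => // j _; apply: Ck_on_scale => //; exact: Ck_on_cst.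
Qed.

Lemma Ck_on_det U k (D : set U) n (M : U -> 'M[R]_n) : open D ->
  (forall i j, Ck_on k D (fun x => M x i j : R^o)) -> Ck_on k D (fun x => \det (M x) : R^o).
Proof.
move=> oD H; rewrite /determinant; apply: Ck_on_sum => // s _.
apply: Ck_on_mul => //; first exact: Ck_on_cst.
by apply: Ck_on_prod.
Qed.

Lemma Ck_on_invmx U k (D : set U) n (M : U -> 'M[R]_n) i j : open D ->
  (forall x, D x -> M x \in unitmx) ->
  (forall i j, Ck_on k D (fun x => M x i j : R^o)) ->
  Ck_on k D (fun x => invmx (M x) i j : R^o).
Proof.
move=> oD Mu H.
apply: (@Ck_on_eq _ _ _ _ (fun x => (\det (M x))^-1 * \adj (M x) i j : R^o)) => //.
  by move=> x; rewrite inE => Dx; rewrite /invmx Mu// !mxE.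
apply: Ck_on_mul => //.
  apply: Ck_on_inv => //; last exact: Ck_on_det.
  by move=> x Dx; rewrite -unitfE -unitmxE Mu.
under eq_fun do rewrite mxE /cofactor.
apply: Ck_on_mul => //; first exact: Ck_on_cst.
apply: Ck_on_det => // a b.
by under eq_fun do rewrite !mxE; exact: H.
Qed.

Lemma smooth_Jcoord n m (D : set 'rV[R]_n) (f : 'rV[R]_n -> 'rV[R]_m) k i j : open D ->
  Ck_on k.+1 D f -> Ck_on k D (fun x => ('J f x) i j : R^o).
Proof.
move=> oD Hf.
have -> : (fun x => ('J f x) i j : R^o) = fun x => ('d f x (delta_mx 0 i)) 0 j.
  by apply/funext => x; rewrite /jacobian mxE.
by apply: Ck_on_coord => //; exact: Ck_on_d.
Qed.

Lemma MVT_diff U (f : U -> R^o) (x h : U) :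
  (forall t, 0 <= t <= 1 -> differentiable f (x + t *: h)) ->
  exists2 t, 0 <= t <= 1 & f (x + h) - f x = 'd f (x + t *: h) h.
Proof.
move=> Df.
pose l (t : R^o) := x + t *: h.
have dl (t : R) : is_diff (t : R^o) l (fun s => s *: h).
  by apply: is_diff_eq; rewrite funeqE => s /=; rewrite !fctE add0r.
have Dphi (t : R) : 0 <= t <= 1 -> is_derive (t : R^o) 1 (f \o l) ('d f (x + t *: h) h).
  move=> t01.
  have d1 : differentiable l (t : R^o) by exact: ex_diff.
  have d2 : differentiable f (l t) by exact: Df.
  have d3 : differentiable (f \o l) (t : R^o) by exact: differentiable_comp.
  apply: DeriveDef; first exact: diff_derivable.
  by rewrite deriveE// diff_comp//= (diff_val (is_diff_def := dl t)) scale1r.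
have [//||c c01 E] := @MVT_segment R (f \o l) (fun t => 'd f (x + t *: h) h) 0 1 ler01.
- by move=> t; rewrite in_itv/= => /andP[/ltW t0 /ltW t1]; apply: Dphi; rewrite t0 t1.
- apply: derivable_within_continuous => t; rewrite in_itv/= => t01.
  exact: (ex_derive (is_derive := Dphi t t01)).
exists c; first by move: c01; rewrite in_itv.
by move: E; rewrite /= /l scale1r scale0r addr0 subr0 mulr1.
Qed.

End Ck.

(** * Mean values, symmetry of second derivatives, the inverse function theorem *)

Section Calc.
Context {R : realType}.
Implicit Types U V W : normedModType R.

Lemma near_cvg_eps U (D : set U) (f : U -> R^o) (x : U) (e : R) : open D -> D x ->
  Ck_on 0 D f -> 0 < e -> \forall y \near x, D y /\ `|f y - f x| < e.
Proof.
move=> oD Dx cf e0; near=> y; split; first by near: y; exact: open_nbhs_nbhs.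
rewrite distrC; near: y.
have /cvgrPdist_lt : f y @[y --> x] --> (f x : R^o) by exact: cf.
by apply.
Unshelve. all: by end_near. Qed.

Lemma ball_norm_ex U (x : U) (P : U -> Prop) : (\forall y \near x, P y) ->
  exists2 r : R, 0 < r & forall y, `|y - x| < r -> P y.
Proof.
move=> /nbhs_ballP[r /= r0 H]; exists r => // y yx; apply: H.
by rewrite -ball_normE /= distrC.
Qed.

(** The mean value theorem is applied twice: to [y |-> f (y + s w) - f y] along [s v], then to
    [z |-> 'd f z v] along [s w]. The left-hand side is symmetric in [v] and [w], which is the
    point. *)
Lemma double_difference U (D : set U) (f : U -> R^o) (x v w : U) (r s : R) :
  Ck_on 2 D f -> (forall y, `|y - x| < r -> D y) -> 0 < s ->
  s * (`|v| + `|w|) < r ->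
  exists2 y, `|y - x| < r &
    f (x + s *: v + s *: w) - f (x + s *: v) - (f (x + s *: w) - f x) =
    s * s * 'd (fun z => 'd f z v) y w.
Proof.
move=> Hf Br s0 sr.
have D1 y : D y -> differentiable f y by exact: Ck_on_diff Hf.
have D2 y : D y -> differentiable (fun z => 'd f z v : R^o) y.
  exact: Ck_on_diff (Ck_on_d v Hf).
have near_x a b : 0 <= a <= 1 -> 0 <= b <= 1 ->
    `|x + a *: (s *: v) + b *: (s *: w) - x| < r.
  move=> /andP[a0 a1] /andP[b0 b1]; rewrite -[x + _ + _]addrA [x + _]addrC addrK.
  apply: le_lt_trans sr; apply: (le_trans (ler_normD _ _)).
  rewrite !normrZ (ger0_norm a0) (ger0_norm b0) (gtr0_norm s0) mulrDr lerD//.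
  - by rewrite ler_piMl// mulr_ge0// ltW.
  - by rewrite ler_piMl// mulr_ge0// ltW.
have nx1 a : 0 <= a <= 1 -> `|x + a *: (s *: v) + s *: w - x| < r.
  by move=> /near_x/(_ (_ : 0 <= 1 <= 1)); rewrite scale1r; apply; rewrite ler01 lexx.
have nx0 a : 0 <= a <= 1 -> `|x + a *: (s *: v) - x| < r.
  by move=> /near_x/(_ (_ : 0 <= 0 <= 1)); rewrite scale0r addr0; apply; rewrite ler01 lexx.
pose g (y : U) : R^o := f (y + s *: w) - f y.
have dg t : 0 <= t <= 1 -> differentiable g (x + t *: (s *: v)) /\
    'd g (x + t *: (s *: v)) (s *: v) =
    'd f (x + t *: (s *: v) + s *: w) (s *: v) - 'd f (x + t *: (s *: v)) (s *: v).
  move=> t01; set y := x + _.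
  have [i1 i2] := diff_id_ptw y; have [c1 c2] := diff_cst_ptw (s *: w) y.
  have [e1 e1'] := diffD_ptw i1 c1.
  have e2 : differentiable f (y + s *: w) by exact/D1/Br/nx1.
  have e3 : differentiable f y by exact/D1/Br/nx0.
  have [e4 e4'] := diff_comp_ptw e1 e2.
  have [e5 e5'] := diffB_ptw e4 e3.
  split; first exact: e5.
  have e6 : 'd (fun z => z + s *: w) y (s *: v) = s *: v.
    by apply: etrans (e1' _) _; rewrite i2 c2 addr0.
  apply: etrans (e5' _) _; congr (_ - _); apply: etrans (e4' _) _.
  by congr ('d _ _ _); exact: e6.
have [t t01] := MVT_diff (fun t t01 => (dg t t01).1).
rewrite /g (dg t t01).2 => Eg.
have [u u01] := @MVT_diff _ _ (fun z => 'd f z v : R^o) (x + t *: (s *: v)) (s *: w)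
  (fun u u01 => D2 _ (Br _ (near_x t u t01 u01))).
move=> Eu; exists (x + t *: (s *: v) + u *: (s *: w)); first exact: near_x.
rewrite Eg; have Z a (b : U) : 'd f a (s *: b) = s * 'd f a b :> R by rewrite linearZ.
rewrite !Z -mulrBr -mulrA; congr (_ * _).
by apply: etrans Eu _; rewrite linearZ.
Qed.

Lemma half_close (a A B : R) : `|a - A| < `|A - B| / 2 -> `|a - B| < `|A - B| / 2 -> False.
Proof.
move=> H1 H2; suff : `|A - B| < `|A - B| by rewrite ltxx.
rewrite {1}(_ : A - B = (a - B) - (a - A)); last by ring.
by rewrite (le_lt_trans (ler_normB _ _))// [ltRHS]splitr ltrD.
Qed.

(** By symmetry of the double difference, the two mixed derivatives take a common value at two
    points near [x]. By continuity that value lies within half of [|A - B|] of both [A] and [B], so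
    they cannot differ. *)
Lemma diff2_sym U (D : set U) (f : U -> R^o) x v w : open D -> D x -> Ck_on 2 D f ->
  'd (fun y => 'd f y v) x w = 'd (fun y => 'd f y w) x v :> R.
Proof.
move=> oD Dx Hf; apply/eqP; rewrite -subr_eq0 -normr_eq0; apply: contraT => nz.
set A : R := 'd (fun y => 'd f y v : R^o) x w; set B : R := 'd (fun y => 'd f y w : R^o) x v.
set e := `|A - B|.
have e0 : 0 < e / 2 by rewrite divr_gt0// lt_neqAle eq_sym nz normr_ge0.
have [r1 r10 H1] := ball_norm_ex (near_cvg_eps oD Dx (Ck_on_d w (Ck_on_d v Hf)) e0).
have [r2 r20 H2] := ball_norm_ex (near_cvg_eps oD Dx (Ck_on_d v (Ck_on_d w Hf)) e0).
set r := Num.min r1 r2.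
have r0 : 0 < r by rewrite lt_min r10.
(* The summand 1 keeps the denominator positive when [v] and [w] both vanish. *)
pose s := r / (`|v| + `|w| + 1).
have d0 : 0 < `|v| + `|w| + 1 by rewrite ltr_wpDl// addr_ge0.
have s0 : 0 < s by rewrite divr_gt0.
have sr : s * (`|v| + `|w|) < r.
  by rewrite /s mulrAC ltr_pdivrMr// ltr_pM2l// ltrDl.
have Br y : `|y - x| < r -> D y by rewrite lt_min => /andP[/H1[]].
have [y yr Ey] := double_difference Hf Br s0 sr.
have [|z zr Ez] := @double_difference _ D f x w v r s Hf Br s0; first by rewrite [`|w| + _]addrC.
have ss : s * s != 0 by rewrite mulf_neq0// gt_eqF.
have E : 'd (fun z => 'd f z v) y w = 'd (fun z => 'd f z w) z v :> R.
  apply: (mulfI ss); rewrite -Ey -Ez (addrAC x (s *: w)).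
  have gen (a b c d : R) : a - b - (c - d) = a - c - (b - d) by ring.
  exact: gen.
have [yr1 _] : `|y - x| < r1 /\ `|y - x| < r2 by apply/andP; rewrite -lt_min.
have [_ zr2] : `|z - x| < r1 /\ `|z - x| < r2 by apply/andP; rewrite -lt_min.
have [_ yA] := H1 y yr1; have [_ zB] := H2 z zr2.
case: (half_close yA); move: zB; rewrite -E; exact.
Qed.

Lemma diff_rV U n (f : U -> 'rV[R]_n) x v j : differentiable f x ->
  ('d f x v) 0 j = 'd (fun y => f y 0 j : R^o) x v.
Proof.
move=> df; have dl : differentiable (@coordl R 1 n 0 j) (f x).
  by apply: linear_differentiable; exact: coordl_continuous.
have := @diff_comp _ _ _ _ f (@coordl R 1 n 0 j) x df dl.
rewrite diff_lin; last exact: coordl_continuous.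
by move=> /(congr1 (fun F : U -> R^o => F v)) /= E; exact: esym E.
Qed.

Lemma differentiable_rV_coord U n (f : U -> 'rV[R]_n) x j : differentiable f x ->
  differentiable (fun y => f y 0 j : R^o) x.
Proof.
move=> df; have dl : differentiable (@coordl R 1 n 0 j) (f x).
  by apply: linear_differentiable; exact: coordl_continuous.
exact: (@differentiable_comp _ _ _ _ f (@coordl R 1 n 0 j)).
Qed.

Lemma diff2_sym_rV U n (D : set U) (f : U -> 'rV[R]_n) x v w :
  open D -> D x -> Ck_on 2 D f ->
  'd (fun y => 'd f y v) x w = 'd (fun y => 'd f y w) x v.
Proof.
move=> oD Dx Hf; apply/rowP => j.
have df u : differentiable (fun y => 'd f y u) x by exact: Ck_on_diff (Ck_on_d u Hf) Dx.
have Hj : Ck_on 2 D (fun y => f y 0 j : R^o) by exact: Ck_on_coord.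
rewrite !diff_rV//.
have E u : \forall y \near x, ('d f y u) 0 j = 'd (fun y => f y 0 j : R^o) y u.
  apply: filterS (open_nbhs_nbhs (conj oD Dx)) => y Dy.
  by rewrite diff_rV//; exact: Ck_on_diff Hf Dy.
have K u : differentiable (fun y => ('d f y u) 0 j : R^o) x.
  exact: Ck_on_diff (Ck_on_coord 0 j oD (Ck_on_d u Hf)) Dx.
have := (near_eq_diff (E v) (K v)).2 => /(congr1 (fun F : U -> R^o => F w)) Ev.
have := (near_eq_diff (E w) (K w)).2 => /(congr1 (fun F : U -> R^o => F v)) Ew.
apply: etrans (esym Ev) _; apply: etrans _ Ew; exact: diff2_sym Hj.
Qed.

Lemma norm_rV_le n (v : 'rV[R]_n) (c : R) : 0 <= c ->
  (forall j, `|v 0 j| <= c) -> `|v| <= c.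
Proof.
move=> c0 H; rewrite /Num.Def.normr/= mx_normrE.
by apply: bigmax_le => // -[i j] _ /=; rewrite ord1.
Qed.

Lemma norm_coord_le n (v : 'rV[R]_n) j : `|v 0 j| <= `|v|.
Proof. by rewrite [leRHS]/Num.Def.normr/= mx_normrE; exact: (le_bigmax _ _ (0, j)). Qed.

(** The norm of a row is the maximum of its entries, so the scalar mean value theorem on each
    coordinate gives the vector estimate with the same constant. *)
Lemma contraction_of_diff n (h : 'rV[R]_n -> 'rV[R]_n) (x0 : 'rV[R]_n) r :
  (forall y, `|y - x0| < r -> differentiable h y /\
     forall v, `|'d h y v| <= 2^-1 * `|v|) ->
  forall x y, `|x - x0| < r -> `|y - x0| < r -> `|h y - h x| <= 2^-1 * `|y - x|.
Proof.
move=> H x y xr yr; apply: norm_rV_le => [|j]; first by rewrite mulr_ge0.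
have seg t : 0 <= t <= 1 -> `|x + t *: (y - x) - x0| < r.
  move=> /andP[t0 t1].
  have -> : x + t *: (y - x) - x0 = (1 - t) *: (x - x0) + t *: (y - x0).
    by rewrite !scalerBr !scalerBl !scale1r; apply/rowP => k; rewrite !mxE; ring.
  apply: (le_lt_trans (ler_normD _ _)); rewrite !normrZ.
  rewrite (ger0_norm t0) (@ger0_norm _ (1 - t)) ?subr_ge0//.
  move: xr yr; set a := `|x - x0|; set b := `|y - x0| => xr yr.
  have [->|tn0] := eqVneq t 0; first by rewrite subr0 mul1r mul0r addr0.
  have t0' : 0 < t by rewrite lt_neqAle eq_sym tn0.
  have : t * b < t * r by rewrite ltr_pM2l.
  have : (1 - t) * a <= (1 - t) * r by rewrite ler_wpM2l ?subr_ge0// ltW.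
  lra.
have [t t01] := @MVT_diff R _ (fun z => h z 0 j : R^o) x (y - x) (fun t t01 =>
   differentiable_rV_coord j (H _ (seg t t01)).1).
rewrite [x + _]addrC subrK [(h y - h x) 0 j]mxE [(- h x) 0 j]mxE => ->.
rewrite -diff_rV; last exact: (H _ (seg t t01)).1.
exact: le_trans (norm_coord_le _ _) ((H _ (seg t t01)).2 _).
Qed.

Lemma smooth_jacobian_close n (D : set 'rV[R]_n) (F : 'rV[R]_n -> 'rV[R]_n) x0 (c : R) :
  open D -> D x0 -> smooth_on D F -> 'J F x0 = 1%:M -> 0 < c ->
  \forall y \near x0, D y /\ forall i j, `|('J F y) i j - (i == j)%:R| < c.
Proof.
move=> oD Dx F1 J1 c0; apply: filterI; first exact: open_nbhs_nbhs.
suff H i j : \forall y \near x0, `|('J F y) i j - (i == j)%:R| < c.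
  have H' i : \forall y \near x0, forall j, `|('J F y) i j - (i == j)%:R| < c.
    exact: filter_forall (H i).
  exact: filter_forall H'.
have := near_cvg_eps oD Dx (smooth_Jcoord i j oD (F1 1%N)) c0.
by apply: filterS => y []; rewrite J1 [1%:M i j]mxE.
Qed.

Lemma jacobianE n m (f : 'rV[R]_n -> 'rV[R]_m) x v : v *m 'J f x = 'd f x v.
Proof. by rewrite /jacobian mul_rV_lin1. Qed.

Lemma jacobian_diff n m (f : 'rV[R]_n -> 'rV[R]_m) x (A : 'M[R]_(n, m)) :
  'd f x = (fun v => v *m A) :> (_ -> _) -> 'J f x = A.
Proof. by move=> E; apply/row_matrixP => i; rewrite !rowE jacobianE E. Qed.

Lemma linear_rV_continuous n V (L : {linear 'rV[R]_n -> V}) : continuous L.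
Proof.
rewrite (_ : (L : 'rV[R]_n -> V) = fun v => \sum_i (v 0 i : R^o) *: L (delta_mx 0 i)).
  suff H : Ck_on 0 setT (fun v : 'rV[R]_n => \sum_i (v 0 i : R^o) *: L (delta_mx 0 i)).
    by move=> x; exact: H.
  apply: Ck_on_sum => [|i _]; first exact: openT.
  apply: Ck_on_scale; [exact: openT| |exact: Ck_on_cst].
  apply: (@Ck_on_linear _ _ _ 0%N setT (@coordl R 1 n 0 i)); first exact: openT.
  exact: coordl_continuous.
apply/funext => v; rewrite {1}(row_sum_delta v) linear_sum.
by apply: eq_bigr => i _; rewrite linearZ.
Qed.

Section InverseFunctionId.
Context {n : nat}.
Variables (D : set 'rV[R]_n) (F : 'rV[R]_n -> 'rV[R]_n) (x0 : 'rV[R]_n).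
Hypotheses (oD : open D) (Dx0 : D x0) (sF : smooth_on D F) (J1 : 'J F x0 = 1%:M).

Let h (x : 'rV[R]_n) := x - F x.

Lemma inverse_function_radius : exists2 r : R, 0 < r &
  (forall y, `|y - x0| < r -> D y) /\
  (forall x y, `|x - x0| < r -> `|y - x0| < r -> `|h y - h x| <= 2^-1 * `|y - x|) /\
  (forall y, `|y - x0| < r -> 'J F y \in unitmx).
Proof.
(* A sum of [n] products, each at most [|v| / (2 (n + 1))], stays below [|v| / 2]; taking [n.+1]
   covers [n = 0]. *)
have c0 : 0 < (2 * n.+1%:R)^-1 :> R by rewrite invr_gt0 mulr_gt0.
have [r r0 H] := ball_norm_ex (smooth_jacobian_close oD Dx0 sF J1 c0).
have small y v : `|y - x0| < r -> `|v - 'd F y v| <= 2^-1 * `|v|.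
  move=> yr; have [Dy HJ] := H y yr.
  apply: norm_rV_le => [|j]; first by rewrite mulr_ge0.
  have -> : v - 'd F y v = v *m (1%:M - 'J F y) by rewrite mulmxBr mulmx1 jacobianE.
  rewrite mxE; apply: (le_trans (ler_norm_sum _ _ _)).
  apply: (@le_trans _ _ (\sum_(i < n) `|v| * (2 * n.+1%:R)^-1)).
    apply: ler_sum => i _; rewrite normrM ler_pM//; first exact: norm_coord_le.
    by rewrite [(1%:M - _) i j]mxE [1%:M i j]mxE [(- 'J F y) i j]mxE distrC; exact/ltW/HJ.
  rewrite sumr_const card_ord -mulrnAr mulrC ler_wpM2r// invfM -mulrnAr.
  rewrite -[X in _ <= X]mulr1 ler_wpM2l// -mulr_natr ler_pdivrMl// mulr1 ler_nat//.
exists r => //; split; last split.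
- by move=> y /H[].
- apply: contraction_of_diff => y yr; have [Dy _] := H y yr.
  have dF : differentiable F y by exact: Ck_on_diff (sF 1%N) Dy.
  have [di di'] := diff_id_ptw y; have [dh dh'] := diffB_ptw di dF.
  split=> [|v]; first exact: dh.
  have E : 'd h y v = v - 'd F y v.
    by apply: etrans (dh' v) _; congr (_ - _); exact: di'.
  by rewrite E; exact: small.
(* A vector of the kernel of ['J F y] satisfies [|v| <= |v| / 2], hence is zero. *)
- move=> y yr; rewrite -row_free_unit -kermx_eq0; apply/eqP/row_matrixP => i.
  rewrite row0; apply/eqP; rewrite -normr_eq0.
  have := small y (row i (kermx ('J F y))) yr.
  rewrite -jacobianE -row_mul mulmx_ker row0 subr0.
  have := normr_ge0 (row i (kermx ('J F y))).
  move: `|_| => a; lra.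
Qed.

(** Openness comes from minimising [|F x - y|] on a closed ball: a minimiser with non-zero residue
    would be improved by one step of the contraction [h]. It is stated for every open subset of [O],
    because charts are later shrunk inside [O]. *)
Theorem inverse_function_id : exists (O : set 'rV[R]_n) (g : 'rV[R]_n -> 'rV[R]_n),
  [/\ open O /\ O `<=` D, O x0, forall O' : set 'rV[R]_n, open O' -> O' `<=` O -> open (F @` O'),
      forall x, O x -> g (F x) = x & smooth_on (F @` O) g].
Proof.
have [r r0 [rD [hL uJ]]] := inverse_function_radius.
pose O := [set x | `|x - x0| < r].
have OD z : O z -> D z by exact: rD.
have oO : open O.
  rewrite (_ : O = ball x0 r); first exact: ball_open.
  by rewrite -ball_normE; apply/seteqP; split=> x /=; rewrite distrC.
have Fh x : F x = x - h x by rewrite /h opprB addrC subrK.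
have lowF x y : O x -> O y -> `|y - x| <= 2 * `|F y - F x|.
  move=> Ox Oy; have := hL x y Ox Oy.
  have -> : F y - F x = (y - x) - (h y - h x) by rewrite !Fh; apply/rowP => k; rewrite !mxE; ring.
  have := lerB_normD (y - x) (- (h y - h x)); rewrite normrN.
  lra.
have injF x y : O x -> O y -> F x = F y -> x = y.
  move=> Ox Oy E; apply/eqP; rewrite eq_sym -subr_eq0 -normr_le0.
  by have := lowF x y Ox Oy; rewrite E subrr normr0 mulr0.
have opF (O' : set 'rV[R]_n) : open O' -> O' `<=` O -> open (F @` O').
  move=> oO' O'O; rewrite openE => _ [x1 O'x1 <-].
  have [e e0 He] : exists2 e : R, 0 < e & forall y, `|y - x1| <= e -> O' y.
    have [e e0 He] := ball_norm_ex (open_nbhs_nbhs (conj oO' O'x1)).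
    exists (e / 2); first by rewrite divr_gt0.
    by move=> y ye; apply: He; apply: le_lt_trans ye _; rewrite ltr_pdivrMr// ltr_pMr// ltr1n.
  have Ox1 := O'O _ O'x1.
  apply/nbhs_ballP; exists (e / 2) => /=; first by rewrite divr_gt0.
  move=> y; rewrite -ball_normE /= => yF.
  pose K := [set x | `|x - x1| <= e].
  have [c Kc cmin] : exists2 c, K c & forall t, K t -> `|F c - y| <= `|F t - y|.
    have K0 : K !=set0 by exists x1; rewrite /K/= subrr normr0 ltW.
    have KO z : K z -> O z by move=> Kz; exact/O'O/He.
    have cK : compact K.
      apply: bounded_closed_compact.
        exists (e + `|x1|); split; first exact: num_real.
        move=> M eM z; rewrite /K/= => Kz; apply/ltW/(le_lt_trans _ eM).
        by rewrite -[z](subrK x1) (le_trans (ler_normD _ _))// lerD2r.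
      rewrite (_ : K = closed_ball x1 e); first exact: closed_ball_closed.
      by rewrite closed_ballE//; apply/seteqP; split=> z; rewrite /K /closed_ball_/= distrC.
    have cf : {within K, continuous (fun z => `|F z - y|)}.
      apply: continuous_in_subspaceT => z; rewrite inE => /KO/OD Dz.
      apply: continuous_comp; last exact: norm_continuous.
      apply: continuousB; last exact: cst_continuous.
      exact: (sF 0%N).
    have [c cK' cmin] := EVT_min_rV K0 cK cf; exists c; first by rewrite inE in cK'.
    by move=> t Kt; apply: cmin; rewrite inE.
  suff E : F c = y by exists c => //; exact: He.
  apply/eqP; rewrite -subr_eq0 -normr_eq0; apply: contraT => nz.
  (* The next iterate of [x |-> y + h x]: here [F t - y = h c - h t] and [c - t = F c - y], so the
     residue at [t] is at most half of the residue at [c]. *)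
  pose t := y + h c.
  have Oc : O c by exact/O'O/He.
  have Kt : K t.
    rewrite /K/= /t (_ : y + h c - x1 = (h c - h x1) - (F x1 - y)); last first.
      by rewrite (Fh x1); apply/rowP => k; rewrite !mxE; ring.
    apply: (le_trans (ler_normB _ _)).
    have := hL x1 c Ox1 Oc; move: Kc; rewrite /K/=.
    move: yF; lra.
  have Ot : O t by exact/O'O/He.
  have := cmin t Kt.
  have -> : F t - y = h c - h t by rewrite Fh /t; apply/rowP => k; rewrite !mxE; ring.
  have := hL t c Ot Oc.
  have -> : c - t = F c - y by rewrite Fh /t; apply/rowP => k; rewrite !mxE; ring.
  have : 0 < `|F c - y| by rewrite lt_neqAle eq_sym nz normr_ge0.
  lra.
pose g y := if pselect (exists2 x, O x & F x = y) is left e then s2val (cid2 e) else 0.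
have gF x : O x -> g (F x) = x.
  move=> Oxx; rewrite /g; case: pselect => [e|[]]; last by exists x.
  case: (cid2 e) => z /= Oz Fz; exact: injF.
have oFO : open (F @` O) by exact: opF.
have dgF y : (F @` O) y -> differentiable g y /\
    forall v, 'd g y v = v *m invmx ('J F (g y)).
  move=> [x Oxx <-{y}]; rewrite gF//; have Ju := uJ x Oxx.
  set A := invmx _.
  have cA : continuous (mulmxr A : 'rV[R]_n -> 'rV[R]_n) by exact: linear_rV_continuous.
  have [k k0 kA] := linear_lipschitz cA.
  suff : differentiable g (F x) /\ 'd g (F x) = mulmxr A :> ('rV[R]_n -> 'rV[R]_n).
    by move=> [dg dgE]; split=> // v; rewrite dgE.
  apply: diff_epsP => // e e0.
  have dFx : differentiable F x by exact: Ck_on_diff (sF 1%N) (OD _ Oxx).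
  have e'0 : 0 < e / (2 * k) by rewrite divr_gt0// mulr_gt0.
  have [d d0 Hd] := ball_norm_ex (diff_eps dFx e'0).
  have [d' d'0 Hd'] := ball_norm_ex (open_nbhs_nbhs (conj oFO (ex_intro2 _ _ x Oxx erefl : (F @` O) (F x)))).
  have m0 : 0 < Num.min d' (d / 2) by rewrite lt_min d'0 divr_gt0.
  apply/nbhs_ballP; exists (Num.min d' (d / 2)) => //= w.
  rewrite -ball_normE /= sub0r normrN lt_min => /andP[wd' wd].
  have [z Oz Fz] : (F @` O) (w + F x) by apply: Hd'; rewrite addrK.
  rewrite -Fz !gF//.
  have wE : w = F z - F x by rewrite Fz addrK.
  have zx : `|z - x| <= 2 * `|w| by rewrite wE; exact: lowF.
  have zd : `|z - x - 0| < d by rewrite subr0; move: zx wd; lra.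
  have := Hd _ zd; rewrite subrK -wE => Hz.
  have -> : z - x - mulmxr A w = - mulmxr A (w - 'd F x (z - x)).
    rewrite /= mulmxBl -jacobianE -mulmxA mulmxV// mulmx1; apply/rowP => j; rewrite !mxE; ring.
  rewrite normrN; apply: (le_trans (kA _)).
  apply: (@le_trans _ _ (k * (e / (2 * k) * (2 * `|w|)))).
    rewrite ler_pM2l//; apply: (le_trans Hz).
    by rewrite ler_pM2l.
  by rewrite le_eqVlt; apply/orP; left; apply/eqP; field; rewrite gt_eqF.
exists O, g; split=> //; first by rewrite /O/= subrr normr0.
(* The derivative of [g] at [y] is the inverse Jacobian of [F] at [g y]; it is as regular as [g], so
   each round of the induction gains one order. *)
elim=> [|k IH]; first by move=> y /dgF[dg _]; exact: differentiable_continuous dg.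
apply: (Ck_on_step (df := fun y v => v *m invmx ('J F (g y)))) => // [y /dgF[]//|y v /dgF[]//|v].
apply: (@Ck_on_comp _ _ _ _ _ _ O g (fun x => v *m invmx ('J F x))) => //.
- exact: finite_basis_rV.
- by move=> _ [x Oxx <-]; rewrite gF.
- apply: Ck_on_rV => // j.
  under eq_fun do rewrite mxE.
  apply: Ck_on_sum => // i _; apply: Ck_on_mul => //; first exact: Ck_on_cst.
  apply: Ck_on_invmx => // a b.
  by apply: smooth_Jcoord => //; apply: Ck_on_sub (sF _) => x /OD.
Qed.
End InverseFunctionId.

Theorem inverse_function n (D : set 'rV[R]_n) (F : 'rV[R]_n -> 'rV[R]_n) x0 :
  open D -> D x0 -> smooth_on D F -> 'J F x0 \in unitmx ->
  exists (O : set 'rV[R]_n) (g : 'rV[R]_n -> 'rV[R]_n),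
  [/\ open O /\ O `<=` D, O x0, forall O' : set 'rV[R]_n, open O' -> O' `<=` O -> open (F @` O'),
      forall x, O x -> g (F x) = x & smooth_on (F @` O) g].
Proof.
move=> oD Dx0 sF Ju; set A := 'J F x0.
have cA : continuous (mulmxr (invmx A) : 'rV[R]_n -> 'rV[R]_n) by exact: linear_rV_continuous.
pose F' x := F x *m invmx A.
have sF' : smooth_on D F'.
  by move=> k; exact: (@Ck_on_lin _ _ _ _ _ _ _ (mulmxr (invmx A) : {linear 'rV[R]_n -> 'rV[R]_n})).
have J1 : 'J F' x0 = 1%:M.
  apply: jacobian_diff; apply/funext => v.
  have dF : differentiable F x0 by exact: Ck_on_diff (sF 1%N) Dx0.
  have [dL dL'] := diff_lin_ptw (F x0) cA.
  have [_ dF'] := diff_comp_ptw dF dL.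
  apply: etrans (dF' v) _; apply: etrans (dL' _) _.
  by rewrite /= -jacobianE -mulmxA mulmxV.
have [W [g [[oO OD] Ox0 opF gF sg]]] := inverse_function_id oD Dx0 sF' J1.
have imE (O' : set 'rV[R]_n) : F @` O' = (mulmxr (invmx A)) @^-1` (F' @` O').
  apply/seteqP; split=> [_ [x O'x <-]|y [x O'x]] /=; first by exists x.
  rewrite /F' => /(congr1 (mulmxr A)); rewrite /= -!mulmxA mulVmx// !mulmx1 => <-.
  by exists x.
have opF' (O' : set 'rV[R]_n) : open O' -> O' `<=` W -> open (F @` O').
  by move=> oO' O'O; rewrite imE; apply: open_comp => [x _|]; [exact: cA|exact: opF].
exists W, (g \o mulmxr (invmx A)); split=> // k.
apply: (@Ck_on_comp _ _ _ _ _ _ (F' @` W)) (sg k).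
- exact: finite_basis_rV.
- exact: opF'.
- exact: opF.
- by move=> _ [x Ox <-]; exists x.
- apply: (@Ck_on_linear _ _ _ _ _ (mulmxr (invmx A) : {linear 'rV[R]_n -> 'rV[R]_n})) => //.
  exact: opF'.
Qed.
End Calc.

(** * Invariant means *)

Definition bounded_over (R : realType) (T : Type) (H : set T) (f : T -> R) :=
  exists C : R, forall a, H a -> `|f a| <= C.

(** The functional takes all functions, but is constrained only through their restrictions to [H]:
    linearity is asked on bounded ones, and the bound looks at values on [H] alone. Weights are
    later absorbed in such functionals, hence a general norm [K] and no normalisation. *)
Definition bounded_functional (R : realType) (T : Type) (H : set T)
    (m : (T -> R) -> R) (K : R) :=
  [/\ 0 <= K,
      forall f g c, bounded_over H f -> bounded_over H g ->
        m (fun a => f a + c * g a) = m f + c * m g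
    & forall f C, 0 <= C -> (forall a, H a -> `|f a| <= C) -> `|m f| <= K * C].

Section InvariantMean.
Context {R : realType} {T : comPzRingType}.
Variable (H : set T).
Hypotheses (H1 : H 1) (HM : forall a b, H a -> H b -> H (a * b)).
Implicit Types (f g : T -> R) (S : seq T).

Let cesaro n (s : T) f : T -> R := fun h => n.+1%:R^-1 * \sum_(k < n.+1) f (s ^+ k * h).
Let iter_cesaro n S f : T -> R := foldr (cesaro n) f S.

Let HX s k : H s -> H (s ^+ k).
Proof. by move=> Hs; elim: k => [|k IH]; rewrite ?expr0// exprS; exact: HM. Qed.

Let cesaro_bound n s f (C : R) : H s -> (forall a, H a -> `|f a| <= C) ->
  forall a, H a -> `|cesaro n s f a| <= C.
Proof.
move=> Hs fC a Ha; rewrite normrM ger0_norm ?invr_ge0// ler_pdivrMl//.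
apply: (le_trans (ler_norm_sum _ _ _)).
rewrite mulr_natl -[n.+1 in leRHS]card_ord -sumr_const; apply: ler_sum => k _.
by apply: fC; apply: HM => //; exact: HX.
Qed.

Let iter_cesaro_bound n S f (C : R) : (forall s, s \in S -> H s) ->
  (forall a, H a -> `|f a| <= C) -> forall a, H a -> `|iter_cesaro n S f a| <= C.
Proof.
elim: S => [|s S IH] //= HS fC; apply: cesaro_bound.
  by apply: HS; rewrite mem_head.
by apply: IH => // t tS; apply: HS; rewrite in_cons tS orbT.
Qed.

Let iter_cesaro_lin n S f g c h :
  iter_cesaro n S (fun a => f a + c * g a) h = iter_cesaro n S f h + c * iter_cesaro n S g h.
Proof.
elim: S h => [|s S IH] //= h; rewrite /cesaro.
under eq_bigr do rewrite IH.
by rewrite big_split/= -mulr_sumr mulrDr !mulrA (mulrC c).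
Qed.

Let iter_cesaro_shift n S f s h :
  iter_cesaro n S (fun a => f (s * a)) h = iter_cesaro n S f (s * h).
Proof.
elim: S h => [|t S IH] //= h; rewrite /cesaro; congr (_ * _).
by apply: eq_bigr => k _; rewrite IH mulrCA.
Qed.

(** At the level of [s] itself, the means of [f] and of its translate differ by a telescoping sum
    with two surviving terms, hence [2 C / (n + 1)]. The other levels average this difference and
    commute with the translation, so they keep the bound. *)
Let iter_cesaro_inv n S f s (C : R) : (forall s, s \in S -> H s) -> s \in S ->
  (forall a, H a -> `|f a| <= C) -> forall a, H a ->
  `|iter_cesaro n S (fun a => f (s * a)) a - iter_cesaro n S f a| <= n.+1%:R^-1 * (2 * C).
Proof.
elim: S => [//|t S IH] /= HS + fC.
have Ht : H t by apply: HS; rewrite mem_head.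
have HS' u : u \in S -> H u by move=> uS; apply: HS; rewrite in_cons uS orbT.
rewrite in_cons => /predU1P[-> a Ha|sS a Ha].
  rewrite /cesaro -mulrBr -sumrB.
  under eq_bigr do rewrite iter_cesaro_shift mulrA -exprS.
  rewrite -(big_mkord xpredT (fun k => iter_cesaro n S f (t ^+ k.+1 * a) - iter_cesaro n S f (t ^+ k * a))).
  rewrite telescope_sumr// expr0 mul1r normrM ger0_norm ?invr_ge0// ler_wpM2l ?invr_ge0//.
  rewrite mulr_natl mulr2n (le_trans (ler_normB _ _))// lerD//; apply: iter_cesaro_bound => //.
  by apply: HM => //; exact: HX.
have := @cesaro_bound n t (fun a => iter_cesaro n S (fun a => f (s * a)) a - iter_cesaro n S f a) _ Ht (IH HS' sS fC) a Ha.
by rewrite /cesaro sumrB mulrBr.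
Qed.

(** The tails of a directed set: along them every [s] of [H] eventually belongs to the list, and the
    order of the means grows, so the defect of invariance tends to 0. *)
Let filt : set_system (seq T * nat) :=
  filter_from [set p : seq T * nat | forall s, s \in p.1 -> H s]
    (fun p => [set q : seq T * nat | (forall s, s \in q.1 -> H s) /\ {subset p.1 <= q.1} /\ (p.2 <= q.2)%N]).

Let filt_proper : ProperFilter filt.
Proof.
apply: filter_from_proper; last first.
  by move=> p Hp; exists p; split=> //; split.
apply: filter_from_filter; first by exists ([::], 0%N).
move=> p q Hp Hq; exists (p.1 ++ q.1, maxn p.2 q.2) => /=.
  by move=> s; rewrite mem_cat => /orP[/Hp|/Hq].
move=> r [Hr [pq le]]; split; (split=> //; split; [|by apply: leq_trans le; rewrite ?leq_maxl ?leq_maxr]).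
- by move=> s sp; apply: pq; rewrite mem_cat sp.
- by move=> s sp; apply: pq; rewrite mem_cat sp orbT.
Qed.

(* Instead of a Haar measure: a limit, along an ultrafilter, of iterated Cesaro means over
   the powers of finitely many elements; commutativity makes it invariant. *)
Lemma invariant_mean : exists m : (T -> R) -> R,
  [/\ bounded_functional H m 1, m (fun=> 1) = 1 &
      forall f s, bounded_over H f -> H s -> m (fun a => f (s * a)) = m f].
Proof.
have [G [GU FG]] := ultraFilterLemma filt_proper.
have GP : ProperFilter G by exact: ultra_proper.
pose u f (p : seq T * nat) : R := iter_cesaro p.2 p.1 f 1.
pose m f : R := lim (u f p @[p --> G]).
have nearH S0 n0 : (forall s, s \in S0 -> H s) ->
    \forall p \near G, (forall s, s \in p.1 -> H s) /\ {subset S0 <= p.1} /\ (n0 <= p.2)%N.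
  by move=> HS0; apply: FG; exists (S0, n0).
have bndu f (C : R) : (forall a, H a -> `|f a| <= C) -> \forall p \near G, `|u f p| <= C.
  move=> fC; apply: filterS (@nearH [::] 0%N _) => // p [HS _].
  exact: iter_cesaro_bound.
(* The values eventually lie in the compact segment from [- C] to [C], so they have a cluster point
   along [G], and an ultrafilter converges to its cluster points. *)
have cvgu f : bounded_over H f -> u f p @[p --> G] --> m f.
  move=> [C fC]; have /bndu uC := fC.
  have [/= l [_ ul]] : [set` `[-C, C]] `&` [set l | u f p @[p --> G] --> l] !=set0.
    have uC' : (u f @ G) `[- C, C]%classic.
      by apply: filterS uC => p; rewrite /= in_itv/= -ler_norml.
    have [l [Cl ul]] := @segment_compact R (- C) C _ (fmap_proper_filter (u f) GP) uC'.
    exists l; split=> // V Vl; have [//|GV] := in_ultra_setVsetC (u f @^-1` V) GU.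
    by have [x [/= nVx Vx]] := ul (~` V) V GV Vl.
  by rewrite /m; move/cvg_lim : (ul) => ->.
exists m; split; [split=> //|..].
- move=> f g c bf bg; apply: cvg_lim => //.
  rewrite (_ : (fun p => _) = fun p => u f p + c * u g p); last first.
    by apply/funext => p; exact: iter_cesaro_lin.
  by apply: cvgD; [exact: cvgu|apply: cvgMl_tmp; exact: cvgu].
- move=> f C _ fC; rewrite mul1r.
  have bf : bounded_over H f by exists C.
  exact: cvgr_to_le (cvg_norm (cvgu f bf)) (bndu f C fC).
- apply: cvg_lim => //; rewrite (_ : u _ = fun=> 1); first exact: cvg_cst.
  apply/funext => -[S n]; rewrite /u /=.
  have E h : iter_cesaro n S (fun=> 1) h = 1.
    elim: S h => [//|t S IH] /= h; rewrite /cesaro.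
    under eq_bigr do rewrite IH.
    by rewrite sumr_const card_ord mulVf.
  exact: E.
- move=> f s [C fC] Hs; apply/eqP; rewrite -subr_eq0 -normr_le0; apply/ler_addgt0Pr => e e0.
  rewrite add0r.
  have bf : bounded_over H f by exists C.
  have bfs : bounded_over H (fun a => f (s * a)) by exists C => a Ha; apply: fC; exact: HM.
  have [n0 n0e] : exists n0, n0.+1%:R^-1 * (2 * C) <= e.
    have C0 : 0 <= C by exact: le_trans (fC 1 H1).
    have /archi_boundP : 0 <= 2 * C / e by rewrite divr_ge0 ?mulr_ge0// ltW.
    move: (Num.bound _) => k Hk; exists k; rewrite ler_pdivrMl//.
    rewrite -ler_pdivrMr// (le_trans (ltW Hk))// ler_nat//.
  apply: cvgr_to_le (cvg_norm (cvgB (cvgu _ bfs) (cvgu _ bf))) _.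
  apply: filterS (@nearH [:: s] n0 _); last by move=> t; rewrite inE => /eqP ->.
  move=> p [HS [sS le]]; apply: le_trans n0e.
  change (`|u (fun a => f (s * a)) p - u f p| <= n0.+1%:R^-1 * (2 * C)).
  apply: (le_trans (iter_cesaro_inv p.2 HS (sS s (mem_head _ _)) fC H1)).
  rewrite ler_wpM2r ?mulr_ge0//; first exact: le_trans (fC 1 H1).
  by rewrite lef_pV2 ?posrE// ler_nat.
Qed.
End InvariantMean.

Lemma continuous_eps (R : realType) (U V : normedModType R) (f : U -> V) (x : U) :
  (forall e : R, 0 < e -> exists2 r : R, 0 < r & forall y, `|y - x| < r -> `|f y - f x| <= e) ->
  {for x, continuous f}.
Proof.
move=> H; suff : f y @[y --> x] --> f x by [].
apply/cvgrPdist_le => e e0; have [r r0 Hr] := H e e0.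
by apply/nbhs_ballP; exists r => //= y; rewrite -ball_normE /= distrC [X in X <= e]distrC => /Hr.
Qed.

(** * Smooth dependence of a mean on a parameter *)

Section Parametric.
Context {R : realType} {T : Type}.
Variables (H : set T) (m : (T -> R) -> R) (K : R).
Hypothesis mH : bounded_functional H m K.

Let mB (f g : T -> R) : bounded_over H f -> bounded_over H g ->
  m (fun a => f a - g a) = m f - m g.
Proof.
case: mH => _ mL _ bf bg; rewrite -[- m g]mulN1r -mL//.
by congr m; apply/funext => a; rewrite mulN1r.
Qed.

Let boundedD (f g : T -> R) (c : R) : bounded_over H f -> bounded_over H g ->
  bounded_over H (fun a => f a + c * g a).
Proof.
move=> [A fA] [B gB]; exists (A + `|c| * B) => a Ha.
by rewrite (le_trans (ler_normD _ _))// lerD ?fA// normrM ler_wpM2l// gB.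
Qed.

Let boundedB (f g : T -> R) : bounded_over H f -> bounded_over H g ->
  bounded_over H (fun a => f a - g a).
Proof.
move=> bf bg; have := boundedD (-1) bf bg.
by congr bounded_over; apply/funext => a; rewrite mulN1r.
Qed.

Let bounded0 : bounded_over H (fun=> 0 : R).
Proof. by exists 0 => a _; rewrite normr0. Qed.

Let m_sum (I : Type) (r : seq I) (c : I -> R) (f : I -> T -> R) :
  (forall i, bounded_over H (f i)) ->
  bounded_over H (fun a => \sum_(i <- r) c i * f i a) /\
  m (fun a => \sum_(i <- r) c i * f i a) = \sum_(i <- r) c i * m (f i).
Proof.
move=> bf; elim: r => [|i r [IHb IH]].
  under eq_fun do rewrite big_nil; rewrite big_nil; split; first exact: bounded0.
  have := mB bounded0 bounded0; under eq_fun do rewrite subrr.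
  by rewrite subrr.
under eq_fun do rewrite big_cons addrC.
split; first exact: boundedD.
by case: mH => _ mL _; rewrite mL// IH big_cons addrC.
Qed.

Context {P : normedModType R} {n : nat}.
Variables (C : set P) (X : T -> P) (Om : set (P * 'rV[R]_n)) (D : set 'rV[R]_n).
Hypotheses (cC : compact C) (XC : forall a, H a -> C (X a)).
Hypotheses (oOm : open Om) (oD : open D) (CD : forall p x, C p -> D x -> Om (p, x)).
Let U := (P * 'rV[R]_n)%type.
Implicit Types (F G : U -> R^o).

(** Compactness of the parameter set [C] makes continuity in the second variable uniform over it; a
    bounded functional only tolerates errors that are uniform. *)
Let param_unif G x (e : R) : Ck_on 0 Om G -> D x -> 0 < e ->
  exists2 r : R, 0 < r & forall y, `|y - x| < r ->
    D y /\ forall p, C p -> `|G (p, y) - G (p, x)| <= e.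
Proof.
move=> cG Dx e0.
have e20 : 0 < e / 2 by rewrite divr_gt0.
suff Hn : \forall y \near x, D y /\ forall p, C p -> `|G (p, y) - G (p, x)| <= e.
  exact: ball_norm_ex Hn.
apply: filterI; first exact: open_nbhs_nbhs.
have := (compact_near_coveringP C).1 cC _ (nbhs x) (fun y p => `|G (p, y) - G (p, x)| <= e).
apply=> p Cp.
have := near_cvg_eps oOm (CD Cp Dx) cG e20.
case=> -[A B] /= [nA nB] AB; exists (A, B); first by split.
move=> [q y] [/= Aq By].
have [_ h1] := AB (q, y) (conj Aq By).
have [_ h2] := AB (q, x) (conj Aq (nbhs_singleton nB)).
rewrite (_ : G (q, y) - G (q, x) = (G (q, y) - G (p, x)) - (G (q, x) - G (p, x))); last by ring.
by rewrite (le_trans (ler_normB _ _))// [leRHS]splitr lerD// ltW.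
Qed.

Lemma param_bounded G x : Ck_on 0 Om G -> D x -> bounded_over H (fun a => G (X a, x)).
Proof.
move=> cG Dx.
have Hc : \forall M \near +oo_R, C `<=` (fun p => `|G (p, x)| <= M).
  apply: ((compact_near_coveringP C).1 cC _ (+oo_R) (fun M p => `|G (p, x)| <= M)) => p Cp.
  have := near_cvg_eps oOm (CD Cp Dx) cG ltr01.
  case=> -[A B] /= [nA nB] AB.
  exists (A, [set M | `|G (p, x)| + 1 <= M]); first by split=> //; exact: nbhs_pinfty_ge.
  move=> [q M] [/= Aq HM]; apply: le_trans HM.
  have [_ h1] := AB (q, x) (conj Aq (nbhs_singleton nB)).
  by rewrite -lerBlDl (le_trans (lerB_dist _ _))// ltW.
by have [M HM] := filter_ex Hc; exists M => a /XC; exact: HM.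
Qed.

Let pairr (v : 'rV[R]_n) : U := (0, v).

Let diff_pairr_sum F q (v : 'rV[R]_n) :
  'd F q (pairr v) = \sum_i v 0 i * 'd F q (pairr (delta_mx 0 i)) :> R.
Proof.
have -> : pairr v = \sum_i (v 0 i : R) *: pairr (delta_mx 0 i).
  rewrite [RHS]surjective_pairing.
  have E1 (I : Type) (r : seq I) (f : I -> U) : (\sum_(i <- r) f i).1 = \sum_(i <- r) (f i).1.
    by elim/big_rec2: _ => // i y1 y2 _ <-.
  have E2 (I : Type) (r : seq I) (f : I -> U) : (\sum_(i <- r) f i).2 = \sum_(i <- r) (f i).2.
    by elim/big_rec2: _ => // i y1 y2 _ <-.
  rewrite E1 E2 /= big1 => [|i _]; last by rewrite scaler0.
  by rewrite -row_sum_delta.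
by rewrite linear_sum; apply: eq_bigr => i _; rewrite linearZ.
Qed.

(** The remainder of the first-order expansion is, by the mean value theorem, a variation of the
    partial derivatives; it is small uniformly over [C], and a bounded functional turns this into
    differentiability of the mean. *)
Lemma param_diff F x : Ck_on 1 Om F -> D x ->
  differentiable (fun y => m (fun a => F (X a, y)) : R^o) x /\
  forall v, 'd (fun y => m (fun a => F (X a, y)) : R^o) x v = m (fun a => 'd F (X a, x) (0, v)).
Proof.
move=> F1 Dx.
pose G (i : 'I_n) : U -> R^o := fun q => 'd F q (pairr (delta_mx 0 i)).
have cG i : Ck_on 0 Om (G i) by exact: Ck_on_d.
have bG i y : D y -> bounded_over H (fun a => G i (X a, y)) by exact: param_bounded.
have bF y : D y -> bounded_over H (fun a => F (X a, y)).
  by move=> Dy; apply: param_bounded => //; exact: Ck_onS.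
pose l (v : 'rV[R]_n) : R^o := \sum_i v 0 i * m (fun a => G i (X a, x)).
have lE v : bounded_over H (fun a => 'd F (X a, x) (pairr v)) /\
    m (fun a => 'd F (X a, x) (pairr v)) = l v.
  by under eq_fun do rewrite diff_pairr_sum; apply: m_sum => i; exact: bG.
have ll : linear l.
  move=> c u v; rewrite /l scaler_sumr -big_split; apply: eq_bigr => i _ /=.
  by rewrite !mxE mulrDl /GRing.scale/= mulrA.
pose L : {linear 'rV[R]_n -> R^o} := HB.pack l (GRing.isLinear.Build _ _ _ _ l ll).
suff : differentiable (fun y => m (fun a => F (X a, y)) : R^o) x /\
    'd (fun y => m (fun a => F (X a, y)) : R^o) x = L :> ('rV[R]_n -> R^o).
  by move=> [? E]; split=> // v; rewrite E (lE v).2.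
apply: diff_epsP => [|e e0]; first exact: linear_rV_continuous.
have [K0 mL mK] := mH.
(* The error is shared between the [n] coordinates and the norm [K] of the functional; both are
   increased by 1 to be positive. *)
pose e' := e / ((K + 1) * n.+1%:R).
have K1 : 0 < K + 1 by rewrite ltr_wpDl.
have e'0 : 0 < e' by rewrite divr_gt0// mulr_gt0.
have [r r0 Hr] : exists2 r : R, 0 < r & forall y, `|y - x| < r ->
    D y /\ forall i p, C p -> `|G i (p, y) - G i (p, x)| <= e'.
  suff Hn : \forall y \near x, D y /\ forall i p, C p -> `|G i (p, y) - G i (p, x)| <= e'.
    exact: ball_norm_ex Hn.
  apply: filterI; first exact: open_nbhs_nbhs.
  suff Hn (i : 'I_n) : \forall y \near x, forall p, C p -> `|G i (p, y) - G i (p, x)| <= e'.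
    exact: filter_forall Hn.
  have [r r0 Hr] := param_unif (cG i) Dx e'0.
  by apply/nbhs_ballP; exists r => // y; rewrite -ball_normE /= distrC => /Hr[].
apply/nbhs_ballP; exists r => //= h; rewrite -ball_normE /= sub0r normrN => hr.
have hx t : 0 <= t <= 1 -> `|x + t *: h - x| < r.
  move=> /andP[t0 t1]; rewrite addrC addKr normrZ ger0_norm//.
  by apply: le_lt_trans hr; rewrite ler_piMl.
have Dhx : D (h + x).
  have [|+ _] := Hr _ (hx 1 _); first by rewrite ler01 lexx.
  by rewrite scale1r addrC.
have -> : m (fun a => F (X a, h + x)) - m (fun a => F (X a, x)) - L h =
    m (fun a => F (X a, h + x) - F (X a, x) - 'd F (X a, x) (pairr h)).
  have bFB := boundedB (bF _ Dhx) (bF _ Dx).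
  by rewrite mB ?(lE h).2 ?mB//; [exact: bF|exact: bF|exact: (lE h).1].
apply: (@le_trans _ _ (K * (n%:R * e' * `|h|))).
  apply: mK => [|a Ha]; first by rewrite mulr_ge0// mulr_ge0// ltW.
  have Cp := XC Ha; set p := X a in Cp *.
  have seg (t : R) : 0 <= t <= 1 -> differentiable F ((p, x) + t *: pairr h).
    move=> t01; have -> : (p, x) + t *: pairr h = (p, x + t *: h).
      by rewrite /pairr; congr (_, _); rewrite /= scaler0 addr0.
    by apply: Ck_on_diff F1 _; apply: CD => //; case: (Hr _ (hx t t01)).
  have [t t01] := MVT_diff seg.
  have -> : (p, x) + t *: pairr h = (p, x + t *: h).
    by rewrite /pairr; congr (_, _); rewrite /= scaler0 addr0.
  have -> : (p, x) + pairr h = (p, h + x).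
    by rewrite /pairr; congr (_, _); rewrite /= ?addr0// addrC.
  have E1 := diff_pairr_sum F (p, x + t *: h) h.
  have E2 := diff_pairr_sum F (p, x) h.
  have AB : ('d F (p, x + t *: h) (pairr h) : R) - 'd F (p, x) (pairr h) =
      \sum_i h 0 i * (G i (p, x + t *: h) - G i (p, x)).
    apply: etrans (congr2 (fun a b : R => a - b) E1 E2) _.
    by rewrite -sumrB; apply: eq_bigr => i _; rewrite mulrBr.
  move=> E; apply: (@le_trans _ _ `|\sum_i h 0 i * (G i (p, x + t *: h) - G i (p, x))|).
    by rewrite -AB; apply: eq_ind_r (fun z : R => `|z - _| <= _) _ _ E.
  apply: (le_trans (ler_norm_sum _ _ _)).
  apply: (@le_trans _ _ (\sum_(i < n) e' * `|h|)).
    apply: ler_sum => i _; rewrite normrM mulrC ler_pM//; last exact: norm_coord_le.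
    by have [_] := Hr _ (hx t t01); apply.
  by rewrite sumr_const card_ord -mulrA mulr_natl.
rewrite !mulrA ler_wpM2r//.
rewrite ler_pdivrMr ?mulr_gt0// [K * n%:R * e]mulrC.
apply: ler_wpM2l; first exact: ltW.
by apply: ler_pM => //; [rewrite lerDl|rewrite ler_nat].
Qed.

Lemma Ck_on_param k F : Ck_on k Om F -> Ck_on k D (fun y => m (fun a => F (X a, y)) : R^o).
Proof.
elim: k F => [|k IH] F HF.
  move=> x Dx; apply: continuous_eps => e e0.
  have [K0 mL mK] := mH.
  have K1 : 0 < K + 1 by rewrite ltr_wpDl.
  have e'0 : 0 < e / (K + 1) by rewrite divr_gt0.
  have [r r0 Hr] := param_unif HF Dx e'0.
  exists r => // y /Hr[Dy Hy]; rewrite -mB; [|exact: param_bounded|exact: param_bounded].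
  apply: (@le_trans _ _ (K * (e / (K + 1)))).
    apply: mK => [|a /XC]; [exact: ltW|exact: Hy].
  by rewrite mulrA ler_pdivrMr// [K * e]mulrC ler_wpM2l// ?lerDl// ltW.
apply: (Ck_on_step (df := fun x v => m (fun a => 'd F (X a, x) (0, v)) : R^o)) => [//|x Dx|x v Dx|v].
- by apply: (param_diff _ Dx).1; apply: Ck_on_le HF.
- by apply: (param_diff _ Dx).2; apply: Ck_on_le HF.
- by apply: (IH (fun q => 'd F q (0, v) : R^o)); exact: Ck_on_d.
Qed.
End Parametric.

(** * Torus actions in charts *)

Section Charts.
Context {R : realType} {n : nat}.
Variable M : manifold R n.
Implicit Types (c : chart R n M) (p q : M) (x : 'rV[R]_n).

Lemma chart_img_map c p : chart_dom c p -> chart_img c (chart_map c p).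
Proof. by move=> cp; exists p. Qed.

Lemma chart_mapK c p : atlas c -> chart_dom c p -> chart_inv c (chart_map c p) = p.
Proof. by move=> /atlas_chart[_ _ H _ _]; exact: H. Qed.

Lemma chart_inv_dom c x : atlas c -> chart_img c x -> chart_dom c (chart_inv c x).
Proof. by move=> Ac [p cp <-]; rewrite chart_mapK. Qed.

Lemma chart_invK c x : atlas c -> chart_img c x -> chart_map c (chart_inv c x) = x.
Proof. by move=> Ac [p cp <-]; rewrite chart_mapK. Qed.

Lemma chart_dom_open c : atlas c -> open (chart_dom c).
Proof. by move=> /atlas_chart[]. Qed.

Lemma chart_img_open c : atlas c -> open (chart_img c).
Proof. by move=> /atlas_chart[]. Qed.

Lemma chart_map_cvg c p : atlas c -> chart_dom c p ->
  chart_map c q @[q --> p] --> chart_map c p.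
Proof. by move=> /atlas_chart[_ _ _ H _] /H. Qed.

Lemma chart_inv_cvg c x : atlas c -> chart_img c x ->
  chart_inv c y @[y --> x] --> chart_inv c x.
Proof. by move=> /atlas_chart[_ _ _ _ H] /H. Qed.

Lemma open_img_inv c (U : set M) : atlas c -> open U ->
  open (chart_img c `&` chart_inv c @^-1` U).
Proof.
move=> Ac oU; rewrite openE => x [cx Ux]; apply: filterI.
  exact: open_nbhs_nbhs (conj (chart_img_open Ac) cx).
by have := chart_inv_cvg Ac cx; apply; exact: open_nbhs_nbhs.
Qed.

Lemma open_dom_map c (O : set 'rV[R]_n) : atlas c -> open O ->
  open (chart_dom c `&` chart_map c @^-1` O).
Proof.
move=> Ac oO; rewrite openE => p [cp Op]; apply: filterI.
  exact: open_nbhs_nbhs (conj (chart_dom_open Ac) cp).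
by have := chart_map_cvg Ac cp; apply; exact: open_nbhs_nbhs.
Qed.

Lemma map_imgE c (U : set M) : atlas c ->
  chart_map c @` (chart_dom c `&` U) = chart_img c `&` chart_inv c @^-1` U.
Proof.
move=> Ac; apply/seteqP; split=> [_ [p [cp Up] <-]|x [cx Ux]].
  by split; [exact: chart_img_map|rewrite /= chart_mapK].
by exists (chart_inv c x); [split=> //; exact: chart_inv_dom|exact: chart_invK].
Qed.

Lemma transition_smooth c c' : atlas c -> atlas c' ->
  smooth_on (chart_img c `&` chart_inv c @^-1` chart_dom c') (transition c c').
Proof.
move=> Ac Ac'; rewrite -map_imgE//.
by have [] := atlas_compatible Ac Ac'.
Qed.

Definition chart_comp c (O : set 'rV[R]_n) (Phi g : 'rV[R]_n -> 'rV[R]_n) : chart R n M :=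
  Chart (chart_dom c `&` chart_map c @^-1` O) (Phi \o chart_map c) (chart_inv c \o g).

Lemma chart_comp_img c O Phi g : atlas c -> O `<=` chart_img c ->
  chart_img (chart_comp c O Phi g) = Phi @` O.
Proof.
move=> Ac Oc; apply/seteqP; split=> [_ [p [/= cp Op] <-]|_ [x Ox <-]] /=.
  by exists (chart_map c p).
exists (chart_inv c x); last by rewrite /= chart_invK//; exact: Oc.
by split; [exact/chart_inv_dom/Oc|rewrite /= chart_invK//; exact: Oc].
Qed.

(** By maximality of the atlas, only compatibility with its members has to be checked; each
    transition is a transition of [c] composed with [Phi] or with its inverse [g]. *)
Lemma chart_comp_atlas c O Phi g : atlas c -> open O -> O `<=` chart_img c ->
  smooth_on O Phi -> open (Phi @` O) -> (forall x, O x -> g (Phi x) = x) ->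
  smooth_on (Phi @` O) g -> atlas (chart_comp c O Phi g).
Proof.
move=> Ac oO Oc sPhi oPhi gPhi sg.
set c1 := chart_comp c O Phi g.
have c1I : chart_img c1 = Phi @` O by exact: chart_comp_img.
have isc1 : is_chart c1.
  split.
  - exact: open_dom_map.
  - by rewrite c1I.
  - by move=> p [cp Op] /=; rewrite gPhi// chart_mapK.
  - move=> p [cp Op] /=; apply: (@continuous_comp _ _ _ (chart_map c) Phi).
      exact: chart_map_cvg.
    exact: (sPhi 0%N).
  - rewrite c1I => y Py /=; apply: (@continuous_comp _ _ _ g (chart_inv c)).
      exact: (sg 0%N).
    by case: Py => x Ox <-; rewrite gPhi//; exact/chart_inv_cvg/Oc.
apply: atlas_maximal => // c' Ac'; split.
- rewrite (_ : chart_map c1 @` _ = Phi @` (O `&` (chart_inv c @^-1` chart_dom c'))); last first.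
    apply/seteqP; split=> [_ [p [[/= cp Op] c'p] <-]|_ [x [Ox c'x] <-]] /=.
      by exists (chart_map c p) => //; split=> //=; rewrite chart_mapK.
    have cx := Oc _ Ox.
    exists (chart_inv c x); last by rewrite /= chart_invK.
    by split=> //; split=> //=; [exact: chart_inv_dom|rewrite chart_invK].
  have E : Phi @` (O `&` (chart_inv c @^-1` chart_dom c')) =
      Phi @` O `&` g @^-1` (chart_img c `&` chart_inv c @^-1` chart_dom c').
    apply/seteqP; split=> [_ [x [Ox c'x] <-]|_ [[x Ox <-]]] /=; rewrite gPhi//.
      by split; [exists x|split=> //; exact: Oc].
    by case=> _ c'x; exists x.
  have oD : open (Phi @` (O `&` (chart_inv c @^-1` chart_dom c'))).
    rewrite E openE => y [Py gy]; apply: filterI.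
      exact: open_nbhs_nbhs.
    have : g z @[z --> y] --> g y by exact: (sg 0%N).
    apply; apply: open_nbhs_nbhs; split=> //; apply: open_img_inv => //.
    exact: chart_dom_open.
  move=> k; apply: (@Ck_on_comp _ _ _ _ _ _ (chart_img c `&` chart_inv c @^-1` chart_dom c') g (transition c c')) => //.
  + exact: finite_basis_rV.
  + by apply: open_img_inv => //; exact: chart_dom_open.
  + by move=> y; rewrite E => -[].
  + by apply: Ck_on_sub (sg k); rewrite E => y [].
  + exact: transition_smooth.
- rewrite setIC map_imgE//.
  have oD : open (chart_img c' `&` chart_inv c' @^-1` chart_dom c1).
    by apply: open_img_inv => //; exact: open_dom_map.
  move=> k; apply: (@Ck_on_comp _ _ _ _ _ _ O (transition c' c) Phi) => //.
  + exact: finite_basis_rV.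
  + by move=> x [c'x [/= cx Ox]].
  + by apply: Ck_on_sub (transition_smooth Ac' Ac k) => x [c'x [/= cx _]].
Qed.

Lemma chart_linear c (A : 'M[R]_n) (b : 'rV[R]_n) : atlas c -> A \in unitmx ->
  exists c', [/\ atlas c', chart_dom c' = chart_dom c,
    forall p, chart_map c' p = (chart_map c p - b) *m A &
    forall x, chart_inv c' x = chart_inv c (x *m invmx A + b)].
Proof.
move=> Ac uA.
pose Phi (x : 'rV[R]_n) := (x - b) *m A; pose g (x : 'rV[R]_n) := x *m invmx A + b.
have gK x : g (Phi x) = x by rewrite /g /Phi mulmxK// subrK.
have Pk x : Phi (g x) = x by rewrite /g /Phi addrK mulmxKV.
have saff (B : 'M[R]_n) (d : 'rV[R]_n) k (D : set 'rV[R]_n) : open D -> Ck_on k D (fun x => x *m B + d).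
  move=> oD; apply: (@Ck_on_add _ _ _ _ _ (fun x => x *m B) (cst d)) => //; last exact: Ck_on_cst.
  apply: (@Ck_on_linear _ _ _ _ _ (mulmxr B : {linear 'rV[R]_n -> 'rV[R]_n})) => //.
  exact: linear_rV_continuous.
have sPhi k (D : set 'rV[R]_n) : open D -> Ck_on k D Phi.
  by move=> oD; rewrite (_ : Phi = fun x => x *m A + - b *m A); [exact: saff|apply/funext => x; rewrite /Phi mulmxBl mulNmx].
have oP : open (Phi @` chart_img c).
  rewrite (_ : _ @` _ = g @^-1` chart_img c).
    apply: open_comp; last exact: chart_img_open.
    by move=> x _; apply: (saff _ _ 0%N setT openT).
  by apply/seteqP; split=> [_ [x cx <-]|x cx] /=; rewrite ?gK//; exists (g x).
exists (chart_comp c (chart_img c) Phi g); split=> //.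
- apply: chart_comp_atlas => //.
  + exact: chart_img_open.
  + by move=> k; apply: sPhi; exact: chart_img_open.
  + by move=> k; exact: saff.
- by apply/seteqP; split=> [p []//|p cp]; split=> //; exact: chart_img_map.
Qed.

Lemma chart_restrict c (O : set 'rV[R]_n) : atlas c -> open O -> O `<=` chart_img c ->
  exists c', [/\ atlas c', chart_dom c' = chart_dom c `&` chart_map c @^-1` O,
    chart_map c' = chart_map c & chart_inv c' = chart_inv c].
Proof.
move=> Ac oO Oc; exists (chart_comp c O idfun idfun); split=> //.
apply: chart_comp_atlas; rewrite ?image_id//.
- by move=> k; exact: Ck_on_id.
- by move=> k; exact: Ck_on_id.
Qed.

Lemma transition_jacobianK c c' p : chart_at c p -> chart_at c' p ->
  'J (transition c c') (chart_map c p) *m 'J (transition c' c) (chart_map c' p) = 1%:M.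
Proof.
move=> [Ac cp] [Ac' c'p].
have cx := chart_img_map cp; have c'x := chart_img_map c'p.
have d1 : differentiable (transition c c') (chart_map c p).
  apply: (Ck_on_diff (transition_smooth Ac Ac' 1%N)).
  by split=> //=; rewrite chart_mapK.
have E : transition c c' (chart_map c p) = chart_map c' p by rewrite /transition /= chart_mapK.
have d2 : differentiable (transition c' c) (transition c c' (chart_map c p)).
  rewrite E; apply: (Ck_on_diff (transition_smooth Ac' Ac 1%N)).
  by split=> //=; rewrite chart_mapK.
have [_ d12] := diff_comp_ptw d1 d2.
have [di di'] := diff_id_ptw (chart_map c p).
have nE : \forall y \near chart_map c p, y = transition c' c (transition c c' y).
  have oD : open (chart_img c `&` chart_inv c @^-1` chart_dom c').
    by apply: open_img_inv => //; exact: chart_dom_open.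
  have Dx : (chart_img c `&` chart_inv c @^-1` chart_dom c') (chart_map c p).
    by split=> //=; rewrite chart_mapK.
  apply: filterS (open_nbhs_nbhs (conj oD Dx)) => y [cy c'y].
  by rewrite /transition /= [chart_inv c' _]chart_mapK// chart_invK.
have [_ K] := near_eq_diff_ptw nE di.
apply/row_matrixP => i; rewrite rowE mulmxA !jacobianE -E -d12 K di' rowE mulmx1 //.
Qed.
End Charts.

(** * The exponential map of the torus *)

Section Torus.
Context {R : realType}.
Implicit Types (X Y : 'rV[R]_2) (a b : R[i] * R[i]).

Lemma cisD (s t : R) : cis (s + t) = cis s * cis t.
Proof. by apply/eqP; rewrite eq_complex /= cosD sinD; apply/andP; split=> //; rewrite addrC. Qed.

Lemma cis0 : cis (0 : R) = 1.
Proof. by apply/eqP; rewrite eq_complex /= cos0 sin0 !eqxx. Qed.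

Lemma S1P (z : R[i]) : S1 z <-> complex.Re z ^+ 2 + complex.Im z ^+ 2 = 1.
Proof.
case: z => x y; rewrite /S1 /= normc_def /=; split.
  move=> /(congr1 (@complex.Re R)) /= E.
  have := sqr_sqrtr (addr_ge0 (sqr_ge0 x) (sqr_ge0 y)).
  by rewrite [Num.sqrt _]E expr1n => ->.
by move=> ->; rewrite sqrtr1.
Qed.

Lemma S1_cis (t : R) : S1 (cis t).
Proof. by apply/S1P => /=; exact: cos2Dsin2. Qed.

Lemma S1M (z w : R[i]) : S1 z -> S1 w -> S1 (z * w).
Proof. by rewrite /S1 /= normrM => -> ->; rewrite mulr1. Qed.

Lemma S1_1 : S1 (1 : R[i]).
Proof. by rewrite /S1 /= normr1. Qed.

Lemma S1_neq0 (z : R[i]) : S1 z -> z != 0.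
Proof. by rewrite /S1 /= => z1; rewrite -normr_eq0 z1 oner_neq0. Qed.

Lemma cis_surj (z : R[i]) : S1 z -> exists t, 0 <= t <= pi *+ 2 /\ cis t = z.
Proof.
move=> /S1P; case: z => x y /= E.
have x1 : -1 <= x <= 1.
  have : x ^+ 2 <= 1 by rewrite -E lerDl sqr_ge0.
  rewrite -ler_norml => H; rewrite -(@ler_pXn2r _ 2)// ?nnegrE//.
  by rewrite real_normK ?num_real// expr1n.
have [a0 api] := (acos_ge0 x1, acos_lepi x1).
have sE : sin (acos x) = `|y|.
  by rewrite sin_acos// -(sqrtr_sqr y); congr Num.sqrt; rewrite -E addrAC subrr add0r.
have [y0|y0] := leP 0 y.
  exists (acos x); split; last first.
    by apply/eqP; rewrite eq_complex /= acosK// sE ger0_norm// !eqxx.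
  by rewrite a0 (le_trans api)// mulr2n lerDl pi_ge0.
exists (pi *+ 2 - acos x); split.
  by have := pi_ge0 R; rewrite mulr2n => p0; apply/andP; split; lra.
apply/eqP; rewrite eq_complex /= cosB sinB cos2pi sin2pi acosK// sE ltr0_norm//.
by rewrite !mul0r !mul1r addr0 sub0r opprK !eqxx.
Qed.

(** From [cos |t| = 1 - 2 sin (|t| / 2) ^+ 2], and the positivity of the sine strictly between 0 and
    [pi]. *)
Lemma cis_periodic_inj (t : R) : `|t| < pi *+ 2 -> cis t = 1 -> t = 0.
Proof.
move=> t2 /(congr1 (@complex.Re R)) /= ct.
have {ct} c1 : cos `|t| = 1 by rewrite cos_norm.
apply/eqP; rewrite -normr_eq0; apply: contraT => t0.
have : 0 < sin (`|t| / 2).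
  apply: sin_gt0_pi; rewrite divr_gt0//=; last by rewrite lt_neqAle eq_sym t0 normr_ge0.
  by rewrite ltr_pdivrMr// mulr_natr.
have := cos_mulr2n (`|t| / 2); rewrite -[(_ / _) *+ 2]mulr_natr divfK ?pnatr_eq0// c1 cos2sin2.
set s := sin _ => E s0.
have : s ^+ 2 = 0 by move: E; rewrite -mulr_natr; lra.
by move=> /eqP; rewrite sqrf_eq0 => /eqP s1; rewrite s1 ltxx in s0.
Qed.

Lemma texpD X Y : texp (X + Y) = texp X * texp Y.
Proof. by rewrite /texp !mxE !cisD. Qed.

Lemma texp0 : texp (0 : 'rV[R]_2) = 1.
Proof. by rewrite /texp !mxE cis0. Qed.

Lemma T2_texp X : T2 (texp X).
Proof. by split; exact: S1_cis. Qed.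

Lemma T2M a b : T2 a -> T2 b -> T2 (a * b).
Proof. by move=> [a1 a2] [b1 b2]; split; exact: S1M. Qed.

Lemma T2_1 : T2 (1 : R[i] * R[i]).
Proof. by split; exact: S1_1. Qed.

(** A compact square that [texp] maps onto the torus. Compactness arguments about the torus and its
    closed subgroups are carried out on lifts in this square, where the action is known to be
    smooth. *)
Definition tbox : set 'rV[R]_2 := [set X | forall i, `[0, pi *+ 2]%classic (X 0 i)].

Lemma tbox_compact : compact tbox.
Proof.
apply: (@rV_compact R 2 (fun=> `[0, pi *+ 2]%classic)) => i; exact: segment_compact.
Qed.

Lemma texp_surj a : T2 a -> exists2 X, tbox X & texp X = a.
Proof.
case: a => a1 a2 [/= /cis_surj[s [s0 <-]] /cis_surj[t [t0 <-]]].
exists (\row_i if i == 0 then s else t); last by rewrite /texp !mxE.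
by move=> i; rewrite /= mxE in_itv; case: ifP.
Qed.

Lemma texp_inj0 X : `|X| < pi *+ 2 -> texp X = 1 -> X = 0.
Proof.
move=> X2 E; have [E1 E2] : cis (X 0 0) = 1 /\ cis (X 0 1) = 1.
  by split; [exact: (congr1 fst E)|exact: (congr1 snd E)].
have c (j : 'I_2) : `|X 0 j| < pi *+ 2 by exact: le_lt_trans (norm_coord_le _ _) X2.
apply/matrixP => k i; rewrite ord1 [RHS]mxE.
case: i => -[|[|//]] Hi.
  by rewrite (_ : Ordinal Hi = 0); [exact: cis_periodic_inj|exact: val_inj].
by rewrite (_ : Ordinal Hi = 1); [exact: cis_periodic_inj|exact: val_inj].
Qed.

Lemma texpNM X : texp X * texp (- X) = 1.
Proof. by rewrite -texpD subrr texp0. Qed.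
End Torus.

(** * Stabilisers and the action read in charts *)

Section Action.
Context {R : realType} {n : nat} {M : manifold R n}.
Variable act : torus_action M.
Implicit Types (X Y : 'rV[R]_2) (a b : R[i] * R[i]) (c : chart R n M) (p q : M).

Lemma act_texpNK X p : act (texp (- X)) (act (texp X) p) = p.
Proof. by rewrite -actM ?texpNM ?act1 1?mulrC ?texpNM ?act1//; exact: T2_texp. Qed.

Lemma act_texpKN X p : act (texp X) (act (texp (- X)) p) = p.
Proof. by rewrite -{1}(opprK X) act_texpNK. Qed.

Lemma act_joint_cvg X p : act (texp Yq.1) Yq.2 @[Yq --> (X, p)] --> act (texp X) p.
Proof. exact: (@act_continuous _ _ _ act (X, p)). Qed.

Lemma act_cvg2 (T : Type) (F : set_system T) (FF : Filter F) (f : T -> 'rV[R]_2)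
    (g : T -> M) X p : f @ F --> X -> g @ F --> p ->
  act (texp (f t)) (g t) @[t --> F] --> act (texp X) p.
Proof.
move=> fX gp A /act_joint_cvg [[P Q] /= [XP pQ] PQ].
have h1 : F (f @^-1` P) := fX P XP.
have h2 : F (g @^-1` Q) := gp Q pQ.
change (F (fun t => A (act (texp (f t)) (g t)))).
by apply: filterS2 h1 h2 => t Pt Qt; exact: (PQ (f t, g t)).
Qed.

Lemma act_cvg a p : T2 a -> act a q @[q --> p] --> act a p.
Proof.
move=> /texp_surj[X _ <-].
by apply: act_cvg2; [exact: cvg_cst|exact: cvg_id].
Qed.

Lemma act_texp_cvg X p : act (texp Y) p @[Y --> X] --> act (texp X) p.
Proof.
by apply: (@act_cvg2 _ (nbhs X) _ id (fun=> p)); [exact: cvg_id|exact: cvg_cst].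
Qed.

Lemma act_preimage_open a (U : set M) : T2 a -> open U -> open (act a @^-1` U).
Proof.
move=> Ta oU; apply: open_comp => // p _; exact: act_cvg.
Qed.

Lemma act_image_open a (U : set M) : T2 a -> open U -> open (act a @` U).
Proof.
move=> /texp_surj[X _ <-] oU.
rewrite (_ : _ @` _ = act (texp (- X)) @^-1` U).
  by apply: act_preimage_open => //; exact: T2_texp.
apply/seteqP; split=> [_ [p Up <-]|p Up] /=; first by rewrite act_texpNK.
by exists (act (texp (- X)) p) => //; rewrite act_texpKN.
Qed.

Lemma stab_1 p : stab act p 1.
Proof. by split; [exact: T2_1|exact: act1]. Qed.

Lemma stabM p a b : stab act p a -> stab act p b -> stab act p (a * b).
Proof. by move=> [Ta ap] [Tb bp]; split; [exact: T2M|rewrite actM// bp]. Qed.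

Lemma stabV p X : stab act p (texp X) -> stab act p (texp (- X)).
Proof. by move=> [_ Xp]; split; [exact: T2_texp|rewrite -{1}Xp act_texpNK]. Qed.

Lemma stab_closed p : closed [set X | stab act p (texp X)].
Proof.
rewrite (_ : [set X | _] = (fun X => act (texp X) p) @^-1` [set p]).
  apply: preimage_closed; first by move=> X _; exact: act_texp_cvg.
  exact/accessible_closed_set1/hausdorff_accessible/mfd_hausdorff.
by apply/seteqP; split=> [X []//|X Xp]; split=> //; exact: T2_texp.
Qed.

Lemma stab_act p a : T2 a -> stab act (act a p) = stab act p.
Proof.
move=> /texp_surj[X _ <-]; have TX := @T2_texp R X.
have comm b : T2 b -> act b (act (texp X) p) = act (texp X) (act b p).
  by move=> Tb; rewrite -!actM// mulrC.
apply/seteqP; split=> [b [Tb bp]|b [Tb bp]]; split=> //; last by rewrite comm// bp.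
by move: bp; rewrite comm// => /(congr1 (act (texp (- X)))); rewrite !act_texpNK.
Qed.

Definition act_rep a c c' : 'rV[R]_n -> 'rV[R]_n := chart_map c' \o act a \o chart_inv c.

Definition act_rep_dom a c c' : set 'rV[R]_n :=
  chart_img c `&` chart_inv c @^-1` (act a @^-1` chart_dom c').

Lemma act_rep_dom_open a c c' : T2 a -> atlas c -> atlas c' -> open (act_rep_dom a c c').
Proof.
by move=> Ta Ac Ac'; apply: open_img_inv => //; apply: act_preimage_open => //; exact: chart_dom_open.
Qed.

Definition act_domain c c' : set ('rV[R]_2 * 'rV[R]_n) :=
  [set Xx | chart_img c Xx.2 /\ chart_dom c' (act (texp Xx.1) (chart_inv c Xx.2))].

Lemma act_domain_open c c' : atlas c -> atlas c' -> open (act_domain c c').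
Proof.
move=> Ac Ac'; rewrite openE => -[X x] [/= cx c'x]; apply: filterI.
  have : Yy.2 @[Yy --> (X, x)] --> x by exact: cvg_snd.
  by apply; apply: open_nbhs_nbhs; split=> //; exact: chart_img_open.
have : act (texp Yy.1) (chart_inv c Yy.2) @[Yy --> (X, x)] --> act (texp X) (chart_inv c x).
  apply: act_cvg2; first exact: cvg_fst.
  apply: (cvg_comp snd (chart_inv c)); first exact: cvg_snd.
  exact: chart_inv_cvg.
by apply; apply: open_nbhs_nbhs; split=> //; exact: chart_dom_open.
Qed.

Lemma act_rep_smooth a c c' : T2 a -> atlas c -> atlas c' ->
  smooth_on (act_rep_dom a c c') (act_rep a c c').
Proof.
move=> Ta Ac Ac' k; have oD := act_rep_dom_open Ta Ac Ac'.
have [X _ E] := texp_surj Ta.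
rewrite -E in oD *.
apply: (@Ck_on_comp _ _ _ _ _ _ (act_domain c c') (fun x => (X, x))
  (fun Xx => chart_map c' (act (texp Xx.1) (chart_inv c Xx.2)))) => //.
- by apply: finite_basis_prod; exact: finite_basis_rV.
- exact: act_domain_open.
- by apply: Ck_on_pair => //; [exact: Ck_on_cst|exact: Ck_on_id].
- exact: act_smooth.
Qed.
End Action.

(** * The isotropy representation *)

Section Diagonalization.
Context {C : numClosedFieldType} {n : nat}.

Lemma unitary_diagonalizable (A : 'M[C]_n) : A \is unitarymx ->
  exists2 P : 'M[C]_n, P \in unitmx & is_diag_mx (P *m A *m invmx P).
Proof.
move=> uA; have nA : A \is normalmx.
  by apply/normalmxP; rewrite (unitarymxP _)// mulmx1C// (unitarymxP _).
have Pu := spectral_unit A.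
exists (spectralmx A) => //.
have /orthomx_spectralP E := nA.
by rewrite {2}E -!mulmxA mulKVmx// mulmxV// mulmx1 diag_mx_is_diag.
Qed.

(** The family may be infinite. A finite list of members whose span has maximal dimension already
    spans all of [F], and a basis diagonalising the list diagonalises every linear combination of
    it. *)
Lemma codiagonalizable_unitary (F : 'M[C]_n -> Prop) :
  (forall A, F A -> A \is unitarymx) ->
  (forall A B, F A -> F B -> A *m B = B *m A) ->
  exists2 P : 'M[C]_n, P \in unitmx & forall A, F A -> is_diag_mx (P *m A *m invmx P).
Proof.
move=> Fu Fc.
pose good k := `[< exists s : seq 'M[C]_n, (forall A, A \in s -> F A) /\ \dim (span s) = k >].
have g0 : exists k, good k by exists 0%N; apply/asboolP; exists [::]; rewrite span_nil dimv0.
have gb k : good k -> (k <= \dim {:'M[C]_n})%N.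
  by move=> /asboolP[s [_ <-]]; exact/dimvS/subvf.
case: (ex_maxnP g0 gb) => k /asboolP [s [Fs sk]] kmax.
have spanF A : F A -> A \in span s.
  move=> FA; have sub : (span s <= span (A :: s))%VS by rewrite span_cons addvSr.
  have : span s == span (A :: s).
    rewrite eqEdim sub /= sk; apply: kmax; apply/asboolP; exists (A :: s); split=> // B.
    by rewrite in_cons => /predU1P[->//|/Fs].
  by move=> /eqP ->; exact/memv_span/mem_head.
have [|P Pu /allP HP] := (codiagonalizableP s).1.
  split=> [A B As Bs|A As]; first exact: Fc (Fs _ As) (Fs _ Bs).
  have [P Pu Pd] := unitary_diagonalizable (Fu _ (Fs _ As)).
  by exists P => //; rewrite /similar_to conjumx.
exists P => // A /spanF As; rewrite (coord_span (X := in_tuple s) As).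
rewrite mulmx_sumr mulmx_suml; apply/is_diag_mxP => i j ij.
rewrite summxE big1// => l _.
rewrite -scalemxAr -scalemxAl mxE.
have /HP : s`_l \in s by exact: mem_nth.
rewrite /= /similar_to conjumx// => /is_diag_mxP/(_ i j ij).
by rewrite (_ : (in_tuple s)`_l = s`_l)// => ->; rewrite mulr0.
Qed.
End Diagonalization.

(** * The complex volume form and the complex structure *)

Section RowReplacement.
Context {K : comPzRingType}.

Definition row_replace m n (k : 'I_m) (r : 'rV[K]_n) (A : 'M[K]_(m, n)) : 'M[K]_(m, n) :=
  \matrix_(i, j) if i == k then r 0 j else A i j.

Lemma row_replace_mul m n p k (r : 'rV[K]_n) (A : 'M[K]_(m, n)) (B : 'M[K]_(n, p)) :
  row_replace k r A *m B = row_replace k (r *m B) (A *m B).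
Proof.
apply/matrixP => i j; rewrite !mxE; case: eqVneq => ik; apply: eq_bigr => l _;
by rewrite !mxE ?ik ?eqxx// (negPf ik).
Qed.

(** Cramer's rule by expansion along row [k]: determinants with one row replaced give all the
    coordinates of [r *m \adj A], and so recover [r] when [A] has determinant 1. *)
Lemma det_row_replace n k (r : 'rV[K]_n) (A : 'M[K]_n) :
  \det (row_replace k r A) = (r *m \adj A) 0 k.
Proof.
rewrite (expand_det_row _ k) mxE; apply: eq_bigr => j _; rewrite !mxE eqxx; congr (_ * _).
rewrite /cofactor; congr (_ * \det _); apply/matrixP => a b; rewrite !mxE.
by rewrite eq_sym (negPf (neq_lift _ _)).
Qed.
End RowReplacement.

Section ComplexCoordinates.
Context {R : realType}.
Notation C := (R[i]).
Notation toC := (map_mx (real_complex R)).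

Definition complex_coord_mx : 'M[C]_(3 + 3, 3) := col_mx 1%:M ('i%:M).

(* [toC v *m zmx F] is the row of the [(e^i + i J e^i) v], for the coframe
   dual to the rows of [F]. *)
Definition zmx (F : 'M[R]_6) : 'M[C]_(6, 3) := toC (invmx F) *m complex_coord_mx.

Lemma imaginaryE : 'i = (0 +i* 1)%C :> C.
Proof. by []. Qed.

Lemma complex_coordE k (B : 'M[R]_(k, 3 + 3)) :
  toC B *m complex_coord_mx = toC (lsubmx B) + 'i *: toC (rsubmx B).
Proof. by rewrite -{1}[B]hsubmxK map_row_mx mul_row_col mulmx1 mul_mx_scalar. Qed.

Lemma zmxE k (F : 'M[R]_6) (A : 'M[R]_(k, 6)) i j :
  (toC A *m zmx F) i j = (coframe_re F A i j +i* coframe_im F A i j)%C.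
Proof.
have E : toC A *m zmx F = toC (coframe_re F A) + 'i *: toC (coframe_im F A).
  by rewrite /zmx mulmxA -map_mxM; exact: (@complex_coordE k (A *m invmx F)).
rewrite E !mxE imaginaryE.
by apply/eqP; rewrite eq_complex /=; apply/andP; split; apply/eqP; ring.
Qed.

Lemma complex_detE (F : 'M[R]_6) (A : 'M[R]_(3, 6)) :
  \det (\matrix_(a < 3, b < 3) (coframe_re F A a b +i* coframe_im F A a b)%C) =
  \det (toC A *m zmx F).
Proof. by congr (\det _); apply/matrixP => i j; rewrite zmxE mxE. Qed.

Lemma zmx_inj (F : 'M[R]_6) (v w : 'rV[R]_6) : F \in unitmx ->
  toC v *m zmx F = toC w *m zmx F -> v = w.
Proof.
move=> uF E; rewrite -(mulmxKV uF v) -(mulmxKV uF w); congr (_ *m _).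
have H j : coframe_re F v 0 j = coframe_re F w 0 j /\ coframe_im F v 0 j = coframe_im F w 0 j.
  by move: (congr1 (fun A : 'M[C]_(1, 3) => A 0 j) E); rewrite !zmxE => -[-> ->].
rewrite -[LHS](@hsubmxK _ 1 3 3) -[RHS](@hsubmxK _ 1 3 3).
by apply: (congr2 (@row_mx R 1 3 3)); apply/rowP => j; have [] := H j.
Qed.

Section Frame.
Variables (J : 'M[R]_6) (E : 'M[R]_(3, 6)).
Hypotheses (JJ : J *m J = - 1%:M) (uF : su3_frame J E \in unitmx).
Let F := su3_frame J E.

Lemma zmx_J : toC J *m zmx F = 'i *: zmx F.
Proof.
pose S : 'M[R]_(3 + 3) := block_mx 0 1%:M (- 1%:M) 0.
have FJ : F *m J = S *m F.
  apply: etrans (@mul_col_mx _ 3 3 6 6 E (E *m J) J) _.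
  apply: etrans _ (esym (@mul_block_col _ 3 3 3 3 6 0 1%:M (- 1%:M) 0 E (E *m J))).
  by rewrite -mulmxA JJ mulmxN mulmx1 !mul0mx add0r addr0 mul1mx mulNmx mul1mx.
have -> : J = invmx F *m S *m F by rewrite -mulmxA -FJ mulKmx.
rewrite /zmx mulmxA -map_mxM mulmxK// map_mxM -mulmxA scalemxAr; congr (_ *m _).
rewrite (_ : toC S = (block_mx 0 1%:M (- 1%:M) 0 : 'M[C]_(3 + 3))); last first.
  by apply: etrans (@map_block_mx _ _ _ 3 3 3 3 _ _ _ _) _; rewrite !map_mx0 map_mxN map_mx1.
apply: etrans (@mul_block_col _ 3 3 3 3 3 _ _ _ _ _ _) _.
rewrite /complex_coord_mx (@scale_col_mx _ 3 3 3) !mul0mx add0r addr0 mul1mx mulmx1.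
apply: (congr2 (@col_mx _ 3 3 3)); first by rewrite scalemx1.
by rewrite scale_scalar_mx -expr2 sqrCi rmorphN.
Qed.

Lemma zmx_mulJ (v : 'rV[R]_6) : toC (v *m J) *m zmx F = 'i *: (toC v *m zmx F).
Proof.
transitivity (toC v *m (toC J *m zmx F)); first by rewrite map_mxM mulmxA.
by rewrite zmx_J; apply/esym/scalemxAr.
Qed.

Lemma zmx_E : toC E *m zmx F = 1%:M.
Proof.
rewrite /zmx mulmxA -map_mxM.
have : F *m invmx F = 1%:M by rewrite mulmxV.
rewrite (_ : F *m invmx F = col_mx (E *m invmx F) (E *m J *m invmx F)); last first.
  exact: (@mul_col_mx _ 3 3 6 6 E (E *m J) (invmx F)).
rewrite (@scalar_mx_block _ 3 3 1) /block_mx => /(congr1 (@usubmx _ 3 3 6)).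
rewrite !col_mxKu => ->.
apply: etrans (complex_coordE _) _.
by rewrite row_mxKl row_mxKr map_mx1 map_mx0 scaler0 addr0.
Qed.

Lemma zmx_surj (w : 'rV[C]_3) : exists a b : 'rV[R]_3,
  w = toC a + 'i *: toC b /\ toC (a *m E + b *m E *m J) *m zmx F = w.
Proof.
exists (map_mx (@complex.Re R) w), (map_mx (@complex.Im R) w).
have wE : w = toC (map_mx (@complex.Re R) w) + 'i *: toC (map_mx (@complex.Im R) w).
  by apply/rowP => j; rewrite !mxE imaginaryE; apply/eqP; rewrite eq_complex /= ;
     apply/andP; split; apply/eqP; ring.
split=> //; rewrite map_mxD !map_mxM mulmxDl -!mulmxA zmx_J zmx_E mulmx1.
by rewrite -scalemxAr zmx_E -scalemxAr mulmx1.
Qed.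

Lemma zmx_span (v : 'rV[R]_6) : exists a b : 'rV[R]_3,
  v = a *m E + b *m E *m J /\ toC v *m zmx F = toC a + 'i *: toC b.
Proof.
have [a [b [E1 E2]]] := zmx_surj (toC v *m zmx F).
by exists a, b; split=> //; exact/esym/(zmx_inj uF).
Qed.
End Frame.

(* The volume form determines the complex structure: [J v] is the only [w] such
   that [psi(w, -, -) = i psi(v, -, -)]. *)
Lemma volume_form_complex_linear (J J' : 'M[R]_6) (E E' : 'M[R]_(3, 6)) (D : 'M[R]_6) :
  J *m J = - 1%:M -> J' *m J' = - 1%:M ->
  su3_frame J E \in unitmx -> su3_frame J' E' \in unitmx ->
  (forall A : 'M[R]_(3, 6), \det (toC (A *m D) *m zmx (su3_frame J' E')) =
                            \det (toC A *m zmx (su3_frame J E))) ->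
  exists B : 'M[C]_3, [/\ \det B = 1,
    toC D *m zmx (su3_frame J' E') = zmx (su3_frame J E) *m B & J *m D = D *m J'].
Proof.
move=> JJ JJ' uF uF' HD; set Z := zmx (su3_frame J E) in HD *; set Z' := zmx _ in HD *.
pose B := toC (E *m D) *m Z'.
have EZ : toC E *m Z = 1%:M by exact: zmx_E.
have detB : \det B = 1 by rewrite /B HD EZ det1.
(* The two volume forms are compared on [E] with its row [k] replaced by row [j] of [E *m J]. By
   Cramer's rule these determinants are the entries of the product with [\adj B], the inverse of
   [B]. *)
have RB : toC (E *m J *m D) *m Z' = 'i *: B.
  suff K : toC (E *m J *m D) *m Z' *m \adj B = 'i%:M.
    have : toC (E *m J *m D) *m Z' *m (\adj B *m B) = 'i *: B by rewrite mulmxA K mul_scalar_mx.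
    by rewrite mul_adj_mx detB mulmx1.
  apply/matrixP => j k.
  rewrite -[LHS](_ : (row j (toC (E *m J *m D) *m Z') *m \adj B) 0 k = _); last first.
    by rewrite -row_mul mxE.
  rewrite -det_row_replace.
  have -> : row_replace k (row j (toC (E *m J *m D) *m Z')) B =
      toC (row_replace k (row j (E *m J)) E *m D) *m Z'.
    have -> : toC (row_replace k (row j (E *m J)) E *m D) =
        row_replace k (row j (toC (E *m J *m D))) (toC (E *m D)).
      rewrite row_replace_mul -row_mul; apply/matrixP => a b; rewrite !mxE.
      by case: ifP => _; rewrite ?mxE.
    by rewrite row_replace_mul -row_mul.
  rewrite HD.
  have -> : toC (row_replace k (row j (E *m J)) E) = row_replace k (row j (toC (E *m J))) (toC E).
    by apply/matrixP => a b; rewrite !mxE; case: ifP => _; rewrite ?mxE.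
  rewrite row_replace_mul EZ -row_mul map_mxM -mulmxA zmx_J// -scalemxAr EZ.
  by rewrite det_row_replace adj1 mulmx1 !mxE mulr_natr.
(* The rows of [E] and [E *m J] span the tangent space over the reals, so the values of [D] on them,
   [B] and ['i *: B], determine it as a complex-linear map. *)
have DZ (v : 'rV[R]_6) : toC (v *m D) *m Z' = toC v *m Z *m B.
  have [a [b [-> vZ]]] := zmx_span JJ uF v.
  rewrite vZ mulmxDl -!mulmxA map_mxD !map_mxM mulmxDl -!mulmxA mulmxDl -scalemxAl scalemxAr.
  have E1 : toC E *m (toC D *m Z') = B by rewrite /B map_mxM mulmxA.
  have E2 : toC E *m (toC J *m (toC D *m Z')) = 'i *: B by rewrite -RB !map_mxM -!mulmxA.
  by rewrite E1 E2.
exists B; split=> //.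
- apply/row_matrixP => i.
  have := DZ (delta_mx 0 i); rewrite !rowE map_mxM map_delta_mx -[X in X = _]mulmxA => ->.
  by rewrite mulmxA.
- apply/row_matrixP => i; rewrite !rowE; apply: (zmx_inj uF'); rewrite -/Z' mulmxA DZ.
  rewrite (mulmxA _ D) (zmx_mulJ JJ' uF') -/Z' DZ /Z (zmx_mulJ JJ uF) -/Z.
  exact/esym/scalemxAl.
Qed.
End ComplexCoordinates.

Section Bilinear.
Context {R : realType} {n : nat}.
Variable f : 'M[R]_(2, n) -> R.
Hypothesis fm : multilinear f.
Implicit Types (u v w : 'rV[R]_n) (a b : R).

Let row_u (x y : 'rV[R]_n) : @row R 2 n (lshift 1 ord0 : 'I_(1 + 1)) (col_mx x y) = x.
Proof. exact: etrans (@rowKu R 1 1 n ord0 x y) (row_id ord0 x). Qed.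

Let row_d (x y : 'rV[R]_n) : @row R 2 n (rshift 1 ord0 : 'I_(1 + 1)) (col_mx x y) = y.
Proof. exact: etrans (@rowKd R 1 1 n ord0 x y) (row_id ord0 y). Qed.

Let row'_u (x y z : 'rV[R]_n) : @row' R 2 n (lshift 1 ord0 : 'I_(1 + 1)) (col_mx x z) =
  @row' R 2 n (lshift 1 ord0 : 'I_(1 + 1)) (col_mx y z).
Proof.
apply/matrixP => k j; rewrite [LHS]mxE [RHS]mxE.
have -> : lift (lshift 1 ord0 : 'I_(1 + 1)) k = rshift 1 ord0 by apply/val_inj; rewrite /= ord1.
exact: etrans (@col_mxEd R 1 1 n x z ord0 j) (esym (@col_mxEd R 1 1 n y z ord0 j)).
Qed.

Let row'_d (x y z : 'rV[R]_n) : @row' R 2 n (rshift 1 ord0 : 'I_(1 + 1)) (col_mx z x) =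
  @row' R 2 n (rshift 1 ord0 : 'I_(1 + 1)) (col_mx z y).
Proof.
apply/matrixP => k j; rewrite [LHS]mxE [RHS]mxE.
have -> : lift (rshift 1 ord0 : 'I_(1 + 1)) k = lshift 1 ord0 by apply/val_inj; rewrite /= ord1.
exact: etrans (@col_mxEu R 1 1 n z x ord0 j) (esym (@col_mxEu R 1 1 n z y ord0 j)).
Qed.

Lemma ev2_linearl a b u v w : ev2 f (a *: u + b *: v) w = a * ev2 f u w + b * ev2 f v w.
Proof.
apply: (fm (i := (lshift 1 ord0 : 'I_(1 + 1)))).
- by rewrite !row_u.
- exact: row'_u.
- exact: row'_u.
Qed.

Lemma ev2_linearr a b u v w : ev2 f w (a *: u + b *: v) = a * ev2 f w u + b * ev2 f w v.
Proof.
apply: (fm (i := (rshift 1 ord0 : 'I_(1 + 1)))).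
- by rewrite !row_d.
- exact: row'_d.
- exact: row'_d.
Qed.

Lemma ev2_suml (I : Type) (r : seq I) (c : I -> R) (u : I -> 'rV[R]_n) w :
  ev2 f (\sum_(i <- r) c i *: u i) w = \sum_(i <- r) c i * ev2 f (u i) w.
Proof.
elim: r => [|i r IH]; last by rewrite !big_cons -IH -[X in _ + X]scale1r ev2_linearl mul1r.
by rewrite !big_nil; have := ev2_linearl 0 0 0 0 w; rewrite scale0r addr0 !mul0r addr0.
Qed.

Lemma ev2_sumr (I : Type) (r : seq I) (c : I -> R) (u : I -> 'rV[R]_n) w :
  ev2 f w (\sum_(i <- r) c i *: u i) = \sum_(i <- r) c i * ev2 f w (u i).
Proof.
elim: r => [|i r IH]; last by rewrite !big_cons -IH -[X in _ + X]scale1r ev2_linearr mul1r.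
by rewrite !big_nil; have := ev2_linearr 0 0 0 0 w; rewrite scale0r addr0 !mul0r addr0.
Qed.
End Bilinear.

Section OrthonormalFrame.
Context {R : realType} {n : nat}.
Variables (g : 'M[R]_(2, n) -> R) (F : 'M[R]_n).
Hypotheses (gm : multilinear g) (gF : forall i j, ev2 g (row i F) (row j F) = (i == j)%:R).

Lemma orthonormal_evl (v : 'rV[R]_n) j : ev2 g (v *m F) (row j F) = v 0 j.
Proof.
rewrite mulmx_sum_row ev2_suml// (bigD1 j)//= gF eqxx mulr1 big1 ?addr0// => i ij.
by rewrite gF (negPf ij) mulr0.
Qed.

Lemma orthonormal_unit : F \in unitmx.
Proof.
rewrite -row_free_unit -kermx_eq0; apply/eqP/row_matrixP => i; apply/rowP => j.
have kF : row i (kermx F) *m F = 0 by rewrite -row_mul mulmx_ker row0.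
have := orthonormal_evl (row i (kermx F)) j; rewrite kF => <-; rewrite row0 [RHS]mxE.
by have := ev2_linearl gm 0 0 0 0 (row j F); rewrite scale0r addr0 !mul0r addr0.
Qed.

Lemma orthonormal_ev (u v : 'rV[R]_n) :
  ev2 g u v = \sum_i (u *m invmx F) 0 i * (v *m invmx F) 0 i.
Proof.
have uF := orthonormal_unit.
rewrite -{1}(mulmxKV uF v) [v *m invmx F *m F]mulmx_sum_row ev2_sumr//.
apply: eq_bigr => i _; rewrite mulrC; congr (_ * _).
by rewrite -{1}(mulmxKV uF u) orthonormal_evl.
Qed.
End OrthonormalFrame.

(** * Jacobians of the action; isotropy matrices lie in SU(3) *)

Section ActionJacobian.
Context {R : realType} {n : nat} {M : manifold R n}.
Variable act : torus_action M.
Implicit Types (c : chart R n M) (p q : M) (a b : R[i] * R[i]).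

Definition act_jacobian a c c' p := 'J (act_rep act a c c') (chart_map c p).

Lemma act_rep_diff a c c' p : T2 a -> chart_at c p -> chart_at c' (act a p) ->
  differentiable (act_rep act a c c') (chart_map c p).
Proof.
move=> Ta [Ac cp] [Ac' cap].
have H : Ck_on 1 (act_rep_dom act a c c') (act_rep act a c c') := act_rep_smooth act Ta Ac Ac' 1%N.
by apply: (Ck_on_diff H); split; [exact: chart_img_map|rewrite /= chart_mapK].
Qed.

(** The chain rule. Jacobians multiply rows from the right, so the factor of [b], which acts first,
    stands on the left. *)
Lemma act_jacobianM a b c c' c'' p : T2 a -> T2 b -> chart_at c p ->
  chart_at c' (act b p) -> chart_at c'' (act a (act b p)) ->
  act_jacobian (a * b) c c'' p = act_jacobian b c c' p *m act_jacobian a c' c'' (act b p).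
Proof.
move=> Ta Tb cp cbp cabp; have [[Ac cpd] [Ac' cbpd]] := (cp, cbp).
have d1 := act_rep_diff Tb cp cbp; have d2 := act_rep_diff Ta cbp cabp.
have E : act_rep act b c c' (chart_map c p) = chart_map c' (act b p).
  by rewrite /act_rep /= chart_mapK.
have d2' : differentiable (act_rep act a c' c'') (act_rep act b c c' (chart_map c p)) by rewrite E.
have [d12 d12'] := diff_comp_ptw d1 d2'.
have nE : \forall y \near chart_map c p,
    act_rep act a c' c'' (act_rep act b c c' y) = act_rep act (a * b) c c'' y.
  have oD : open (act_rep_dom act b c c') := act_rep_dom_open Tb Ac Ac'.
  have Dx : act_rep_dom act b c c' (chart_map c p).
    by split; [exact: chart_img_map|rewrite /= chart_mapK].
  apply: filterS (open_nbhs_nbhs (conj oD Dx)) => y [cy c'y].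
  by rewrite /act_rep /= chart_mapK// actM.
have [_ K] := near_eq_diff_ptw nE d12.
apply/row_matrixP => i; rewrite !rowE mulmxA.
apply: etrans (jacobianE _ _ _) _; apply: etrans (K _) _; apply: etrans (d12' _) _.
rewrite E; apply/esym; apply: etrans (jacobianE _ _ _) _.
exact: congr1 (jacobianE _ _ _).
Qed.
End ActionJacobian.

Section Isotropy.
Context {R : realType} (M : manifold R 6) (S : su3_structure M) (act : torus_action M).
Hypothesis symm : two_torus_symmetry S act.
Notation C := (R[i]).
Notation toC := (map_mx (real_complex R)).
Implicit Types (c : chart R 6 M) (p q : M) (a b : R[i] * R[i]).

Local Notation act_jacobian := (act_jacobian act).

Lemma su3_frame_unit c p E : chart_at c p ->
  su3_adapted (su3_J S c p) (su3_g S c p) (su3_sigma S c p)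
      (su3_psip S c p) (su3_psim S c p) E ->
  su3_frame (su3_J S c p) E \in unitmx.
Proof.
move=> cp [gF _ _]; apply: orthonormal_unit gF.
by have [[gm _ _] _ _] := su3_riemannian S; exact: gm.
Qed.

Lemma symmetry_jacobian a c c' p E E' : T2 a -> chart_at c p -> chart_at c' (act a p) ->
  let ad c p E := su3_adapted (su3_J S c p) (su3_g S c p) (su3_sigma S c p)
      (su3_psip S c p) (su3_psim S c p) E in
  ad c p E -> ad c' (act a p) E' ->
  let D := act_jacobian a c c' p in
  exists B : 'M[C]_3, [/\ \det B = 1,
    toC D *m zmx (su3_frame (su3_J S c' (act a p)) E') = zmx (su3_frame (su3_J S c p) E) *m B
  & su3_J S c p *m D = D *m su3_J S c' (act a p)].
Proof.
move=> Ta cp cap ad adE adE' D.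
apply: volume_form_complex_linear.
- exact: su3_almost_complex.
- exact: su3_almost_complex.
- exact: su3_frame_unit adE.
- exact: su3_frame_unit adE'.
- move=> A; rewrite -!complex_detE.
  have [_ _ <-] := adE; have [_ _ <-] := adE'.
  have [_ Pp Pm] := symm p Ta.
  by rewrite /D /act_jacobian (Pp c c' A)// (Pm c c' A).
Qed.

Lemma symmetry_J a c c' p : T2 a -> chart_at c p -> chart_at c' (act a p) ->
  su3_J S c p *m act_jacobian a c c' p = act_jacobian a c c' p *m su3_J S c' (act a p).
Proof.
move=> Ta cp cap.
have [E adE] := su3_adapted_frame S cp; have [E' adE'] := su3_adapted_frame S cap.
by have [B []] := symmetry_jacobian Ta cp cap adE adE'.
Qed.

(** The metric is [sigma (- J u) v]; the action preserves [sigma], and commutes with [J] because it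
    preserves the complex volume form. *)
Lemma symmetry_g a c c' p (u v : 'rV[R]_6) : T2 a -> chart_at c p -> chart_at c' (act a p) ->
  ev2 (su3_g S c' (act a p)) (u *m act_jacobian a c c' p) (v *m act_jacobian a c c' p) =
  ev2 (su3_g S c p) u v.
Proof.
move=> Ta cp cap; have JD := symmetry_J Ta cp cap.
set D := act_jacobian a c c' p in JD *.
have gs c0 p0 (x y : 'rV[R]_6) : chart_at c0 p0 ->
    ev2 (su3_g S c0 p0) x y = ev2 (su3_sigma S c0 p0) (- (x *m su3_J S c0 p0)) y.
  by move=> cp0; rewrite su3_sigmaE// mulNmx -mulmxA su3_almost_complex// mulmxN opprK mulmx1.
rewrite !gs// -!mulmxA -JD mulmxA -mulNmx.
have [Ps _ _] := symm p Ta.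
rewrite /ev2 -[RHS](Ps c c' _ cp cap).
by congr (su3_sigma _ _ _ _); exact/esym/(@mul_col_mx _ 1 1 6 6).
Qed.

(** In the coordinates [Z] the metric is the real part of the standard Hermitian form [h]. A
    complex-linear map preserving the real part preserves all of [h], as one sees by testing on a
    vector and on its product with ['i]. *)
Lemma isotropy_unitary a c p E : stab act p a -> chart_at c p ->
  su3_adapted (su3_J S c p) (su3_g S c p) (su3_sigma S c p)
      (su3_psip S c p) (su3_psim S c p) E ->
  let D := act_jacobian a c c p in let Z := zmx (su3_frame (su3_J S c p) E) in
  exists B : 'M[C]_3, [/\ \det B = 1, B \is unitarymx & toC D *m Z = Z *m B].
Proof.
move=> [Ta ap] cp adE D Z.
have cap : chart_at c (act a p) by rewrite ap.
have adE' := adE; rewrite -{1 2 3 4 5}ap in adE'.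
have := symmetry_jacobian Ta cp cap adE adE'; rewrite ap -/D -/Z => -[B [dB DZ _]].
exists B; split=> //.
pose F := su3_frame (su3_J S c p) E.
have [gF _ _] := adE; have [[gm _ _] _ _] := su3_riemannian S.
pose h (w w' : 'rV[C]_3) : C := (w *m map_mx Num.conj w'^T) 0 0.
have gre (u v : 'rV[R]_6) : ev2 (su3_g S c p) u v = complex.Re (h (toC u *m Z) (toC v *m Z)).
  rewrite (orthonormal_ev (gm c p cp) gF) -/F /h mxE.
  have ReS (G : 'I_3 -> C) : complex.Re (\sum_i G i) = \sum_i complex.Re (G i).
    by elim/big_rec2: _ => // i y1 y2 _ <-; case: (G i) => ? ?; case: y2.
  rewrite ReS; apply: etrans (@big_split_ord _ _ _ 3 3 _ _) _; rewrite /= -big_split/=.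
  apply: eq_bigr => i _; 
  have -> : (map_mx Num.conj (toC v *m Z)^T) i 0 = ((toC v *m Z) 0 i)^* by rewrite !mxE.
  rewrite !zmxE /= !mxE.
  by rewrite mulrN opprK.
have uF : F \in unitmx by exact: su3_frame_unit adE.
have JJ := su3_almost_complex S cp.
have hB w w' : complex.Re (h (w *m B) (w' *m B)) = complex.Re (h w w').
  have [a1 [b1 [_ E1]]] := zmx_surj JJ uF w; have [a2 [b2 [_ E2]]] := zmx_surj JJ uF w'.
  have := @symmetry_g a c c p (a1 *m E + b1 *m E *m su3_J S c p) (a2 *m E + b2 *m E *m su3_J S c p) Ta cp cap.
  rewrite ap -/D !gre.
  have DZ' v : toC (v *m D) *m Z = toC v *m Z *m B by rewrite map_mxM -mulmxA DZ mulmxA.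
  by rewrite !DZ' E1 E2.
apply/unitarymxP; apply/matrixP => i j.
set N := B *m _.
have hN (k : C) : h (k *: delta_mx 0 i *m B) (delta_mx 0 j *m B) = k * N i j.
  rewrite /h trmx_mul map_mxM trmx_delta map_delta_mx mulmxA -!scalemxAl mxE; congr (_ * _).
  by rewrite -(mulmxA _ B _) -[B *m _]/N -rowE -colE !mxE.
have h1 (k : C) : h (k *: delta_mx 0 i) (delta_mx 0 j) = k * (1%:M : 'M[C]_3) i j.
  rewrite /h trmx_delta map_delta_mx -!scalemxAl mxE; congr (_ * _).
  by rewrite mul_delta_mx_cond mulmxnE !mxE !eqxx.
have := hB ('i *: delta_mx 0 i) (delta_mx 0 j); have := hB (1 *: delta_mx 0 i) (delta_mx 0 j).
rewrite !hN !h1 !mul1r; case: (N i j) => x y; case: ((1%:M : 'M[C]_3) i j) => x' y' /= -> .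
by rewrite /= !mul0r !mul1r !sub0r => /oppr_inj ->.
Qed.

Lemma unitary_eigen (n : nat) (B : 'M[C]_n) (w : 'rV[C]_n) (k : C) :
  B \is unitarymx -> w != 0 -> w *m B = k *: w -> `|k| = 1.
Proof.
move=> /unitarymxP uB w0 E.
pose nw : C := (w *m map_mx Num.conj w^T) 0 0.
have nw0 : nw != 0.
  apply: contra w0; rewrite /nw mxE => /eqP nw0; apply/eqP/rowP => j; rewrite [RHS]mxE.
  have nneg i : true -> 0 <= `|w 0 i| ^+ 2 by move=> _; rewrite exprn_ge0.
  have S0 : \sum_i `|w 0 i| ^+ 2 = 0.
    by rewrite -[RHS]nw0; apply: eq_bigr => i _; rewrite !mxE normCK.
  have /eqP : `|w 0 j| ^+ 2 = 0 by exact: (psumr_eq0P nneg S0).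
  by rewrite sqrf_eq0 normr_eq0 => /eqP.
have : ((w *m B) *m map_mx Num.conj (w *m B)^T) 0 0 = nw.
  by rewrite trmx_mul map_mxM mulmxA -(mulmxA w) uB mulmx1.
rewrite E linearZ/= map_mxZ -scalemxAl -scalemxAr !mxE mulrA -normCK.
rewrite -[X in _ * X](_ : nw = _); last by rewrite /nw mxE.
rewrite -[RHS]mul1r => /(mulIf nw0) /eqP; rewrite sqrp_eq1 ?normr_ge0// => /eqP //.
Qed.

(** Commutativity of the torus makes the unitary matrices [B a] commute, so one basis [P]
    diagonalises all of them. The weights are their diagonal entries there, and the determinant 1 of
    [B a] is the product of the weights. *)
Lemma isotropy_weights c p : chart_at c p ->
  exists (W : 'M[C]_(6, 3)) (chi : R[i] * R[i] -> 'rV[C]_3),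
  [/\ forall v : 'rV[R]_6, toC v *m W = 0 -> v = 0,
      forall a, stab act p a -> toC (act_jacobian a c c p) *m W = W *m diag_mx (chi a),
      forall a i, stab act p a -> `|chi a 0 i| = 1,
      forall a, stab act p a -> \prod_i chi a 0 i = 1
    & forall a b i, stab act p a -> stab act p b -> chi (a * b) 0 i = chi a 0 i * chi b 0 i].
Proof.
move=> cp; have [E adE] := su3_adapted_frame S cp.
set J := su3_J S c p in adE; have JJ : J *m J = - 1%:M by exact: su3_almost_complex.
have uF : su3_frame J E \in unitmx by exact: su3_frame_unit adE.
set Z := zmx (su3_frame J E).
pose B a := toC (E *m act_jacobian a c c p) *m Z.
have EZ : toC E *m Z = 1%:M by exact: zmx_E.
have HB a : stab act p a -> [/\ \det (B a) = 1, B a \is unitarymx & toC (act_jacobian a c c p) *m Z = Z *m B a].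
  move=> ap; have [B' [dB uB DB]] := isotropy_unitary ap cp adE.
  have -> // : B a = B'.
  by rewrite /B map_mxM -mulmxA [X in _ *m X]DB mulmxA EZ mul1mx.
have JM a b : stab act p a -> stab act p b ->
    act_jacobian (a * b) c c p = act_jacobian b c c p *m act_jacobian a c c p.
  move=> [Ta ap] [Tb bp].
  have := @act_jacobianM _ _ _ act a b c c c p Ta Tb cp; rewrite bp ap.
  by move=> /(_ cp cp).
have BM a b : stab act p a -> stab act p b -> B b *m B a = B (a * b).
  move=> ap bp; have [_ _ Ea] := HB _ ap; have [_ _ Eb] := HB _ bp.
  have intertwine (E' : 'M[C]_(3, 6)) (Z' : 'M[C]_(6, 3)) (D1 D2 : 'M[C]_6) (B1 B2 : 'M[C]_3) :
      E' *m Z' = 1%:M -> D1 *m Z' = Z' *m B1 -> D2 *m Z' = Z' *m B2 ->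
      E' *m (D2 *m D1) *m Z' = B2 *m B1.
    by move=> EZ' E1 E2; rewrite -!mulmxA E1 (mulmxA D2) E2 !mulmxA EZ' mul1mx.
  rewrite -(intertwine _ _ _ _ _ _ EZ Ea Eb).
  congr (_ *m _); rewrite -!map_mxM -JM//.
have uB A : (exists2 a, stab act p a & A = B a) -> A \is unitarymx.
  by move=> [a ap ->]; have [_ u _] := HB a ap.
have cB A A' : (exists2 a, stab act p a & A = B a) -> (exists2 a, stab act p a & A' = B a) ->
    A *m A' = A' *m A.
  move=> [a ap ->] [b bp ->]; apply: etrans (BM b a bp ap) _; apply: etrans _ (esym (BM a b ap bp)).
  by rewrite mulrC.
clearbody B.
have [P uP HP] := codiagonalizable_unitary uB cB.
pose chi a : 'rV[C]_3 := \row_i (P *m B a *m invmx P) i i.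
have chiE a : stab act p a -> P *m B a *m invmx P = diag_mx (chi a).
  move=> ap; have /is_diag_mxP dg := HP (B a) (ex_intro2 _ _ a ap erefl).
  apply/matrixP => i j; rewrite [RHS]mxE; case: (eqVneq i j) => [->|ij].
    by rewrite mulr1n [RHS]mxE.
  by rewrite mulr0n dg.
exists (Z *m invmx P), chi; split.
- move=> v /(congr1 (mulmx^~ P)); rewrite mul0mx mulmxA mulmxKV// => vZ.
  by apply: (zmx_inj uF); rewrite -/Z vZ map_mx0 mul0mx.
- move=> a ap; have [_ _ Ea] := HB a ap.
  by rewrite mulmxA Ea -chiE// !mulmxA mulmxKV.
- move=> a i ap; have [_ uBa _] := HB a ap.
  apply: (unitary_eigen uBa (w := row i P)).
    apply: contraTneq (uP) => r0; rewrite -row_free_unit -kermx_eq0.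
    apply/eqP => K; have : (delta_mx 0 i : 'rV[C]_3) *m P == 0 by rewrite -rowE r0.
    rewrite -sub_kermx K submx0 => /eqP /(congr1 (fun A : 'rV[C]_3 => A 0 i)).
    by rewrite !mxE !eqxx => /eqP; rewrite oner_eq0.
  rewrite -row_mul; have -> : P *m B a = diag_mx (chi a) *m P by rewrite -chiE// mulmxKV.
  by rewrite row_mul row_diag_mx -scalemxAl -rowE.
- move=> a ap; have [dB _ _] := HB a ap.
  by rewrite -det_diag -chiE// !det_mulmx det_inv mulrAC mulfV ?mul1r// -unitfE -unitmxE.
- move=> a b i ap bp; have cab := chiE _ (stabM ap bp).
  have ca := chiE _ ap; have cb := chiE _ bp.
  have dg : diag_mx (chi (a * b)) = diag_mx (chi b) *m diag_mx (chi a).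
    apply: etrans (esym cab) _; apply: etrans _ (congr2 mulmx cb ca).
    by rewrite -(BM _ _ ap bp) !mulmxA mulmxKV.
  clearbody chi.
  have := congr1 (fun A : 'M[C]_3 => A i i) dg; rewrite mulmx_diag.
  by rewrite !mxE eqxx !mulr1n => ->; rewrite mulrC.
Qed.
End Isotropy.

(** The tube lemma. With [K] a set of lifts of group elements, it finds points near [y] that all
    these elements keep inside a given open set. *)
Lemma compact_tube (U V : topologicalType) (K : set U) (Om : set (U * V)) (y : V) :
  compact K -> open Om -> (forall x, K x -> Om (x, y)) ->
  exists2 D : set V, open_nbhs y D & forall z x, D z -> K x -> Om (x, z).
Proof.
move=> /compact_near_coveringP cK oO KO.
have : \forall z \near y, forall x, K x -> Om (x, z).
  apply: (cK V (nbhs y) (fun z x => Om (x, z))) => x Kx.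
  have [[A B] [/= xA yB] AB] : nbhs (x, y) Om by exact: open_nbhs_nbhs (conj oO (KO _ Kx)).
  by exists (A, B) => // -[x' z] [/= Ax' Bz]; apply: AB.
move=> yK; have : nbhs y [set z | forall x, K x -> Om (x, z)] by exact: yK.
by rewrite nbhsE => -[D yD DK]; exists D => // z x Dz; exact: DK.
Qed.

(** * Polydiscs in complex coordinates *)

Section ComplexCoordinates.
Context {R : realType}.
Notation C := (R[i]).
Implicit Types (x y v : 'rV[R]_6) (i : 'I_3) (z : C).

Lemma unsplit_surj (j : 'I_6) : exists k : 'I_3 + 'I_3, j = unsplit k.
Proof. by exists (@fintype.split 3 3 j); rewrite (@splitK 3 3). Qed.

(* R^6 is C^3 through [z_i = x_i + i x_(3 + i)], the convention of [su3_frame]. *)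
Definition zeta i x : C := (x 0 (@lshift 3 3 i) +i* x 0 (@rshift 3 3 i))%C.

Definition of_zeta (z : 'I_3 -> C) : 'rV[R]_6 :=
  @row_mx R 1 3 3 (\row_i complex.Re (z i)) (\row_i complex.Im (z i)).

Lemma of_zetaK (z : 'I_3 -> C) i : zeta i (of_zeta z) = z i.
Proof.
rewrite /zeta /of_zeta (@row_mxEl _ 1 3 3) (@row_mxEr _ 1 3 3) !mxE.
by case: (z i).
Qed.

Lemma zeta_inj x y : (forall i, zeta i x = zeta i y) -> x = y.
Proof.
move=> xy; apply/rowP => j.
have [k ->] := unsplit_surj j.
by case: k => k; have [] := xy k.
Qed.

Lemma zeta0 i : zeta i 0 = 0. Proof. by rewrite /zeta !mxE. Qed.

Lemma zetaD i x y : zeta i (x + y) = zeta i x + zeta i y.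
Proof. by rewrite /zeta !mxE. Qed.

Lemma zetaZ i (r : R) x : zeta i (r *: x) = r%:C%C * zeta i x.
Proof. by rewrite /zeta !mxE; apply/eqP; rewrite eq_complex /=; apply/andP; split; apply/eqP; ring. Qed.

Definition csq z : R := complex.Re z ^+ 2 + complex.Im z ^+ 2.

Lemma csqM z w : csq (z * w) = csq z * csq w.
Proof. by case: z w => a b [c d]; rewrite /csq /=; ring. Qed.

Lemma csq_ge0 z : 0 <= csq z. Proof. by rewrite addr_ge0 ?sqr_ge0. Qed.

Lemma csq_eq0 z : csq z = 0 -> z = 0.
Proof.
case: z => a b /eqP; rewrite /csq paddr_eq0 ?sqr_ge0// !sqrf_eq0 => /andP[/eqP/= -> /eqP /= ->].
by [].
Qed.

Lemma csq_S1 z : S1 z -> csq z = 1. Proof. by move/S1P. Qed.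

(** Bounding each complex coordinate separately makes the set invariant under all diagonal unitary
    maps, in particular under the weights; squares keep the inequalities polynomial. *)
Definition polydisc (r : R) : set 'rV[R]_6 := [set x | forall i, csq (zeta i x) < r ^+ 2].

Lemma csq_zeta_continuous i : continuous (fun x : 'rV[R]_6 => csq (zeta i x) : R).
Proof.
have cj (j : 'I_6) : continuous (fun x : 'rV[R]_6 => x 0 j ^+ 2 : R).
  by move=> x; apply: (@continuous_comp _ _ _ (fun y : 'rV[R]_6 => y 0 j) (fun t : R => t ^+ 2));
    [exact: coord_continuous|exact: exprn_continuous].
by move=> x; exact: (cvgD (cj (@lshift 3 3 i) x) (cj (@rshift 3 3 i) x)).
Qed.

Lemma polydisc_open r : open (polydisc r).
Proof.
rewrite openE => x xr.
apply: (@filter_forall _ _ (fun i y => csq (zeta i y) < r ^+ 2) (nbhs x)) => i.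
exact: (csq_zeta_continuous (open_nbhs_nbhs (conj (open_lt (y := r ^+ 2)) (xr i)))).
Qed.

Lemma polydisc_nbhs (U : set 'rV[R]_6) : nbhs (0 : 'rV[R]_6) U ->
  exists2 r : R, 0 < r & polydisc r `<=` U.
Proof.
move=> /nbhs_ballP[r /= r0 rU]; exists (r / 2); first by rewrite divr_gt0.
move=> x xr; apply: rU; rewrite -ball_normE /= sub0r normrN.
have r2 : 0 <= r / 2 by rewrite divr_ge0// ltW.
apply: (@le_lt_trans _ _ (r / 2)); last by rewrite ltr_pdivrMr// ltr_pMr// ltr1n.
apply: norm_rV_le => // j.
have [k ->] := unsplit_surj j.
rewrite -(ler_pXn2r (n := 2))// ?nnegrE// real_normK ?num_real//.
case: k => k; apply: le_trans (ltW (xr k)); rewrite /csq /=.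
  by rewrite lerDl sqr_ge0.
by rewrite lerDr sqr_ge0.
Qed.
End ComplexCoordinates.

Section IsotropyReal.
Context {R : realType} (M : manifold R 6) (S : su3_structure M) (act : torus_action M).
Hypothesis symm : two_torus_symmetry S act.
Notation C := (R[i]).

Lemma isotropy_zeta (c : chart R 6 M) p : chart_at c p ->
  exists (A : 'M[R]_6) (chi : 'I_3 -> C * C -> C),
  [/\ A \in unitmx,
      forall a i (v : 'rV[R]_6), stab act p a ->
        zeta i (v *m act_jacobian act a c c p *m A) = chi i a * zeta i (v *m A),
      forall a i, stab act p a -> S1 (chi i a),
      forall a, stab act p a -> \prod_i chi i a = 1
    & forall a b i, stab act p a -> stab act p b -> chi i (a * b) = chi i a * chi i b].
Proof.
move=> cp; have [W [chi [Winj WD n1 p1 cM]]] := isotropy_weights symm cp.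
pose A : 'M[R]_6 := @row_mx R 6 3 3 (map_mx (@complex.Re R) W) (map_mx (@complex.Im R) W).
have zA i (v : 'rV[R]_6) : zeta i (v *m A) = (map_mx (real_complex R) v *m W) 0 i.
  have E : v *m A = @row_mx R 1 3 3 (v *m map_mx (@complex.Re R) W) (v *m map_mx (@complex.Im R) W).
    exact: (@mul_mx_row R 1 6 3 3).
  rewrite /zeta E (@row_mxEl _ 1 3 3) (@row_mxEr _ 1 3 3) !mxE.
  have ReIm (G : 'I_6 -> C) : ((\sum_i complex.Re (G i)) +i* (\sum_i complex.Im (G i)))%C = \sum_i G i.
    elim/big_rec3: _ => // j y1 y2 y3 _ <-; by case: (G j).
  rewrite -ReIm; apply/eqP; rewrite eq_complex /=; apply/andP; split; apply/eqP; apply: eq_bigr => j _; rewrite !mxE;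
    case: (W j i) => a b /=; ring.
exists A, (fun i a => chi a 0 i); split=> //.
- rewrite -row_free_unit -kermx_eq0; apply/eqP/row_matrixP => k; rewrite row0.
  apply: Winj; apply/rowP => i; rewrite -zA -row_mul mulmx_ker row0 zeta0 mxE //.
- move=> a i v ap; rewrite !zA map_mxM -mulmxA WD// mulmxA mul_mx_diag mxE mulrC.
  by [].
Qed.
End IsotropyReal.

(** * Linearization of the stabiliser *)

Section ComplexMean.
Context {R : realType} {T : comPzRingType}.
Notation C := (R[i]).
Variables (H : set T) (m : (T -> R) -> R).
Hypotheses (mb : bounded_functional H m 1) (m1 : m (fun=> 1) = 1).
Hypothesis minv : forall f s, bounded_over H f -> H s -> m (fun a => f (s * a)) = m f.
Implicit Types (f g : T -> R) (h : T -> C) (z : C).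

Lemma bounded_lin f g (x y : R) : bounded_over H f -> bounded_over H g ->
  bounded_over H (fun a => x * f a + y * g a).
Proof.
move=> [Cf fC] [Cg gC]; exists (`|x| * Cf + `|y| * Cg) => a Ha.
by rewrite (le_trans (ler_normD _ _))// !normrM lerD// ler_wpM2l ?fC ?gC.
Qed.

Lemma bounded_cst (x : R) : bounded_over H (fun=> x).
Proof. by exists `|x|. Qed.

(** The difference is bounded by 0 on [H], so the norm bound of the functional makes its mean
    vanish. *)
Lemma mean_ext f g : bounded_over H f -> (forall a, H a -> f a = g a) -> m f = m g.
Proof.
move=> fb fg; have [_ ml mle] := mb.
have gb : bounded_over H g by have [B fB] := fb; exists B => a Ha; rewrite -fg// fB.
have := mle (fun a => f a + (-1) * g a) 0 (lexx _).
rewrite mulr0 ml// mulN1r => /(_ _) H0; apply/eqP; rewrite -subr_eq0 -normr_le0 H0// => a Ha.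
by rewrite fg// mulN1r subrr normr0.
Qed.

Lemma mean_lin f g (x y : R) : bounded_over H f -> bounded_over H g ->
  m (fun a => x * f a + y * g a) = x * m f + y * m g.
Proof.
move=> fb gb; have [_ ml _] := mb.
have z0 : m (fun=> 0) = 0.
  have := ml _ _ (-1) (bounded_cst 0) (bounded_cst 0).
  by under eq_fun do rewrite mulr0 addr0; rewrite mulN1r subrr.
have xf : m (fun a => x * f a) = x * m f.
  have := ml _ _ x (bounded_cst 0) fb; rewrite z0 add0r => <-.
  by congr (m _); apply/funext => a; rewrite add0r.
rewrite ml// ?xf//.
by have := bounded_lin x 0 fb (bounded_cst 0); under eq_fun do rewrite mulr0 addr0.
Qed.

Definition cbounded h := bounded_over H (fun a => complex.Re (h a)) /\ bounded_over H (fun a => complex.Im (h a)).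

Definition cmean h : C := (m (fun a => complex.Re (h a)) +i* m (fun a => complex.Im (h a)))%C.

Lemma cmean_ext h h' : cbounded h -> (forall a, H a -> h a = h' a) -> cmean h = cmean h'.
Proof.
by move=> [b1 b2] hh'; congr Complex; apply: mean_ext => // a Ha; rewrite /= hh'.
Qed.

Lemma cmeanZ z h : cbounded h -> cmean (fun a => z * h a) = z * cmean h.
Proof.
case: z => x y [b1 b2]; apply/eqP; rewrite eq_complex /=; apply/andP; split; apply/eqP.
  rewrite -mulNr -mean_lin//; congr (m _); apply/funext => a /=; case: (h a) => u v /=; ring.
by rewrite -mean_lin//; congr (m _); apply/funext => a /=; case: (h a) => u v /=; ring.
Qed.

Lemma cmean_cst z : cmean (fun=> z) = z.
Proof.
have mc (x : R) : m (fun=> x) = x.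
  have := mean_lin x 0 (bounded_cst 1) (bounded_cst 0); rewrite m1 mulr1.
  by rewrite !mul0r !addr0.
by rewrite /cmean !mc; case: z.
Qed.

Lemma cmean_inv h s : cbounded h -> H s -> cmean (fun a => h (s * a)) = cmean h.
Proof. by move=> [b1 b2] Hs; congr Complex; apply: (minv (f := fun a => _ (h a))). Qed.

(** Weights that depend on the group element alone are absorbed in the functional. What remains to
    be averaged is then a smooth function of the lift and of the chart variable, to which
    differentiation under the mean applies. *)
Lemma weighted_functional f : (forall a, H a -> `|f a| <= 1) ->
  bounded_functional H (fun g => m (fun a => f a * g a)) 1.
Proof.
move=> f1; have [_ ml mle] := mb.
have fb g : bounded_over H g -> bounded_over H (fun a => f a * g a).
  move=> [B gB]; exists `|B| => a Ha; rewrite normrM.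
  by rewrite (le_trans (ler_wpM2r _ (f1 a Ha)))// mul1r (le_trans (gB a Ha))// ler_norm.
split=> // [g g' k gb gb'|g B B0 gB].
  rewrite -ml//; try exact: fb.
  by congr (m _); apply/funext => a; ring.
rewrite mul1r -[leRHS]mul1r; apply: mle => // a Ha; rewrite normrM.
by rewrite (le_trans (ler_wpM2r _ (f1 a Ha)))// mul1r gB.
Qed.
End ComplexMean.

Section AveragedMap.
Context {R : realType} {M : manifold R 6}.
Variables (act : torus_action M) (q : M) (c : chart R 6 M).
Notation C := (R[i]).
Let T : comPzRingType := (C * C)%type.
Let H : set T := stab act q.
Variables (m : (T -> R) -> R) (A : 'M[R]_6).
Hypotheses (mb : bounded_functional H m 1) (cq : chart_at c q).
Variable D : set 'rV[R]_6.
Let K : set 'rV[R]_2 := tbox `&` [set X | H (texp X)].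
Hypotheses (oD : open D) (D0 : D (chart_map c q)).
Hypothesis DK : forall x X, D x -> K X -> act_domain act c c (X, x).
Variable X : T -> 'rV[R]_2.
Hypothesis XP : forall a, H a -> K (X a) /\ texp (X a) = a.

Let Ac : atlas c. Proof. by case: cq. Qed.
Let oOm : open (act_domain act c c). Proof. exact: act_domain_open. Qed.
Let cK : compact K. Proof. by apply: compact_closedI; [exact: tbox_compact|exact: stab_closed]. Qed.

Let G (Xx : 'rV[R]_2 * 'rV[R]_6) : 'rV[R]_6 := chart_map c (act (texp Xx.1) (chart_inv c Xx.2)).
Let F k (Xx : 'rV[R]_2 * 'rV[R]_6) : R^o := (G Xx *m A) 0 k.

Let G_smooth : smooth_on (act_domain act c c) G.
Proof. exact: act_smooth. Qed.

Let F_smooth k : smooth_on (act_domain act c c) (F k).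
Proof.
move=> j; apply: (Ck_on_coord (f := fun Xx => G Xx *m A)) => //.
apply: (@Ck_on_lin _ _ _ _ _ _ G (mulmxr A)) => //.
exact: linear_rV_continuous.
Qed.

Let Om_q a : H a -> act_domain act c c (X a, chart_map c q).
Proof. by move=> Ha; have [KX _] := XP Ha; exact: DK. Qed.

Let G_diff a (v : 'rV[R]_6) : H a -> differentiable G (X a, chart_map c q) /\
  'd G (X a, chart_map c q) (0, v) = v *m act_jacobian act a c c q.
Proof.
move=> Ha; have [_ Xa] := XP Ha.
have dG : differentiable G (X a, chart_map c q) := Ck_on_diff (G_smooth 1%N) (Om_q Ha).
split=> //; have [d1 _] := diff_cst_ptw (X a) (chart_map c q).
have [d2 _] := diff_id_ptw (chart_map c q).
have [d3 d3'] := diff_pair_ptw d1 d2.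
have [d4 d4'] := diff_comp_ptw d3 dG.
apply/esym; apply: etrans (jacobianE _ _ _) _.
have -> : act_rep act a c c = fun y => G (X a, y) by apply/funext => y; rewrite /act_rep /G /= Xa.
apply: etrans (d4' v) _; congr ('d G _ _); apply: etrans (d3' v) _.
by congr pair; [have [_] := diff_cst_ptw (X a) (chart_map c q); exact|have [_] := diff_id_ptw (chart_map c q); exact].
Qed.

Let F_diff k a (v : 'rV[R]_6) : H a ->
  'd (F k) (X a, chart_map c q) (0, v) = (v *m act_jacobian act a c c q *m A) 0 k.
Proof.
move=> Ha; have [dG <-] := G_diff v Ha.
have cL : continuous (mulmxr A : 'rV[R]_6 -> 'rV[R]_6) := @linear_rV_continuous _ _ _ _.
have [dL dL'] := diff_lin_ptw (G (X a, chart_map c q)) cL.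
have [dLG dLG'] := diff_comp_ptw dG dL.
have E := diff_rV (0, v) k dLG.
have E2 := etrans (dLG' (0, v)) (dL' ('d G (X a, chart_map c q) (0, v))).
exact: etrans (esym E) (congr1 (fun w : 'rV[R]_6 => w 0 k) E2).
Qed.

Section Weighted.
Variables (b : T -> C) (i : 'I_3).
Hypothesis b1 : forall a, H a -> csq (b a) <= 1.

(* The real part of the mean over the stabiliser of [b a * zeta i] after the action of
   [a]; with [b] the inverse of a weight, or [-i] times it, these are the real and
   imaginary parts of the linearizing coordinates. *)
Definition averaged x : R^o :=
  m (fun a => complex.Re (b a * zeta i (chart_map c (act a (chart_inv c x)) *m A))).

Let Re1 a : H a -> `|complex.Re (b a)| <= 1.
Proof.
move=> /b1 h; rewrite -(ler_pXn2r (n := 2))// ?nnegrE// expr1n real_normK ?num_real//.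
by apply: le_trans h; rewrite /csq lerDl sqr_ge0.
Qed.

Let Im1 a : H a -> `|- complex.Im (b a)| <= 1.
Proof.
move=> /b1 h; rewrite normrN -(ler_pXn2r (n := 2))// ?nnegrE// expr1n real_normK ?num_real//.
by apply: le_trans h; rewrite /csq lerDr sqr_ge0.
Qed.

Let mRe := weighted_functional mb Re1.
Let mIm := weighted_functional mb Im1.

Let XK a : H a -> K (X a). Proof. by move=> /XP[]. Qed.
Let CD X' x : K X' -> D x -> act_domain act c c (X', x). Proof. by move=> KX Dx; exact: DK. Qed.

Let lin2 (f g : T -> R) : bounded_over H f -> bounded_over H g ->
  m (fun a => complex.Re (b a) * f a) + m (fun a => - complex.Im (b a) * g a) =
  m (fun a => complex.Re (b a) * f a + - complex.Im (b a) * g a) /\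
  bounded_over H (fun a => complex.Re (b a) * f a + - complex.Im (b a) * g a).
Proof.
move=> fb gb; have [_ ml _] := mb.
have bw (w h : T -> R) : (forall a, H a -> `|w a| <= 1) -> bounded_over H h ->
    bounded_over H (fun a => w a * h a).
  move=> w1 [B hB]; exists B => a Ha; rewrite normrM.
  by rewrite -[leRHS]mul1r ler_pM// ?w1// hB.
have b12 := bounded_lin 1 1 (bw _ _ Re1 fb) (bw _ _ Im1 gb).
split; last by under eq_fun do rewrite -[X in X + _]mul1r -[X in _ + X]mul1r.
rewrite -[X in _ + X]mul1r -ml; [|exact: bw Re1 fb|exact: bw Im1 gb].
by congr m; apply/funext => a; rewrite mul1r.
Qed.

Let avE x : D x -> averaged x =
  m (fun a => complex.Re (b a) * F (@lshift 3 3 i) (X a, x)) +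
  m (fun a => - complex.Im (b a) * F (@rshift 3 3 i) (X a, x)).
Proof.
move=> Dx.
have bF k : bounded_over H (fun a => F k (X a, x)).
  exact: (param_bounded cK XK oOm CD (F_smooth k 0%N) Dx).
have [-> bb] := lin2 (bF (@lshift 3 3 i)) (bF (@rshift 3 3 i)).
apply/esym/(mean_ext mb) => // a Ha; have [_ Xa] := XP Ha.
by rewrite /F /G /= Xa /zeta; case: (b a) => u w /=; ring.
Qed.

Lemma averaged_bounded x : D x -> bounded_over H
  (fun a => complex.Re (b a * zeta i (chart_map c (act a (chart_inv c x)) *m A))).
Proof.
move=> Dx.
have bF k : bounded_over H (fun a => F k (X a, x)).
  exact: (param_bounded cK XK oOm CD (F_smooth k 0%N) Dx).
have [_ [B fB]] := lin2 (bF (@lshift 3 3 i)) (bF (@rshift 3 3 i)).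
exists B => a Ha; apply: le_trans (fB a Ha); have [_ Xa] := XP Ha.
by rewrite /F /G /= Xa /zeta; case: (b a) => u w /=; rewrite mulNr.
Qed.

Lemma averaged_smooth : smooth_on D averaged.
Proof.
move=> k; apply: (@Ck_on_eq _ _ _ _ _ ((fun x => m (fun a => complex.Re (b a) * F (@lshift 3 3 i) (X a, x)) : R^o) +
  (fun x => m (fun a => - complex.Im (b a) * F (@rshift 3 3 i) (X a, x)) : R^o))) => //.
  by move=> x /set_mem Dx; rewrite avE.
apply: Ck_on_add => //.
  exact: (Ck_on_param mRe cK XK oOm oD CD (F_smooth (@lshift 3 3 i) k)).
exact: (Ck_on_param mIm cK XK oOm oD CD (F_smooth (@rshift 3 3 i) k)).
Qed.

Lemma averaged_diff v : 'd averaged (chart_map c q) v =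
  m (fun a => complex.Re (b a * zeta i (v *m act_jacobian act a c c q *m A))) :> R.
Proof.
have [d1 d1'] := param_diff mRe cK XK oOm oD CD (F_smooth (@lshift 3 3 i) 1%N) D0.
have [d2 d2'] := param_diff mIm cK XK oOm oD CD (F_smooth (@rshift 3 3 i) 1%N) D0.
have [d3 d3'] := diffD_ptw d1 d2.
have nE : \forall y \near chart_map c q, m (fun a => complex.Re (b a) * F (@lshift 3 3 i) (X a, y)) +
    m (fun a => - complex.Im (b a) * F (@rshift 3 3 i) (X a, y)) = averaged y :> R^o.
  by apply: filterS (open_nbhs_nbhs (conj oD D0)) => y Dy; rewrite avE.
have [_ E] := near_eq_diff_ptw nE d3.
apply: etrans (E v) _; apply: etrans (d3' v) _; rewrite d1' d2'.
have bF k : bounded_over H (fun a => 'd (F k) (X a, chart_map c q) (0, v)).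
  have F0 : Ck_on 0 (act_domain act c c) (fun Xx => 'd (F k) Xx (0, v)) := Ck_on_d _ (F_smooth k 1%N).
  exact: (param_bounded cK XK oOm CD F0 D0).
have [-> bb] := lin2 (bF (@lshift 3 3 i)) (bF (@rshift 3 3 i)).
apply: (mean_ext mb) => // a Ha; rewrite !F_diff//.
by rewrite /zeta; case: (b a) => u w /=; ring.
Qed.
End Weighted.
End AveragedMap.

(* The polydisc is invariant, and in the coordinates [zeta] the stabiliser acts on it by
   the diagonal matrices [diag (chi 0 a, chi 1 a, chi 2 a)] of SU(3). *)
Definition linearized (R : realType) (M : manifold R 6) (act : torus_action M) (q : M)
    (c : chart R 6 M) (chi : 'I_3 -> R[i] * R[i] -> R[i]) : Prop :=
  [/\ chart_at c q /\ chart_map c q = 0,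
      chart_img c = polydisc 1,
      forall a p, stab act q a -> chart_dom c p -> chart_dom c (act a p) /\
        forall i, zeta i (chart_map c (act a p)) = chi i a * zeta i (chart_map c p),
      forall a i, stab act q a -> S1 (chi i a)
    & (forall a, stab act q a -> \prod_i chi i a = 1) /\
      forall a b i, stab act q a -> stab act q b -> chi i (a * b) = chi i a * chi i b].

Section Linearization.
Context {R : realType} {M : manifold R 6} {S : su3_structure M} {act : torus_action M}.
Hypothesis symm : two_torus_symmetry S act.
Notation C := (R[i]).

(** Averaging as in Bochner's linearisation: [Phi x] is the mean of [chi i a ^-1] times the
    coordinates, through [A], of [a] applied to [x]. Translating the mean by [b] brings out the
    factor [chi i b]. At the fixed point each averaged term has derivative [zeta i (v *m A)], so the
    Jacobian is the invertible matrix [A]. *)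
Lemma equivariant_map c q : chart_at c q -> chart_map c q = 0 ->
  exists (D : set 'rV[R]_6) (Phi : 'rV[R]_6 -> 'rV[R]_6) (chi : 'I_3 -> C * C -> C),
  [/\ [/\ open D, D 0 & D `<=` chart_img c],
      [/\ smooth_on D Phi, Phi 0 = 0 & 'J Phi 0 \in unitmx],
      forall b x, stab act q b -> D x -> chart_dom c (act b (chart_inv c x)) /\
        (D (chart_map c (act b (chart_inv c x))) -> forall i,
          zeta i (Phi (chart_map c (act b (chart_inv c x)))) = chi i b * zeta i (Phi x)),
      forall a i, stab act q a -> S1 (chi i a)
    & (forall a, stab act q a -> \prod_i chi i a = 1) /\
      forall a b i, stab act q a -> stab act q b -> chi i (a * b) = chi i a * chi i b].
Proof.
move=> cq c0; have [A [chi [uA AD chi1 chip chiM]]] := isotropy_zeta symm cq.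
pose T : comPzRingType := (C * C)%type; pose H : set T := stab act q.
have [m [mb m1 minv]] := @invariant_mean R T H (stab_1 act q) (fun a b ha hb => stabM ha hb).
have [Ac qc] := cq.
pose K : set 'rV[R]_2 := tbox `&` [set X | H (texp X)].
have cK : compact K by apply: compact_closedI; [exact: tbox_compact|exact: stab_closed].
have qE : chart_inv c 0 = q by rewrite -c0 chart_mapK.
have KO X : K X -> act_domain act c c (X, 0).
  move=> [_ [_ /= Xq]]; split=> /=; last by rewrite qE Xq.
  by rewrite -c0; exact: chart_img_map.
have [D [oD D0] DK] := compact_tube cK (@act_domain_open _ _ _ act c c Ac Ac) KO.
have /choice [X XP] : forall a : T, exists X, H a -> K X /\ texp X = a.
  move=> a; have [Ha|nH] := pselect (H a); last by exists 0.
  have [X Xb Xa] := texp_surj (proj1 Ha); exists X; split=> //; split=> //=.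
  by rewrite Xa.
(* The conjugate of a weight is its inverse, the weight having modulus 1. *)
pose w (u : C) a (i : 'I_3) : C := u * (complex.Re (chi i a) -i* complex.Im (chi i a))%C.
have w1 (u : C) i : csq u <= 1 -> forall a, H a -> csq (w u a i) <= 1.
  move=> u1 a Ha; rewrite csqM; move: (csq_S1 (chi1 a i Ha)).
  by rewrite /csq /= sqrrN => ->; rewrite mulr1.
have wK (u : C) a i z : H a -> w u a i * (chi i a * z) = u * z.
  move=> Ha; rewrite mulrA /w -(mulrA u); have /S1P := chi1 a i Ha.
  case: (chi i a) => s t /= st; congr (_ * _); rewrite -[RHS]mulr1; congr (_ * _).
  by apply/eqP; rewrite eq_complex /=; apply/andP; split; apply/eqP; [rewrite -st|]; ring.
have u1 : csq (1 : C) <= 1 by rewrite /csq /= expr1n expr0n addr0.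
(* Means are real-valued: the factors 1 and [ni] under the real part yield the real and the
   imaginary part of the complex mean. *)
pose ni : C := (0 -i* 1)%C.
have u2 : csq ni <= 1 by rewrite /csq /= sqrrN expr1n expr0n add0r.
have D0' : D (chart_map c q) by rewrite c0.
pose P u i := averaged act c m A (fun a => w u a i) i.
have DK' x X' : D x -> K X' -> act_domain act c c (X', x) by move=> Dx KX; exact: DK.
have Ps u i : csq u <= 1 -> smooth_on D (P u i).
  move=> hu; exact: (@averaged_smooth R M act q c m A mb cq D oD DK' X XP (fun a => w u a i) i (w1 u i hu)).
have Pd u i v : csq u <= 1 -> 'd (P u i) 0 v = complex.Re (u * zeta i (v *m A)) :> R.
  move=> hu; have := @averaged_diff R M act q c m A mb cq D oD D0' DK' X XP (fun a => w u a i) i (w1 u i hu) v; rewrite c0 => ->.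
  rewrite -[RHS]mul1r -m1 mulrC.
  have bR : bounded_over H (fun=> 1 : R) by exists 1 => a _; rewrite normr1.
  have := mean_lin mb (complex.Re (u * zeta i (v *m A))) 0 bR bR.
  rewrite [X in _ = _ + X]mul0r [X in _ = X]addr0 => E0; apply: etrans _ E0.
  apply/esym/(mean_ext mb); first exact: (bounded_lin _ _ bR bR).
  by move=> a Ha; rewrite AD// wK// mulr1 mul0r addr0.
pose Phi x := of_zeta (fun i => (P 1 i x +i* P ni i x)%C).
have zPhi i x : zeta i (Phi x) = cmean m (fun a => w 1 a i * zeta i (chart_map c (act a (chart_inv c x)) *m A)).
  rewrite of_zetaK /cmean; congr Complex; rewrite /P /averaged; congr m; apply/funext => a.
  by rewrite /w /ni mul1r -mulrA; case: (_ * zeta i _) => s t /=; ring.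
have Pb x i : D x -> cbounded H (fun a => w 1 a i * zeta i (chart_map c (act a (chart_inv c x)) *m A)).
  move=> Dx; have [B1 b1] := averaged_bounded A mb cq DK' XP i (w1 1 i u1) Dx.
  have [B2 b2] := averaged_bounded A mb cq DK' XP i (w1 ni i u2) Dx.
  split; [by exists B1|exists B2 => a Ha; apply: le_trans (b2 a Ha)].
  rewrite /w /ni mul1r -mulrA le_eqVlt; apply/orP; left; apply/eqP; congr (`|_|).
  by case: (_ * zeta i _) => s t /=; ring.
have Phic (j : 'I_6) : (exists2 ui : C * 'I_3, csq ui.1 <= 1 & (fun x => Phi x 0 j) = P ui.1 ui.2) .
  have [k ->] := unsplit_surj j.
  case: k => k /=; [exists (1, k)|exists (ni, k)] => //=; apply/funext => x.
    by rewrite /Phi /of_zeta (@row_mxEl _ 1 3 3) mxE.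
  by rewrite /Phi /of_zeta (@row_mxEr _ 1 3 3) mxE.
have Phis : smooth_on D Phi.
  by move=> k; apply: Ck_on_rV => // j; have [[u i] /= hu ->] := Phic j; exact: Ps.
exists D, Phi, chi; split=> //.
- split=> // x Dx; have [K1 _] := XP 1 (stab_1 act q).
  by have [] := DK x _ Dx K1.
- split=> //.
    apply: zeta_inj => i; rewrite zPhi zeta0 -[RHS](cmean_cst mb m1 0).
    apply: (cmean_ext mb (Pb 0 i D0)) => a [_ aq].
    by rewrite qE aq c0 mul0mx zeta0 mulr0.
  have -> // : 'J Phi 0 = A; apply/row_matrixP => l.
  rewrite !rowE; apply: etrans (jacobianE _ _ _) _; set v := delta_mx 0 l.
  have dPhi : differentiable Phi 0 := Ck_on_diff (Phis 1%N : Ck_on 1 D Phi) D0.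
  apply: zeta_inj => i; rewrite /zeta !(diff_rV _ _ dPhi).
  have El : (fun y => Phi y 0 (@lshift 3 3 i) : R^o) = P 1 i.
    by apply/funext => x; rewrite /Phi /of_zeta (@row_mxEl _ 1 3 3) mxE.
  have Er : (fun y => Phi y 0 (@rshift 3 3 i) : R^o) = P ni i.
    by apply/funext => x; rewrite /Phi /of_zeta (@row_mxEr _ 1 3 3) mxE.
  rewrite El Er; apply: etrans (congr2 (@Complex R) (Pd 1 i v u1) (Pd ni i v u2)) _.
  by apply/eqP; rewrite eq_complex /=; apply/andP; split; apply/eqP; rewrite /ni /=; ring.
- move=> b x Hb Dx; have xdom : chart_dom c (act b (chart_inv c x)).
    have [KX Xb] := XP b Hb; have [_ /=] := DK x _ Dx KX; by rewrite Xb.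
  split=> // Dy i; rewrite !zPhi chart_mapK//.
  set z := fun a => _; set y := chart_map _ _ in Dy.
  have Py := Pb y i Dy; rewrite /y chart_mapK// in Py.
  pose g a := w 1 a i * zeta i (chart_map c (act a (chart_inv c x)) *m A).
  have gb : cbounded H g := Pb x i Dx.
  have gbb : cbounded H (fun a => g (b * a)).
    by have [[B1 b1] [B2 b2]] := gb; split; [exists B1|exists B2] => a Ha;
      [apply: b1|apply: b2]; exact: stabM.
  rewrite -(cmean_inv minv gb Hb) -(cmeanZ mb _ gbb).
  apply: (cmean_ext mb Py) => a Ha; rewrite /g -(@actM _ _ _ act a b _ (proj1 Ha) (proj1 Hb)).
  rewrite (mulrC a b) /w !mul1r (chiM b a i Hb Ha); move: (zeta i _) => t.
  have /S1P := chi1 b i Hb; case: (chi i b) (chi i a) t => [s1 t1] [s2 t2] [s3 t3] /= st.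
  apply/eqP; rewrite eq_complex /=; apply/andP; split; apply/eqP; rewrite -[LHS]mul1r -st; ring.
Qed.

(** The map [Phi] is a chart on some [Q], but [Q] need not be invariant. The tube lemma gives a
    smaller [Q'] that the stabiliser keeps inside [Q]; a polydisc is chosen in the image of [Q'],
    and rescaling makes its radius 1. *)
Lemma linearized_chart q : exists c chi, linearized act q c chi.
Proof.
have [c0 Ac0 qc0] := atlas_cover q.
have [c [Ac dE mE iE]] := chart_linear (chart_map c0 q) Ac0 (unitmx1 R 6).
have cq : chart_at c q by split=> //; rewrite dE.
have c0' : chart_map c q = 0 by rewrite mE subrr mul0mx.
have [D [Phi [chi [[oD D0 Dc] [Phis Phi0 Ju] eqv chi1 chiX]]]] := equivariant_map cq c0'.
have [Q [g [[oO QD] Q0 imO gK gs]]] := inverse_function oD D0 Phis Ju.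
pose K : set 'rV[R]_2 := tbox `&` [set X | stab act q (texp X)].
have cK : compact K by apply: compact_closedI; [exact: tbox_compact|exact: stab_closed].
pose U : set M := chart_dom c `&` chart_map c @^-1` Q.
have oU : open U by exact: open_dom_map.
pose Om : set ('rV[R]_2 * M) := (fun Xp => act (texp Xp.1) Xp.2) @^-1` U.
have oOm : open Om by apply: open_comp => // ? _; exact: act_continuous.
have KO X : K X -> Om (X, q) by move=> [_ [_ Xq]]; rewrite /Om /= Xq; split; [case: cq|rewrite /= c0'].
have [V [oV Vq] VK] := compact_tube cK oOm KO.
pose Q' := Q `&` (chart_img c `&` chart_inv c @^-1` V).
have oO' : open Q' by apply: openI => //; exact: open_img_inv.
have Q'0 : Q' 0.
  split=> //; rewrite -c0'; split; first by apply: chart_img_map; case: cq.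
  by rewrite /= chart_mapK//; case: cq.
have Q'Q : Q' `<=` Q by move=> x [].
have [r r0 rO'] : exists2 r : R, 0 < r & polydisc r `<=` Phi @` Q'.
  apply: polydisc_nbhs; apply: open_nbhs_nbhs; split; first exact: imO.
  by exists 0.
pose Q2 := Q' `&` Phi @^-1` polydisc r.
have oO2 : open Q2.
  rewrite openE => x [Q'x rx]; apply: filterI; first exact: open_nbhs_nbhs (conj oO' Q'x).
  have Dx : D x by apply/QD/Q'Q.
  exact: (Phis 0%N x Dx _ (open_nbhs_nbhs (conj (@polydisc_open R r) rx))).
have imO2 : Phi @` Q2 = polydisc r.
  apply/seteqP; split=> [_ [x [_ rx] <-] //|y ry].
  have [x Q'x xy] := rO' y ry; exists x => //; split=> //; by rewrite /= xy.
have Q2D : Q2 `<=` D by move=> x [/Q'Q/QD].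
have A2 : atlas (chart_comp c Q2 Phi g).
  apply: chart_comp_atlas => //.
  - by move=> x [[_ []]].
  - by move=> k; apply: Ck_on_sub (Phis k).
  - by rewrite imO2; exact: polydisc_open.
  - by move=> x [[Ox _] _]; exact: gK.
  - by move=> k; apply: Ck_on_sub (gs k) => _ [x [[Ox _] _] <-]; exists x.
have ur : (r^-1 *: 1%:M : 'M[R]_6) \in unitmx.
  by rewrite scalemx1 unitmxE det_scalar unitrX// unitfE invr_eq0 gt_eqF.
have [c3 [A3 dE3 mE3 _]] := chart_linear 0 A2 ur.
have m3 p : chart_map c3 p = r^-1 *: Phi (chart_map c p).
  by rewrite mE3 subr0 -scalemxAr mulmx1.
have csqZ (t : R) i x : csq (zeta i (t *: x)) = t ^+ 2 * csq (zeta i x).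
  by rewrite zetaZ csqM /csq /=; ring.
exists c3, chi; split=> //.
- split; last by rewrite m3 c0' Phi0 scaler0.
  split=> //; rewrite dE3 /=; split; first by case: cq.
  rewrite /= c0'; split=> //; rewrite /= Phi0 => i.
  by rewrite zeta0 /csq /= expr0n addr0 exprn_gt0.
- apply/seteqP; split=> [_ [p + <-] i|y y1].
    rewrite dE3 /= => -[_ [_ rx]].
    rewrite m3 csqZ exprVn mulrC ltr_pdivrMr ?exprn_gt0// expr1n mul1r; exact: rx.
  have : polydisc r (r *: y).
    by move=> i; rewrite csqZ -[ltRHS]mulr1 ltr_pM2l ?exprn_gt0//; have := y1 i; rewrite expr1n.
  rewrite -imO2 => -[x O2x xy]; exists (chart_inv c x).
    rewrite dE3 /=; split; first by apply: chart_inv_dom => //; apply: Dc; exact: Q2D.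
    by rewrite /= chart_invK//; apply: Dc; exact: Q2D.
  rewrite m3 chart_invK ?xy//; last by apply: Dc; exact: Q2D.
  by rewrite scalerA mulVf ?gt_eqF// scale1r.
- move=> a p Ha; rewrite dE3 => -[pc /= O2x].
  have := eqv a _ Ha (Q2D _ O2x); rewrite chart_mapK// => -[apc apE].
  have [[Ox [_ Vp]] rx] := O2x; rewrite /= chart_mapK// in Vp.
  have [X Xb Xa] := texp_surj (proj1 Ha).
  have [_ /= Oy] : U (act a p).
    by have := VK _ X Vp; rewrite /Om /= Xa; apply; split=> //=; rewrite Xa.
  have zE := apE (QD _ Oy).
  (* The moved point lies in [Q], where [Phi] is injective, and its image stays in the polydisc
     because the weights have modulus 1. It is therefore the point of [Q2] with that image. *)
  have ry : polydisc r (Phi (chart_map c (act a p))).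
    by move=> i; rewrite zE csqM (csq_S1 (chi1 a i Ha)) mul1r.
  split; last by move=> i; rewrite !m3 !zetaZ zE mulrCA.
  split=> //=; have := ry; rewrite -imO2 => -[y' O2y' y'E].
  have Oy' : Q y' by have [[]] := O2y'.
  by rewrite -(gK _ Oy) -y'E gK.
Qed.
End Linearization.

Section LinearizedBasics.
Context {R : realType} {M : manifold R 6} {act : torus_action M}.
Variables (q : M) (c : chart R 6 M) (chi : 'I_3 -> R[i] * R[i] -> R[i]).
Hypothesis L : linearized act q c chi.
Implicit Types (x : 'rV[R]_6) (p : M) (a : R[i] * R[i]).

Lemma lin_atlas : atlas c. Proof. by have [[[]]] := L. Qed.

Lemma lin_dom : chart_dom c q. Proof. by have [[[]]] := L. Qed.

Lemma lin_inv_dom x : polydisc 1 x -> chart_dom c (chart_inv c x).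
Proof. by have [_ <- _ _ _] := L => x1; apply: chart_inv_dom => //; exact: lin_atlas. Qed.

Lemma lin_invK x : polydisc 1 x -> chart_map c (chart_inv c x) = x.
Proof. by have [_ <- _ _ _] := L => x1; apply: chart_invK => //; exact: lin_atlas. Qed.

Lemma lin_inj p p' : chart_dom c p -> chart_dom c p' ->
  (forall i, zeta i (chart_map c p) = zeta i (chart_map c p')) -> p = p'.
Proof.
move=> pc pc' /zeta_inj E.
by rewrite -(chart_mapK lin_atlas pc) E (chart_mapK lin_atlas pc').
Qed.

Lemma lin_fix a p : stab act q a -> chart_dom c p ->
  (act a p = p <-> forall i, chi i a = 1 \/ zeta i (chart_map c p) = 0).
Proof.
move=> aq pc; have [_ _ /(_ a p aq pc) [apc E] _ _] := L; split=> [ap i|H].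
  have := E i; rewrite ap => /eqP; rewrite -[X in X == _]mul1r -subr_eq0 -mulrBl mulf_eq0.
  by case/orP => /eqP h; [left; apply/eqP; rewrite -subr_eq0 -oppr_eq0 opprB h|right].
by apply: lin_inj => // i; rewrite E; case: (H i) => ->; rewrite ?mul1r ?mulr0.
Qed.
End LinearizedBasics.

(** * Elements with trivial weights *)

Section Rigidity.
Context {R : realType} {M : manifold R 6} {S : su3_structure M} {act : torus_action M}.
Hypotheses (symm : two_torus_symmetry S act) (eff : effective act).
Implicit Types (p q : M) (a : R[i] * R[i]).

Lemma fixed_closed a : T2 a -> closed [set p | act a p = p].
Proof.
move=> Ta p clp; apply: (mfd_hausdorff (m := M)) => A B nA nB.
have : nbhs p (act a @^-1` A `&` B) by apply: filterI => //; exact: act_cvg.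
by move=> /clp [p' [/= pp' [Ap Bp]]]; exists p'; split=> //; rewrite -pp'.
Qed.

(** Every open set has points where [zeta i] does not vanish, and there the weight must be 1: if
    [zeta i] is 0 at [x], a step of [r / 2] along the vector with all complex coordinates 1 makes it
    [r / 2]. *)
Lemma fixed_near a q c chi : linearized act q c chi -> stab act q a ->
  chart_dom c `&` interior [set p | act a p = p] !=set0 -> forall i, chi i a = 1.
Proof.
move=> L aq [p [pc fp]] i.
have Ac := lin_atlas L.
pose x := chart_map c p; pose e : 'rV[R]_6 := of_zeta (fun=> 1).
have nx : nbhs x (chart_img c `&` (chart_inv c @^-1` [set p | act a p = p])).
  apply: filterI; first by apply: open_nbhs_nbhs; split; [exact: chart_img_open|exact: chart_img_map].
  by apply: chart_inv_cvg => //; [exact: chart_img_map|rewrite chart_mapK].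
have : (fun t : R^o => x + t *: e) @ (0 : R^o) --> x.
  have [/differentiable_continuous + _] := diff_line_ptw x e 0.
  by move=> h U; have := h U; rewrite /= scale0r addr0.
move=> /(_ _ nx) /nbhs_ballP[r /= r0 rx].
have fixt (t : R) : `|t| < r -> chi i a = 1 \/ zeta i (x + t *: e) = 0.
  move=> tr; have [xc /= ax] : (chart_img c `&` (chart_inv c @^-1` [set p | act a p = p])) (x + t *: e).
    by apply: rx; rewrite -ball_normE /= sub0r normrN.
  have dx := chart_inv_dom Ac xc.
  by have /(lin_fix L aq dx)/(_ i) := ax; rewrite chart_invK.
have h0 : `|0 : R| < r by rewrite normr0.
have h2 : `|r / 2| < r by rewrite gtr0_norm ?divr_gt0// ltr_pdivrMr// ltr_pMr// ltr1n.
have [//|z0] := fixt _ h0; have [//|] := fixt _ h2.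
move: z0; rewrite scale0r addr0 zetaD zetaZ of_zetaK => ->.
by rewrite add0r mulr1 => -[/eqP]; rewrite gt_eqF// divr_gt0.
Qed.

Lemma isotropy_faithful a q c chi : linearized act q c chi -> stab act q a ->
  (forall i, chi i a = 1) -> a = 1.
Proof.
move=> L aq chi1; have [Ta _] := aq; apply: eff => // p.
pose Fx := [set p | act a p = p].
have domF q' c' chi' : linearized act q' c' chi' -> stab act q' a -> (forall i, chi' i a = 1) ->
    interior Fx q'.
  move=> L' aq' h; have oc : open (chart_dom c') by apply: chart_dom_open; exact: lin_atlas L'.
  apply: filterS (open_nbhs_nbhs (conj oc (lin_dom L'))) => p' p'c.
  by apply/(lin_fix L' aq' p'c) => i; left.
suff FT : interior Fx = [set: M].
  by have /interior_subset : interior Fx p by rewrite FT.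
apply: (mfd_connected (m := M)).
- by exists q; exact: domF L aq chi1.
- by exists (interior Fx); [exact: open_interior|rewrite setTI].
exists (closure (interior Fx)); first exact: closed_closure.
rewrite setTI; apply/seteqP; split=> [|p' clp]; first exact: subset_closure.
have aq' : stab act p' a.
  split=> //; apply: (fixed_closed Ta) => U nU.
  by have [r [/interior_subset Fr Ur]] := clp U nU; exists r.
have [c' [chi' L']] := linearized_chart symm p'.
apply: (domF _ _ _ L' aq'); apply: (fixed_near L' aq').
have [r [Fr cr]] : interior Fx `&` chart_dom c' !=set0.
  by apply: clp; apply: open_nbhs_nbhs; split; [exact: chart_dom_open (lin_atlas L')|exact: lin_dom L'].
by exists r.
Qed.
End Rigidity.

(** * Isometries and fixed-point sets *)

Section MoreDiff.
Context {R : realType}.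
Implicit Types U V : normedModType R.

Lemma diff_base U V (f : U -> V) x y w : x = y -> 'd f x w = 'd f y w.
Proof. by move=> ->. Qed.

Lemma diff_sum_ptw U V (I : Type) (r : seq I) (f : I -> U -> V) x :
  (forall i, differentiable (f i) x) ->
  differentiable (fun y => \sum_(i <- r) f i y) x /\
  forall v, 'd (fun y => \sum_(i <- r) f i y) x v = \sum_(i <- r) 'd (f i) x v.
Proof.
move=> df; elim: r => [|i r [IHd IH]].
  have -> : (fun y : U => \sum_(i <- [::]) f i y) = (fun=> 0) by apply/funext => y; rewrite big_nil.
  have [d E] := diff_cst_ptw (0 : V) x; split=> // v.
  by rewrite big_nil; exact: E.
have -> : (fun y : U => \sum_(j <- i :: r) f j y) = (fun y => f i y + \sum_(j <- r) f j y).
  by apply/funext => y; rewrite big_cons.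
have [d E] := diffD_ptw (df i) IHd; split=> // v.
by rewrite big_cons; apply: etrans (E v) _; congr (_ + _); exact: IH.
Qed.

Lemma diff_mul_ptw U (f g : U -> R^o) x : differentiable f x -> differentiable g x ->
  differentiable (fun y => f y * g y : R^o) x /\
  forall v, 'd (fun y => f y * g y : R^o) x v = f x * 'd g x v + 'd f x v * g x :> R.
Proof. exact: (@diff_scale R U R^o). Qed.

Definition bil n (W : 'M[R]_n) (u v : 'rV[R]_n) : R := \sum_k \sum_l u 0 k * v 0 l * W k l.

Lemma bilE n (W : 'M[R]_n) (u v : 'rV[R]_n) : bil W u v = (u *m W *m v^T) 0 0.
Proof.
rewrite mxE /bil exchange_big /=; apply: eq_bigr => l _; rewrite !mxE mulr_suml.
by apply: eq_bigr => k _; ring.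
Qed.

Lemma bilBl n (W : 'M[R]_n) u u' v : bil W (u - u') v = bil W u v - bil W u' v.
Proof. by rewrite !bilE !mulmxBl !mxE. Qed.

Lemma bilC n (W : 'M[R]_n) u v : W^T = W -> bil W u v = bil W v u.
Proof.
move=> sW; rewrite /bil exchange_big; apply: eq_bigr => k _; apply: eq_bigr => l _ /=.
by rewrite -{1}sW mxE; ring.
Qed.

Lemma diff_bil U n (G : U -> 'M[R]_n) (a b : U -> 'rV[R]_n) x :
  (forall k l, differentiable (fun y => G y k l : R^o) x) ->
  differentiable a x -> differentiable b x ->
  differentiable (fun y => bil (G y) (a y) (b y) : R^o) x /\
  forall v, 'd (fun y => bil (G y) (a y) (b y) : R^o) x v =
    bil (\matrix_(k, l) 'd (fun y => G y k l : R^o) x v) (a x) (b x) +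
    bil (G x) ('d a x v) (b x) + bil (G x) (a x) ('d b x v) :> R.
Proof.
move=> dG da db.
have dak k := differentiable_rV_coord k da.
have dbl l := differentiable_rV_coord l db.
have dab k l := diff_mul_ptw (dak k) (dbl l).
have dt k l := diff_mul_ptw (proj1 (dab k l)) (dG k l).
have dl k := diff_sum_ptw (index_enum 'I_n) (fun l => proj1 (dt k l)).
have [d E] := diff_sum_ptw (index_enum 'I_n) (fun k => proj1 (dl k)).
split=> // v; apply: etrans (E v) _; rewrite /bil -!big_split /=.
apply: eq_bigr => k _; apply: etrans (proj2 (dl k) v) _; rewrite -!big_split /=.
apply: eq_bigr => l _; apply: etrans (proj2 (dt k l) v) _.
apply: etrans (congr1 (fun t : R => a x 0 k * b x 0 l * 'd (fun y => G y k l : R^o) x v + t * G x k l)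
  (proj2 (dab k l) v)) _.
apply: etrans (congr2 (fun s t : R => a x 0 k * b x 0 l * 'd (fun y => G y k l : R^o) x v +
  (a x 0 k * s + t * b x 0 l) * G x k l) (esym (diff_rV v l db)) (esym (diff_rV v k da))) _.
have key (a0 b0 s t g1 g : R) : a0 * b0 * g1 + (a0 * s + t * b0) * g =
  a0 * b0 * g1 + t * b0 * g + a0 * s * g by ring.
by apply: etrans (key _ _ _ _ _ _) _; congr (_ * _ + _ + _); rewrite mxE.
Qed.

Lemma diff_bil_cst U n (G : U -> 'M[R]_n) (u v : 'rV[R]_n) x :
  (forall k l, differentiable (fun y => G y k l : R^o) x) ->
  differentiable (fun y => bil (G y) u v : R^o) x /\
  forall w, 'd (fun y => bil (G y) u v : R^o) x w =
    bil (\matrix_(k, l) 'd (fun y => G y k l : R^o) x w) u v :> R.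
Proof.
move=> dG; have [d1 e1] := diff_cst_ptw u x; have [d2 e2] := diff_cst_ptw v x.
have [d E] := diff_bil dG d1 d2; split=> // w; apply: etrans (E w) _.
apply: etrans (congr2 (fun s t => bil _ u v + bil (G x) s v + bil (G x) u t) (e1 w) (e2 w)) _.
by rewrite !bilE trmx0 !mulmx0 !mul0mx [X in _ + X + _]mxE [X in _ + X]mxE !addr0.
Qed.
End MoreDiff.

(** * Christoffel symbols under an isometry with a fixed point *)

Section Isometry.
Context {R : realType} {n : nat}.
Variables (G : 'rV[R]_n -> 'M[R]_n) (f : 'rV[R]_n -> 'rV[R]_n) (D : set 'rV[R]_n).
Variable x0 : 'rV[R]_n.
Hypotheses (oD : open D) (Dx0 : D x0) (fs : Ck_on 2 D f) (fx0 : f x0 = x0).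
Hypotheses (Gd : forall k l, differentiable (fun y => G y k l : R^o) x0).
Hypotheses (Gsym : \forall y \near x0, (G y)^T = G y) (Gpos : forall u, u != 0 -> 0 < bil (G x0) u u).
Hypothesis iso : forall x u v, D x -> bil (G (f x)) ('d f x u) ('d f x v) = bil (G x) u v.
Implicit Types u v z : 'rV[R]_n.

Let dG z : 'M[R]_n := \matrix_(k, l) 'd (fun y => G y k l : R^o) x0 z.

(** The symbols of an abstract matrix field [G] at [x0], written with differentials; they are those
    of [christoffel] when [G] is the Gram matrix of the metric. *)
Definition christoffel_sym (i j k : 'I_n) : R :=
  2^-1 * \sum_(l < n) (invmx (G x0)) k l *
    (dG (delta_mx 0 i) j l + dG (delta_mx 0 j) i l - dG (delta_mx 0 l) i j).

Definition christoffel_form u v : 'rV[R]_n :=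
  \row_k \sum_(i < n) \sum_(j < n) christoffel_sym i j k * u 0 i * v 0 j.

Let koszul u v z : R := 2^-1 * (bil (dG u) v z + bil (dG v) u z - bil (dG z) u v).

Let G0sym : (G x0)^T = G x0.
Proof. exact: nbhs_singleton Gsym. Qed.

Let G0unit : G x0 \in unitmx.
Proof.
rewrite -row_free_unit -kermx_eq0; apply/eqP/row_matrixP => i; rewrite row0.
apply/eqP/contraT => /Gpos; rewrite bilE -row_mul mulmx_ker row0 mul0mx mxE ltxx.
by [].
Qed.

Let dGE z k l : dG z k l = \sum_i z 0 i * dG (delta_mx 0 i) k l.
Proof.
rewrite mxE {1}(row_sum_delta z) linear_sum /=; apply: eq_bigr => i _.
by rewrite linearZ /= mxE.
Qed.

(** Pairing with [G x0] cancels the inverse Gram matrix and leaves Koszul's formula, which contains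
    derivatives of the metric only and can be compared through an isometry. *)
Let koszul_christoffel u v z : bil (G x0) (christoffel_form u v) z = koszul u v z.
Proof.
pose c : 'rV[R]_n := \row_l koszul u v (delta_mx 0 l).
have bd W (u' : 'rV[R]_n) l : bil W u' (delta_mx 0 l) = \sum_k u' 0 k * W k l.
  rewrite /bil; apply: eq_bigr => k _; rewrite (bigD1 l)//= big1 ?addr0 ?mxE ?eqxx ?mulr1//.
  by move=> l' /negPf ll'; rewrite mxE ll' andbF mulr0 mul0r.
have cE : christoffel_form u v = c *m (invmx (G x0))^T.
  apply/rowP => k; rewrite !mxE.
  transitivity (\sum_l \sum_i \sum_j 2^-1 * (invmx (G x0) k l *
    (dG (delta_mx 0 i) j l + dG (delta_mx 0 j) i l - dG (delta_mx 0 l) i j)) * u 0 i * v 0 j).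
    rewrite [RHS]exchange_big; apply: eq_bigr => i _ /=; rewrite [RHS]exchange_big; apply: eq_bigr => j _ /=.
    by rewrite /christoffel_sym -!mulrA mulr_suml mulr_sumr; apply: eq_bigr => l _; rewrite !mulrA.
  apply: eq_bigr => l _; rewrite !mxE /koszul !bd.
  have -> : \sum_k v 0 k * dG u k l = \sum_i \sum_j u 0 i * v 0 j * dG (delta_mx 0 i) j l.
    rewrite exchange_big; apply: eq_bigr => j _ /=; rewrite dGE mulr_sumr; apply: eq_bigr => i _; ring.
  have -> : \sum_k u 0 k * dG v k l = \sum_i \sum_j u 0 i * v 0 j * dG (delta_mx 0 j) i l.
    by apply: eq_bigr => i _; rewrite dGE mulr_sumr; apply: eq_bigr => j _; ring.
  rewrite /bil -sumrN -!big_split /= mulr_sumr mulr_suml; apply: eq_bigr => i _.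
  rewrite -sumrN -!big_split /= mulr_sumr mulr_suml; apply: eq_bigr => j _; ring.
rewrite bilE cE -mulmxA -mulmxA (mulmxA _^T).
have -> : (invmx (G x0))^T *m G x0 = 1%:M by rewrite -{2}G0sym -trmx_mul mulmxV// trmx1.
rewrite mul1mx mxE /koszul.
have -> : bil (dG u) v z = \sum_l z 0 l * bil (dG u) v (delta_mx 0 l).
  rewrite /bil exchange_big; apply: eq_bigr => l _ /=; rewrite -/(bil _ _ _) bd mulr_sumr.
  by apply: eq_bigr => k _; ring.
have -> : bil (dG v) u z = \sum_l z 0 l * bil (dG v) u (delta_mx 0 l).
  rewrite /bil exchange_big; apply: eq_bigr => l _ /=; rewrite -/(bil _ _ _) bd mulr_sumr.
  by apply: eq_bigr => k _; ring.
have -> : bil (dG z) u v = \sum_l z 0 l * bil (dG (delta_mx 0 l)) u v.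
  rewrite /bil; under eq_bigr => k _ do under eq_bigr => k' _ do rewrite dGE mulr_sumr.
  under eq_bigr => k _ do rewrite exchange_big /=.
  rewrite exchange_big /=; apply: eq_bigr => l _; rewrite mulr_sumr; apply: eq_bigr => k _.
  by rewrite mulr_sumr; apply: eq_bigr => k' _; ring.
rewrite -sumrN -!big_split /= mulr_sumr; apply: eq_bigr => l _.
by rewrite [c 0 l]mxE [z^T _ _]mxE /koszul; ring.
Qed.

Let A u := 'd f x0 u.
Let B u v := 'd (fun y => 'd f y v) x0 u.

Let diff_iso z u v : bil (dG (A z)) (A u) (A v) + bil (G x0) (B z u) (A v) + bil (G x0) (A u) (B z v) =
  bil (dG z) u v.
Proof.
have fd : differentiable f x0 := Ck_on_diff fs Dx0.
have dfd w : differentiable (fun y => 'd f y w) x0.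
  have h : Ck_on 1 D (fun y => 'd f y w) := Ck_on_d w fs.
  exact: Ck_on_diff h Dx0.
have Gd' k l : differentiable (fun y => G y k l : R^o) (f x0) by rewrite fx0.
have Gf k l := diff_comp_ptw fd (Gd' k l).
have [d1 E1] := diff_bil (fun k l => proj1 (Gf k l)) (dfd u) (dfd v).
have [d2 E2] := diff_bil_cst u v Gd.
have nE : \forall y \near x0, bil (G y) u v = bil (G (f y)) ('d f y u) ('d f y v) :> R^o.
  by apply: filterS (open_nbhs_nbhs (conj oD Dx0)) => y Dy; rewrite iso.
have [_ E] := near_eq_diff_ptw nE d2.
have H := etrans (esym (E1 z)) (etrans (E z) (E2 z)).
have gfx : G (f x0) = G x0 by rewrite fx0.
apply: etrans _ H; congr (_ + _ + _).
- congr (bil _ _ _); apply/matrixP => k l; rewrite !mxE; apply/esym; apply: etrans (proj2 (Gf k l) z) _.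
  exact: diff_base fx0.
- have e W : G x0 = W -> bil (G x0) (B z u) (A v) = bil W (B z u) (A v) by move=> ->.
  exact: (e _ (esym gfx)).
- have e W : G x0 = W -> bil (G x0) (A u) (B z v) = bil W (A u) (B z v) by move=> ->.
  exact: (e _ (esym gfx)).
Qed.

Let Bsym u v : B u v = B v u.
Proof. exact: diff2_sym_rV oD Dx0 fs. Qed.

(** The derivative of the isometry identity is [diff_iso]. In its Koszul combination the second
    derivatives [B], being symmetric, cancel except for [B u v]; as the Jacobian is invertible and
    the metric definite, pairing with all [A z] gives the law. *)
Lemma christoffel_isometry u v :
  'd f x0 (christoffel_form u v) =
  christoffel_form ('d f x0 u) ('d f x0 v) + 'd (fun y => 'd f y v) x0 u.
Proof.
change (A (christoffel_form u v) = christoffel_form (A u) (A v) + B u v).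
have bC x y : bil (G x0) x y = bil (G x0) y x by exact: bilC G0sym.
have iso0 x y : bil (G x0) (A x) (A y) = bil (G x0) x y.
  by have := iso x y Dx0; rewrite fx0.
have [J JE] : exists J : 'M[R]_n, forall w, A w = w *m J.
  by exists ('J f x0) => w; apply/esym/jacobianE.
have dI := diff_iso; have BS := Bsym.
clearbody A B.
have key z : bil (G x0) (A (christoffel_form u v) - christoffel_form (A u) (A v) - B u v) (A z) = 0.
  rewrite !bilBl koszul_christoffel iso0 koszul_christoffel /koszul -(dI u) -(dI v) -(dI z).
  rewrite (BS v u) (BS z u) (BS z v) (bC (A v) (B u z)) (bC (A u) (B v z)).
  have key2 (a b c d e g : R) :
    2^-1 * (a + d + e + (b + d + g) - (c + e + g)) - 2^-1 * (a + b - c) - d = 0 by lra.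
  exact: key2.
have uJ : J \in unitmx.
  rewrite -row_free_unit -kermx_eq0; apply/eqP/row_matrixP => i; rewrite row0.
  set k := row i _; apply/eqP/contraT => /Gpos.
  by rewrite -(iso0 k k) JE /k -row_mul mulmx_ker row0 bilE !mul0mx mxE ltxx.
pose w := A (christoffel_form u v) - christoffel_form (A u) (A v) - B u v.
have {}key z : bil (G x0) w (A z) = 0 := key z.
have w0 : w = 0.
  apply/eqP/contraT => /Gpos; have := key (w *m invmx J).
  by rewrite JE mulmxKV// => ->; rewrite ltxx.
by apply/eqP; rewrite -subr_eq0 opprD addrA; apply/eqP.
Qed.
End Isometry.

Lemma diff_field (R : realType) n (D : set 'rV[R]_n) (f Y : 'rV[R]_n -> 'rV[R]_n) x u :
  open D -> D x -> Ck_on 2 D f -> differentiable Y x ->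
  differentiable (fun y => 'd f y (Y y)) x /\
  'd (fun y => 'd f y (Y y)) x u = 'd (fun y => 'd f y (Y x)) x u + 'd f x ('d Y x u).
Proof.
move=> oD Dx fs dY; pose e k : 'rV[R]_n := delta_mx 0 k.
have dfd w : differentiable (fun y => 'd f y w) x.
  have h : Ck_on 1 D (fun y => 'd f y w) := Ck_on_d w fs.
  exact: Ck_on_diff h Dx.
have dfE (y w : 'rV[R]_n) : 'd f y w = \sum_k w 0 k *: 'd f y (e k).
  rewrite {1}(row_sum_delta w) linear_sum; apply: eq_bigr => k _; exact: linearZ.
have dYk k := differentiable_rV_coord k dY.
have dt k := diff_scale (dYk k) (dfd (e k)).
have [d E] := diff_sum_ptw (index_enum 'I_n) (fun k => proj1 (dt k)).
have nE : \forall y \near x, \sum_(k <- index_enum 'I_n) (Y y 0 k : R^o) *: 'd f y (e k) = 'd f y (Y y).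
  by apply: filterE => y; rewrite dfE.
have [d' E'] := near_eq_diff_ptw nE d; split; first exact: d'.
apply: etrans (E' u) _; apply: etrans (E u) _.
have E1 : 'd (fun y => 'd f y (Y x)) x u = \sum_k Y x 0 k *: 'd (fun y => 'd f y (e k)) x u.
  apply: etrans (diff2_sym_rV _ _ oD Dx fs) _.
  apply: etrans (congr1 ('d (fun y => 'd f y u) x) (row_sum_delta (Y x))) _.
  apply: etrans (linear_sum _ _ _ _) _; apply: eq_bigr => k _; apply: etrans (linearZ _ _) _.
  by congr (_ *: _); exact: diff2_sym_rV oD Dx fs.
apply: esym; apply: etrans (congr2 (fun s t => s + t) E1 (dfE x ('d Y x u))) _.
rewrite -big_split; apply: eq_bigr => k _ /=; apply: esym; apply: etrans (proj2 (dt k) u) _.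
by congr (_ + _ *: _); exact: esym (diff_rV u k dY).
Qed.

(** * Fixed-point sets as totally geodesic complex surfaces *)

Section FixedTangent.
Context {R : realType} {M : manifold R 6} {act : torus_action M}.
Implicit Types (c : chart R 6 M) (q p : M) (a : R[i] * R[i]) (v w : 'rV[R]_6).

Lemma line_diff0 w : differentiable (fun t : R^o => t *: w) (0 : R^o) /\
  'd (fun t : R^o => t *: w) (0 : R^o) 1 = w.
Proof.
have [d E] := diff_line_ptw (0 : 'rV[R]_6) w 0.
have nE : \forall y \near (0 : R^o), (fun s : R^o => 0 + s *: w) y = y *: w.
  by apply: filterE => y; rewrite add0r.
have [d' E'] := near_eq_diff_ptw nE d; split; first exact: d'.
by apply: etrans (E' 1) _; apply: etrans (E 1) _; rewrite scale1r.
Qed.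

Lemma line_near w (Q : set 'rV[R]_6) : open Q -> Q 0 ->
  exists2 e : R, 0 < e & forall t : R^o, ball (0 : R^o) e t -> Q (t *: w).
Proof.
move=> oQ Q0; have [/differentiable_continuous cl _] := line_diff0 w.
have : nbhs ((fun t : R^o => t *: w) 0) Q by rewrite /= scale0r; exact: open_nbhs_nbhs.
by move=> /cl /nbhs_ballP[e /= e0 eQ]; exists e.
Qed.

Lemma act_jacobian_transition a c c' q : stab act q a -> chart_at c q -> chart_at c' q ->
  'J (transition c c') (chart_map c q) *m act_jacobian act a c' c' q =
  act_jacobian act a c c q *m 'J (transition c c') (chart_map c q).
Proof.
move=> [Ta aq] cq cq'; have T1 : T2 (1 : R[i] * R[i]) := T2_1.
have JE : act_jacobian act 1 c c' q = 'J (transition c c') (chart_map c q).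
  by rewrite /act_jacobian /act_rep /transition; congr ('J _ _); apply/funext => x; rewrite /= act1.
have E1 : act_jacobian act a c c' q =
    'J (transition c c') (chart_map c q) *m act_jacobian act a c' c' q.
  by rewrite -JE; have := @act_jacobianM _ _ _ act a 1 c c' c' q Ta T1 cq; rewrite act1 aq mulr1; apply.
have E2 : act_jacobian act a c c' q =
    act_jacobian act a c c q *m 'J (transition c c') (chart_map c q).
  by rewrite -JE; have := @act_jacobianM _ _ _ act 1 a c c c' q T1 Ta cq; rewrite aq act1 mul1r; apply.
exact: etrans (esym E1) E2.
Qed.

(** In a linearised chart the action of [a] sends the line [t *: v] to [t *: w] exactly, for small
    [t]; its derivative at the centre is thus the diagonal map itself. *)
Lemma zeta_act_jacobian a q c chi i v : linearized act q c chi -> stab act q a ->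
  zeta i (v *m act_jacobian act a c c q) = chi i a * zeta i v.
Proof.
move=> L aq; have [[cq c0] imE eqv _ _] := L; have [Ta aqE] := aq.
pose w := of_zeta (fun i => chi i a * zeta i v).
suff -> : v *m act_jacobian act a c c q = w by rewrite of_zetaK.
have caq : chart_at c (act a q) by rewrite aqE.
have df := act_rep_diff Ta cq caq.
have [dl El] := line_diff0 v; have [dw Ew] := line_diff0 w.
have p0 : polydisc 1 (0 : 'rV[R]_6).
  by move=> j; rewrite zeta0 /csq /= expr0n addr0 expr1n.
have [e e0 eP] := line_near v (@polydisc_open R 1) p0.
have df0 : differentiable (act_rep act a c c) ((fun t : R^o => t *: v) 0).
  by rewrite /= scale0r -c0.
have [dc Ec] := diff_comp_ptw dl df0.
have nE : \forall t \near (0 : R^o), act_rep act a c c (t *: v) = t *: w.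
  apply/nbhs_ballP; exists e => // t /eP Pt.
  have pd := lin_inv_dom L Pt; have [apc E] := eqv a _ aq pd.
  apply: zeta_inj => j; rewrite /act_rep /= E (lin_invK L Pt) !zetaZ of_zetaK.
  by rewrite mulrCA.
have [_ E] := near_eq_diff_ptw nE dc.
apply: etrans (jacobianE _ _ _) _.
have Ew' := etrans (esym Ew) (E 1).
apply: esym; apply: etrans Ew' _; apply: etrans (Ec 1) _.
rewrite El; apply: diff_base; by rewrite /= scale0r c0.
Qed.

Section Fixed.
Variables (K : set (R[i] * R[i])) (W : set M).
Hypotheses (KT : K `<=` @T2 R) (oW : open W).
Let N := [set q | W q /\ forall a, K a -> act a q = q].
(** One weight is trivial on all of [K] and each other one is non-trivial somewhere on [K], so in
    the linearised chart the points fixed by [K] form a single complex coordinate line. *)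
Hypothesis NL : forall q, N q -> exists c chi i0, [/\ linearized act q c chi,
  forall a, K a -> chi i0 a = 1 & forall j, j != i0 -> exists2 a, K a & chi j a != 1].

Lemma fixed_stab q a : N q -> K a -> stab act q a.
Proof. by move=> [_ Nq] Ka; split; [exact: KT|exact: Nq]. Qed.

(** A curve of fixed points has a fixed velocity. Conversely, a fixed vector lies on the complex
    line of the trivial weight in the linearised chart, where the straight line it spans consists of
    fixed points; the transition map carries it to the chart [c]. *)
Lemma fixed_tangent q c v : N q -> chart_at c q ->
  tangent N c q v <-> forall a, K a -> v *m act_jacobian act a c c q = v.
Proof.
move=> Nq cq; have [Ac qc] := cq; split.
  move=> [e [gam [e0 g0 gN gs gv]]] a Ka; have [Ta aq] := fixed_stab Nq Ka.
  have ball0 : ball (0 : R^o) e 0 by exact: ballxx.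
  have dg : differentiable gam 0 := Ck_on_diff (gs 1%N) ball0.
  have gvE : 'd gam 0 1 = v by rewrite -gv deriveE.
  have caq : chart_at c (act a q) by rewrite aq.
  have df : differentiable (act_rep act a c c) (gam 0).
    by rewrite g0; exact: act_rep_diff.
  have [dc Ec] := diff_comp_ptw dg df.
  have nE : \forall t \near (0 : R^o), act_rep act a c c (gam t) = gam t.
    apply/nbhs_ballP; exists e => // t /gN [ct [_ Nt]].
    by rewrite /act_rep /= Nt// chart_invK.
  have [_ E] := near_eq_diff_ptw nE dc.
  apply: etrans (jacobianE _ _ _) _.
  rewrite -gvE; apply: esym; apply: etrans (E 1) _; apply: etrans (Ec 1) _.
  exact: diff_base g0.
move=> vK; have [c' [chi [i0 [L chi0 chij]]]] := NL Nq.
have [[cq' c0'] imE _ _ _] := L; have [Ac' qc'] := cq'.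
pose w := v *m 'J (transition c c') (chart_map c q).
have wz j : j != i0 -> zeta j w = 0.
  move=> ji; have [a Ka nz] := chij j ji.
  have aq := fixed_stab Nq Ka; have wD : w *m act_jacobian act a c' c' q = w.
    apply: etrans (esym (mulmxA _ _ _)) _.
    apply: etrans (congr1 (mulmx v) (act_jacobian_transition aq cq cq')) _.
    exact: etrans (mulmxA _ _ _) (congr1 (mulmx^~ _) (vK a Ka)).
  have /eqP := etrans (esym (zeta_act_jacobian j w L aq)) (congr1 (zeta j) wD).
  rewrite -[X in _ == X]mul1r -subr_eq0 -mulrBl mulf_eq0 subr_eq0 (negPf nz) /=.
  by move/eqP.
pose Q := chart_img c' `&` chart_inv c' @^-1` (chart_dom c `&` W).
have oQ : open Q by apply: open_img_inv => //; apply: openI => //; exact: chart_dom_open.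
have inv0 : chart_inv c' 0 = q by rewrite -c0' chart_mapK.
have Q0 : Q 0.
  split; first by rewrite -c0'; exact: chart_img_map.
  by rewrite /= inv0; split=> //; case: Nq.
have [e e0 eQ] := line_near w oQ Q0.
pose gam (t : R^o) : 'rV[R]_6 := transition c' c (t *: w).
have sQ : smooth_on (chart_img c' `&` chart_inv c' @^-1` chart_dom c) (transition c' c).
  exact: transition_smooth.
have oQ' : open (chart_img c' `&` chart_inv c' @^-1` chart_dom c).
  by apply: open_img_inv => //; exact: chart_dom_open.
have eQ' (t : R^o) : ball (0 : R^o) e t ->
    (chart_img c' `&` chart_inv c' @^-1` chart_dom c) (t *: w).
  by move=> /eQ [? []].
have gs : smooth_on (ball (0 : R^o) e) gam.
  move=> k; apply: (@Ck_on_comp _ _ _ _ _ _ _ (fun t : R^o => t *: w) (transition c' c) _ _ oQ' eQ').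
  - exact: finite_basis_rV.
  - exact: ball_open.
  - by apply: Ck_on_scale; [exact: ball_open|apply: Ck_on_id; exact: ball_open|exact: Ck_on_cst].
  - exact: sQ.
exists e, gam; split=> //.
- by rewrite /gam scale0r /transition /= inv0.
- move=> t /eQ [ct [/= cdt Wt]]; split.
    by rewrite /gam /transition /=; exact: chart_img_map.
  rewrite /gam /transition /= chart_mapK//; split=> // a Ka.
  have aq := fixed_stab Nq Ka; have pd := chart_inv_dom Ac' ct.
  apply/(lin_fix L aq pd) => i; rewrite chart_invK//.
  case: (eqVneq i i0) => [->|/wz z0]; first by left; exact: chi0.
  by right; rewrite zetaZ z0 mulr0.
have b0 : ball (0 : R^o) e 0 by exact: ballxx.
have dgam : differentiable gam 0 := Ck_on_diff (gs 1%N) b0.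
have [dl El] := line_diff0 w.
have dtr : differentiable (transition c' c) ((fun t : R^o => t *: w) 0).
  by apply: (Ck_on_diff (sQ 1%N)); exact: eQ'.
have [_ E] := diff_comp_ptw dl dtr.
rewrite deriveE//; apply: etrans (E 1) _; rewrite El.
have -> : v = w *m 'J (transition c' c) (chart_map c' q).
  by rewrite /w -mulmxA transition_jacobianK// mulmx1.
apply: esym; apply: etrans (jacobianE _ _ _) _; apply: diff_base.
by rewrite /= scale0r c0'.
Qed.

Variable S : su3_structure M.
Hypothesis symm : two_torus_symmetry S act.

Lemma fixed_complex : complex_submanifold (su3_J S) N.
Proof.
move=> c q v Nq cq /(fixed_tangent _ Nq cq) vK; apply/(fixed_tangent _ Nq cq) => a Ka.
have [Ta aq] := fixed_stab Nq Ka.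
have caq : chart_at c (act a q) by rewrite aq.
have JD := symmetry_J symm Ta cq caq; rewrite aq in JD.
apply: etrans (esym (mulmxA _ _ _)) _; apply: etrans (congr1 (mulmx v) JD) _.
exact: etrans (mulmxA _ _ _) (congr1 (mulmx^~ _) (vK a Ka)).
Qed.

Lemma fixed_submanifold : N !=set0 -> connected N -> is_submanifold 2 N.
Proof.
move=> N0 cN; split=> // q Nq; have [c [chi [i0 [L chi0 chij]]]] := NL Nq.
have [[[Ac qc] c0] _ _ _ _] := L.
pose l : 'I_6 := @lshift 3 3 i0; pose r : 'I_6 := @rshift 3 3 i0.
have lr : l != r by rewrite (@eq_lrshift 3 3).
pose o0 : 'I_6 := ord0; pose o1 : 'I_6 := Ordinal (isT : 1 < 6)%N.
(* A slice chart keeps the free coordinates first, so [l] and [r] are brought to positions 0 and 1;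
   [r'] is where the second transposition expects to find [r]. *)
have [s s0 s1] : exists2 s : {perm 'I_6}, s o0 = l & s o1 = r.
  pose r' := tperm o0 l r; have r'0 : r' != o0.
    by rewrite /r' -{2}(tpermR o0 l) (inj_eq perm_inj) eq_sym.
  exists (tperm o1 r' * tperm o0 l)%g; rewrite permM.
    by rewrite (@tpermD _ o1 r' o0)// tpermL.
  by rewrite tpermL /r' tpermK.
have uP : perm_mx s^-1 \in @unitmx R 6 by exact: unitmx_perm.
have [c1 [A1 d1 m1 _]] := chart_linear 0 Ac uP.
have m1E p j : chart_map c1 p 0 j = chart_map c p 0 (s j).
  by rewrite m1 subr0 -col_permE mxE.
pose Q := chart_img c1 `&` chart_inv c1 @^-1` W.
have oQ : open Q by exact: open_img_inv.
have [c2 [A2 d2 m2 _]] := chart_restrict A1 oQ (@subIsetl _ _ _).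
have qc1 : chart_dom c1 q by rewrite d1.
exists c2.
  split=> //; rewrite d2; split=> //; split; first exact: chart_img_map.
  by rewrite /= chart_mapK//; case: Nq.
move=> x; rewrite d2 => -[pc1 [_ /=]]; rewrite chart_mapK// => Wp.
have pc : chart_dom c x by rewrite -d1.
have NE : N x <-> forall i, i != i0 -> zeta i (chart_map c x) = 0.
  split=> [[_ Np] i ii0|H].
    have [a Ka nz] := chij i ii0; have aq := fixed_stab Nq Ka.
    by have /(lin_fix L aq pc)/(_ i)[E|//] := Np a Ka; rewrite E eqxx in nz.
  split=> // a Ka; apply/(lin_fix L (fixed_stab Nq Ka) pc) => i.
  by case: (eqVneq i i0) => [->|/H]; [left; exact: chi0|right].
rewrite NE m2; split=> [H j j2|H i ii0].
  rewrite m1E; have [k sk] := unsplit_surj (s j).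
  rewrite sk; case: k sk => k sk /=.
    have /H : k != i0.
      apply: (contraTneq _ j2) => E; have : s j = l by rewrite sk E.
      by rewrite -s0 => /perm_inj ->.
    by case.
  have /H : k != i0.
    apply: (contraTneq _ j2) => E; have : s j = r by rewrite sk E.
    by rewrite -s1 => /perm_inj ->.
  by case.
have coord (j : 'I_6) : j != l -> j != r -> chart_map c x 0 j = 0.
  move=> jl jr; have := H ((s^-1)%g j); rewrite m1E permKV; apply.
  have n0 : (s^-1)%g j != o0 by apply: contra jl => /eqP E; rewrite -s0 -E permKV.
  have n1 : (s^-1)%g j != o1 by apply: contra jr => /eqP E; rewrite -s1 -E permKV.
  by move: n0 n1; rewrite -!val_eqE /=; case: (val _) => [|[|]].
by rewrite /zeta !coord// ?(@eq_lshift 3 3) ?(@eq_rshift 3 3) ?(@eq_lrshift 3 3) ?(@eq_rlshift 3 3).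
Qed.

Lemma bil_gram c y (u v : 'rV[R]_6) : atlas c -> chart_img c y ->
  bil (gram (su3_g S) c y) u v = ev2 (su3_g S c (chart_inv c y)) u v.
Proof.
move=> Ac cy; have [[gm _ _] _ _] := su3_riemannian S.
have gml := gm c _ (conj Ac (chart_inv_dom Ac cy)).
rewrite (row_sum_delta u) (ev2_suml gml) -(row_sum_delta u); apply: eq_bigr => k _.
rewrite (row_sum_delta v) (ev2_sumr gml) -(row_sum_delta v) mulr_sumr; apply: eq_bigr => j _.
by rewrite mxE mulrA.
Qed.

(** It is enough that ['d f] fixes the covariant derivative. The Christoffel part follows from the
    transformation law, with a second-derivative term; that term is cancelled by differentiating
    ['d f (Y) = Y]. *)
Lemma fixed_totally_geodesic : totally_geodesic (su3_g S) N.
Proof.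
move=> c X Y Ac sX sY XYt q Nq qc; have cq : chart_at c q by [].
apply/(fixed_tangent _ Nq cq) => a Ka; have [Ta aq] := fixed_stab Nq Ka.
set x0 := chart_map c q.
have cx0 : chart_img c x0 by exact: chart_img_map.
have [[gm gt gs] gsym gpos] := su3_riemannian S.
pose f := act_rep act a c c; pose D := act_rep_dom act a c c.
have oD : open D by exact: act_rep_dom_open.
have Dx0 : D x0 by split=> //; rewrite /= /x0 chart_mapK// aq.
have fs : Ck_on 2 D f := act_rep_smooth act Ta Ac Ac 2%N.
have fx0 : f x0 = x0 by rewrite /f /act_rep /= /x0 chart_mapK// aq.
pose G y := gram (su3_g S) c y.
have Gd k l : differentiable (fun y => G y k l : R^o) x0.
  have H : Ck_on 1 (chart_img c) (fun y => G y k l : R^o).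
    apply: (Ck_on_eq (chart_img_open Ac) _ (gs c (col_mx (delta_mx 0 k) (delta_mx 0 l) : 'M[R]_(1 + 1, 6)) Ac 1%N)).
    by move=> y _; rewrite /G mxE.
  exact: Ck_on_diff H cx0.
have Gsym : \forall y \near x0, (G y)^T = G y.
  apply: filterS (open_nbhs_nbhs (conj (chart_img_open Ac) cx0)) => y cy.
  by apply/matrixP => k l; rewrite !mxE gsym//; split=> //; exact: chart_inv_dom.
have Gpos (u : 'rV[R]_6) : u != 0 -> 0 < bil (G x0) u u.
  by move=> u0; rewrite bil_gram// /x0 chart_mapK//; exact: gpos.
have iso x (u v : 'rV[R]_6) : D x -> bil (G (f x)) ('d f x u) ('d f x v) = bil (G x) u v.
  move=> [cx /= afx]; have ci := chart_inv_dom Ac cx.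
  have cfx : chart_img c (f x) by exact: chart_img_map.
  rewrite !bil_gram// {1}/f /act_rep /= chart_mapK//.
  have E := @symmetry_g _ _ _ _ symm a c c (chart_inv c x) u v Ta (conj Ac ci) (conj Ac afx).
  apply: etrans _ E; rewrite /act_jacobian chart_invK// -/f.
  by congr (ev2 _ _ _); apply/esym/jacobianE.
have law := christoffel_isometry oD Dx0 fs fx0 Gd Gsym Gpos iso.
have [[e [gam [e0 g0 gN gsm gv]]] Yt] := XYt q Nq qc; rewrite -/x0 in g0 gv Yt.
have fixd p (v : 'rV[R]_6) : N p -> chart_dom c p -> tangent N c p v ->
    'd f (chart_map c p) v = v.
  move=> Np pc tv; have cp : chart_at c p by [].
  have /(fixed_tangent _ Np cp)/(_ a Ka) H := tv.
  by apply: etrans _ H; apply/esym/jacobianE.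
have Xf : 'd f x0 (X x0) = X x0 by apply: fixd => //; case: (XYt q Nq qc).
have Yf : 'd f x0 (Y x0) = Y x0 by exact: fixd.
have dY : differentiable Y x0 := Ck_on_diff (sY 1%N) cx0.
have [dH EH] := diff_field (X x0) oD Dx0 fs dY.
have b0 : ball (0 : R^o) e 0 by exact: ballxx.
have dg : differentiable gam 0 := Ck_on_diff (gsm 1%N) b0.
have gvE : 'd gam 0 1 = X x0 by rewrite -gv deriveE.
have dYg : differentiable Y (gam 0) by rewrite g0.
have dHg : differentiable (fun y => 'd f y (Y y)) (gam 0) by rewrite g0.
have [d1 E1] := diff_comp_ptw dg dYg.
have [d2 E2] := diff_comp_ptw dg dHg.
(* The identity ['d f (Y) = Y] holds on the fixed set only, so it is differentiated along the curve
   [gam] in this set, whose velocity at 0 is [X x0]. *)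
have nE : \forall t \near (0 : R^o), 'd f (gam t) (Y (gam t)) = Y (gam t).
  apply/nbhs_ballP; exists e; first exact: e0.
  move=> t /gN [ct Nt].
  have dt := chart_inv_dom Ac ct; have [_ tY] := XYt _ Nt dt.
  by have := fixd _ _ Nt dt tY; rewrite chart_invK.
have [_ E3] := near_eq_diff_ptw nE d2.
have dYX : 'd (fun y => 'd f y (Y y)) x0 (X x0) = 'd Y x0 (X x0).
  have := etrans (esym (E1 1)) (etrans (E3 1) (E2 1)); rewrite gvE => H.
  apply: etrans (diff_base _ _ (esym g0)) _; apply: etrans (esym H) _.
  exact: diff_base g0.
have nablaE : nabla (su3_g S) c X Y x0 = 'd Y x0 (X x0) + christoffel_form G x0 (X x0) (Y x0).
  have dE (a' b d : 'I_6) : 'D_(delta_mx 0 a') (fun y => gram (su3_g S) c y b d : R^o) x0 =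
      (\matrix_(k, l) 'd (fun y => G y k l : R^o) x0 (delta_mx 0 a')) b d :> R.
    by rewrite mxE; exact: deriveE (Gd b d).
  have cE i j k : christoffel (su3_g S) c x0 i j k = christoffel_sym G x0 i j k.
    by congr (_ * _); apply: eq_bigr => m _; congr (_ * _); congr (_ + _ - _); apply: dE.
  rewrite /nabla; congr (_ + _); first exact: deriveE dY.
  apply/rowP => k; apply: etrans (mxE _ _ _ _) _; apply: esym; apply: etrans (mxE _ _ _ _) _.
  by apply: eq_bigr => i _; apply: eq_bigr => j _; rewrite cE.
rewrite -/x0 nablaE; apply: etrans (jacobianE _ _ _) _.
apply: etrans (linearD ('d f x0) _ _) _.
have l1 := etrans (law (X x0) (Y x0)) (congr2 (fun s t => christoffel_form G x0 s t +
  'd (fun y => 'd f y (Y x0)) x0 (X x0)) Xf Yf).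
have l2 := etrans (esym EH) dYX.
apply: etrans (congr1 (fun s => 'd f x0 ('d Y x0 (X x0)) + s) l1) _.
apply: etrans _ (congr1 (fun s => s + christoffel_form G x0 (X x0) (Y x0)) l2).
have key (V : zmodType) (t u b : V) : t + (u + b) = b + t + u by rewrite addrA addrC addrA.
exact: key.
Qed.

Lemma fixed_surface : N !=set0 -> connected N -> totally_geodesic_complex_surface S N.
Proof.
by move=> N0 cN; split; [exact: fixed_submanifold|exact: fixed_totally_geodesic|exact: fixed_complex].
Qed.
End Fixed.
End FixedTangent.

(** * Slices *)

Section Orbit.
Context {R : realType} {M : manifold R 6} {act : torus_action M}.
Variables (q : M) (c : chart R 6 M) (chi : 'I_3 -> R[i] * R[i] -> R[i]).
Hypothesis L : linearized act q c chi.
Implicit Types (X Y : 'rV[R]_2) (x v : 'rV[R]_6) (p : M) (a : R[i] * R[i]).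

Let Ac : atlas c := lin_atlas L.
Let qc : chart_dom c q := lin_dom L.
Let cq0 : chart_map c q = 0. Proof. by have [[]] := L. Qed.

Lemma lin_inv0 : chart_inv c 0 = q.
Proof. by rewrite -cq0 chart_mapK. Qed.

Lemma stab_texpX X (n : nat) : stab act q (texp X) -> stab act q (texp (n%:R *: X)).
Proof.
move=> Xq; elim: n => [|n IH]; first by rewrite scale0r texp0; exact: stab_1.
by rewrite -natr1 scalerDl scale1r texpD; exact: stabM.
Qed.

Definition orb X : 'rV[R]_6 := chart_map c (act (texp X) q).

Let orbD : set 'rV[R]_2 := [set X | chart_dom c (act (texp X) q)].

Let orbD_open : open orbD.
Proof.
rewrite openE => X dX; apply: act_texp_cvg.
by apply: open_nbhs_nbhs; split=> //; exact: chart_dom_open.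
Qed.

Let orbD0 : orbD 0. Proof. by rewrite /orbD /= texp0 act1. Qed.

Lemma orb_smooth : smooth_on orbD orb.
Proof.
move=> k; apply: (@Ck_on_eq _ _ _ _ _ ((fun Xx => chart_map c (act (texp Xx.1) (chart_inv c Xx.2))) \o
  (fun X : 'rV[R]_2 => (X, 0 : 'rV[R]_6)))) => //.
  by move=> X _; rewrite /= lin_inv0.
apply: (@Ck_on_comp _ _ _ _ _ _ (act_domain act c c)) => //.
- by apply: finite_basis_prod; exact: finite_basis_rV.
- exact: act_domain_open.
- move=> X dX; split=> /=; last by rewrite lin_inv0.
  by rewrite -cq0; exact: chart_img_map.
- by apply: Ck_on_pair => //; [exact: Ck_on_id|exact: Ck_on_cst].
- exact: act_smooth.
Qed.

Let orb_diff : differentiable orb 0 := Ck_on_diff (orb_smooth 1%N) orbD0.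

Let orb0 : orb 0 = 0. Proof. by rewrite /orb texp0 act1. Qed.

(* The infinitesimal action of R^2 = Lie(T^2) at [q]. *)
Definition xi : 'M[R]_(2, 6) := 'J orb 0.

Lemma xiE X : X *m xi = 'd orb 0 X. Proof. exact: jacobianE. Qed.

(** The torus being commutative, an element fixing [q] fixes the whole orbit of [q]; the identity is
    the derivative of this fact at [q]. *)
Lemma xi_fix a X : stab act q a -> X *m xi *m act_jacobian act a c c q = X *m xi.
Proof.
move=> [Ta aq]; have caq : chart_at c (act a q) by rewrite aq.
have cq : chart_at c q by [].
have df : differentiable (act_rep act a c c) (orb 0).
  by rewrite orb0 -cq0; exact: act_rep_diff.
have [dc Ec] := diff_comp_ptw orb_diff df.
have nE : \forall X \near (0 : 'rV[R]_2), act_rep act a c c (orb X) = orb X.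
  apply: filterS (open_nbhs_nbhs (conj orbD_open orbD0)) => Y dY.
  rewrite /act_rep /orb /= chart_mapK// -actM//; last exact: T2_texp.
  by rewrite mulrC actM ?aq//; exact: T2_texp.
have [_ E] := near_eq_diff_ptw nE dc.
apply: etrans (jacobianE _ _ _) _; rewrite xiE.
apply: esym; apply: etrans (E X) _; apply: etrans (Ec X) _.
by apply: diff_base; rewrite orb0 cq0.
Qed.

Lemma xi_zeta a X i : stab act q a -> chi i a = 1 \/ zeta i (X *m xi) = 0.
Proof.
move=> aq; have := zeta_act_jacobian i (X *m xi) L aq.
rewrite xi_fix// => /eqP; rewrite -[X in X == _]mul1r -subr_eq0 -mulrBl mulf_eq0.
by case/orP => /eqP h; [left; apply/eqP; rewrite eq_sym -subr_eq0 h|right].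
Qed.

Lemma orbit_near X : exists2 e : R, 0 < e & forall t : R^o, ball (0 : R^o) e t -> orbD (t *: X).
Proof.
have [/differentiable_continuous cl _] := diff_line_ptw (0 : 'rV[R]_2) X 0.
have : nbhs ((fun t : R^o => 0 + t *: X) 0) orbD.
  by rewrite /= scale0r addr0; exact: open_nbhs_nbhs.
move=> /cl /nbhs_ballP[e /= e0 eQ]; exists e; first exact: e0.
by move=> t /eQ /=; rewrite add0r.
Qed.

(** The kernel of the infinitesimal action is the Lie algebra of the stabiliser. If [X *m xi = 0],
    the velocity of the orbit curve at time [s] is the image under the action of its velocity at
    time 0, hence zero, and the curve is constant for small times. *)
Lemma xi_stab X : X *m xi = 0 <-> forall t : R, stab act q (texp (t *: X)).
Proof.
have [e e0 eX] := orbit_near X.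
split=> [X0|stX].
  pose phi (t : R^o) := orb (t *: X).
  have dphi (s : R^o) : ball (0 : R^o) e s -> differentiable phi s /\ 'd phi s 1 = 0.
    move=> sb; have [d1 E1] := diff_line_ptw (- s *: X) X s.
    have l0 : - s *: X + s *: X = 0 by rewrite -scalerDl addNr scale0r.
    have dorb : differentiable orb ((fun t : R^o => - s *: X + t *: X) s) by rewrite /= l0.
    have [d2 E2] := diff_comp_ptw d1 dorb.
    have Ts := T2_texp (s *: X).
    have cs : chart_at c (act (texp (s *: X)) q) by split=> //; exact: eX.
    have cq : chart_at c q by [].
    have drep : differentiable (act_rep act (texp (s *: X)) c c) (orb (- s *: X + s *: X)).
      by rewrite l0 orb0 -cq0; exact: act_rep_diff.
    have [d3 E3] := diff_comp_ptw d2 drep.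
    have nE : \forall t \near s, act_rep act (texp (s *: X)) c c (orb (- s *: X + t *: X)) = phi t.
      apply/nbhs_ballP; exists e; first exact: e0.
      move=> t st; have /eX dt : ball (0 : R^o) e (t - s).
        by move: st; rewrite -ball_normE /= sub0r opprB.
      rewrite -scalerDl [- s + t]addrC /act_rep /orb /= chart_mapK//.
      rewrite -actM; [|exact: T2_texp|exact: T2_texp].
      by rewrite -texpD -scalerDl addrCA subrr addr0.
    have [d4 E4] := near_eq_diff_ptw nE d3; split; first exact: d4.
    apply: etrans (E4 1) _; apply: etrans (E3 1) _.
    suff -> : 'd (fun y : R^o => orb (- s *: X + y *: X)) s 1 = 0 by exact: linear0.
    apply: etrans (E2 1) _; apply: etrans (congr1 _ (E1 1)) _.
    rewrite scale1r; apply: etrans (diff_base _ _ l0) _.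
    by rewrite -xiE.
  have small (t : R) : `|t| < e -> stab act q (texp (t *: X)).
    move=> te; split; first exact: T2_texp.
    have tb (u : R) : 0 <= u <= 1 -> ball (0 : R^o) e (0 + u *: (t : R^o)).
      move=> /andP[u0 u1]; rewrite -ball_normE /= !add0r normrN normrM (ger0_norm u0).
      by apply: le_lt_trans te; rewrite ler_piMl.
    have t1 : ball (0 : R^o) e t by rewrite -ball_normE /= sub0r normrN.
    have pt : phi t = phi 0.
      apply/rowP => k; apply/eqP; rewrite -subr_eq0; apply/eqP.
      have [u u01] := @MVT_diff R R^o (fun s => phi s 0 k : R^o) 0 t
        (fun u hu => differentiable_rV_coord k (proj1 (dphi _ (tb u hu)))).
      rewrite add0r => ->; have [dp Ep] := dphi _ (tb u u01).
      have E1 : 'd (fun s => phi s 0 k : R^o) (0 + u *: (t : R^o)) 1 = 0.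
        by have := diff_rV (1 : R^o) k dp; rewrite Ep mxE => <-.
      have t1E : (t : R^o) = t *: (1 : R^o) by rewrite /GRing.scale /= mulr1.
      apply: etrans (congr1 ('d (fun s : R^o => phi s 0 k : R^o) (0 + u *: (t : R^o))) t1E) _.
      by apply: etrans (linearZ _ _) _; apply: etrans (congr1 _ E1) _; exact: mulr0.
    have := eX t t1; rewrite /orbD /= => dt.
    by rewrite -(chart_mapK Ac dt) -/(orb _) -/(phi t) pt /phi scale0r orb0 lin_inv0.
  (* Any time is a multiple of a small one, and the stabiliser is closed under powers. *)
  move=> t; pose n := (Num.trunc (`|t| / e)).+1.
  have n0 : (n%:R : R) != 0 by rewrite pnatr_eq0.
  have -> : t *: X = n%:R *: ((t / n%:R) *: X) by rewrite scalerA mulrCA mulfV// mulr1.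
  apply: stab_texpX; apply: small; rewrite normrM normfV normr_nat ltr_pdivrMr ?ltr0n//.
  rewrite mulrC -ltr_pdivrMr//; exact: truncnS_gt.
have [d E] := diff_line_ptw (0 : 'rV[R]_2) X 0.
have l0 : 0 + (0 : R^o) *: X = 0 by rewrite scale0r addr0.
have dorb : differentiable orb ((fun t : R^o => 0 + t *: X) 0) by rewrite /= l0.
have [d2 E2] := diff_comp_ptw d dorb.
have nE : \forall t \near (0 : R^o), orb (0 + t *: X) = 0.
  by apply: filterE => t; rewrite add0r /orb; have [_ ->] := stX t.
have [_ E3] := near_eq_diff_ptw nE d2.
have H := etrans (esym (E2 1)) (etrans (esym (E3 1)) (proj2 (diff_cst_ptw (0 : 'rV[R]_6) (0 : R^o)) 1)).
have lE : 'd (fun t : R^o => 0 + t *: X) 0 1 = X by apply: etrans (E 1) _; rewrite scale1r.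
rewrite xiE; apply: etrans (diff_base _ _ (esym l0)) _.
apply: etrans (congr1 ('d orb (0 + (0 : R^o) *: X)) (esym lE)) _; exact: H.
Qed.

(* A generalised inverse of the infinitesimal action which, like its transpose, is
   invariant under the isotropy representation. *)
Lemma equivariant_inverse : exists Lm : 'M[R]_(6, 2),
  [/\ xi *m Lm *m xi = xi, Lm *m xi *m Lm = Lm
    & forall a, stab act q a -> act_jacobian act a c c q *m Lm = Lm].
Proof.
have [S SE] : exists S : 'M[R]_2, xi *m xi^T = S by exists (xi *m xi^T).
have [P SPS] : exists P : 'M[R]_2, S *m P *m S = S by exists (pinvmx S); rewrite mulmxKpV.
have xixiT (B : 'M[R]_(2, 6)) : B *m B^T = 0 -> B = 0.
  move=> BB; apply/matrixP => i j; rewrite mxE.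
  have := congr1 (fun A : 'M[R]_2 => A i i) BB; rewrite !mxE => /eqP.
  rewrite psumr_eq0 => [/allP/(_ j)|k _]; rewrite !mxE -?expr2 ?sqr_ge0//.
  by rewrite mem_index_enum => /(_ isT); rewrite sqrf_eq0 => /eqP.
have SPxi : S *m P *m xi = xi.
  apply/eqP; rewrite -subr_eq0; apply/eqP/xixiT.
  have Y : (S *m P *m xi - xi) *m xi^T = 0.
    by rewrite mulmxBl -[S *m P *m xi *m _]mulmxA SE SPS subrr.
  by rewrite linearB /= trmx_mul mulmxBr mulmxA Y mul0mx subr0.
(* The entries of [w *m xi^T] are Euclidean products with orbit directions. A diagonal map by unit
   weights preserves such products, since each weight is 1 or the corresponding coordinate of the
   orbit direction vanishes. *)
have invT a : stab act q a -> act_jacobian act a c c q *m xi^T = xi^T.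
  move=> aq; apply/row_matrixP => k; rewrite !rowE mulmxA.
  set D := act_jacobian _ _ _ _ _; set v := delta_mx 0 k.
  have pair (w : 'rV[R]_6) X : (w *m xi^T *m X^T) 0 0 =
      \sum_i complex.Re (zeta i w * (complex.Re (zeta i (X *m xi)) -i* complex.Im (zeta i (X *m xi)))%C).
    rewrite -mulmxA -trmx_mul mxE; apply: etrans (@big_split_ord _ _ _ 3 3 _ _) _; rewrite /= -big_split /=.
    by apply: eq_bigr => i _; rewrite !mxE; rewrite mulrN opprK.
  have pairD X : (v *m D *m xi^T *m X^T) 0 0 = (v *m xi^T *m X^T) 0 0.
    rewrite !pair; apply: eq_bigr => i _; rewrite (zeta_act_jacobian i v L aq).
    by have [->|->] := xi_zeta X i aq; rewrite ?mul1r// /= !(mulr0, oppr0, subr0).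
  apply/rowP => j; have := pairD (delta_mx 0 j).
  by rewrite trmx_delta -!colE ![col _ _ _ _]mxE.
(* The matrix [P] is only a generalised inverse of [S]; replacing it by [P *m S *m P] makes it
   reflexive, which gives the second identity. *)
pose Lm := xi^T *m P *m S *m P.
exists Lm; split.
- by rewrite /Lm !mulmxA SE SPS SPxi.
- rewrite /Lm !mulmxA -!(mulmxA _ xi xi^T) SE.
  have SPS' (B : 'M[R]_(6, 2)) : B *m S *m P *m S = B *m S.
    by rewrite -(mulmxA B S P) -(mulmxA B) SPS.
  by rewrite !SPS'.
- by move=> a aq; rewrite /Lm !mulmxA invT.
Qed.

(** The lifts in [tbox] at distance at least [e] from those of the stabiliser of [q] form a compact
    set and all move [q]; by the tube lemma they move every nearby point, so they meet no stabiliser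
    there. *)
Lemma near_stab (e : R) : 0 < e -> exists2 V : set M, open_nbhs q V &
  forall p a, V p -> stab act p a ->
  exists Y b, [/\ `|Y| < e, stab act q b & a = texp Y * b].
Proof.
move=> e0.
pose A : set 'rV[R]_2 := \bigcup_(Z in [set Z | stab act q (texp Z)]) ball Z e.
have oA : open A by apply: bigcup_open => Z _; exact: ball_open.
pose Om : set ('rV[R]_2 * M) := ~` [set Xp | act (texp Xp.1) Xp.2 = Xp.2].
have oOm : open Om.
  apply: closed_openC => -[X p] cl; apply: (mfd_hausdorff (m := M)) => B C nB nC /=.
  have nBC : nbhs (X, p) ((fun Yq : 'rV[R]_2 * M => act (texp Yq.1) Yq.2) @^-1` B `&` snd @^-1` C).
    by apply: filterI; [exact: act_continuous|apply: (@cvg_snd _ _ (nbhs X) (nbhs p))].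
  by have [[Y p'] /= [E [Bp Cp]]] := cl _ nBC; exists p'; split=> //; rewrite -E.
have cK : compact (tbox `&` ~` A).
  by apply: compact_closedI; [exact: tbox_compact|exact: open_closedC].
have KO X : (tbox `&` ~` A) X -> Om (X, q).
  move=> [_ nA]; rewrite /Om /= => Xq; apply: nA; exists X; last exact: ballxx.
  by split=> //; exact: T2_texp.
have [V nV VK] := compact_tube cK oOm KO.
exists V => // p a Vp [Ta ap]; have [X Xb Xa] := texp_surj Ta.
have [[Z Zq XZ]|nA] := pselect (A X); last by have := VK p X Vp (conj Xb nA); rewrite /Om /= Xa.
exists (X - Z), (texp Z); split=> //; last by rewrite -texpD subrK.
by move: XZ; rewrite -ball_normE /= distrC.
Qed.

Section Slice.
Variable Lm : 'M[R]_(6, 2).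
Hypotheses (xiL : xi *m Lm *m xi = xi) (LxiL : Lm *m xi *m Lm = Lm).
Hypothesis LD : forall a, stab act q a -> act_jacobian act a c c q *m Lm = Lm.

Let Pi : 'M[R]_6 := 1%:M - Lm *m xi.

Let F (Xx : 'rV[R]_2 * 'rV[R]_6) : 'rV[R]_6 := chart_map c (act (texp Xx.1) (chart_inv c Xx.2)).

Let lp (v : 'rV[R]_6) : 'rV[R]_2 * 'rV[R]_6 := (v *m Lm, v *m Pi).

(** Tubular coordinates: the transverse part [v *m Pi] is a point of the slice, and [v *m Lm] is the
    torus element that moves it along its orbit. The derivative at 0 is [Lm *m xi + Pi], the
    identity. *)
Let G v := F (lp v).

Let D : set 'rV[R]_6 := [set v | polydisc 1 (v *m Pi) /\ act_domain act c c (lp v)].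

Let cL : continuous (mulmxr Lm : 'rV[R]_6 -> 'rV[R]_2) := @linear_rV_continuous _ _ _ _.
Let cPi : continuous (mulmxr Pi : 'rV[R]_6 -> 'rV[R]_6) := @linear_rV_continuous _ _ _ _.

Let D_open : open D.
Proof.
have o1 : open ((mulmxr Pi : 'rV[R]_6 -> 'rV[R]_6) @^-1` polydisc 1).
  by apply: open_comp => [v _|]; [exact: (@cPi v)|exact: polydisc_open].
have o2 : open (lp @^-1` act_domain act c c).
  apply: open_comp => [v _|]; last exact: act_domain_open.
  have [dl1 _] := diff_lin_ptw v cL; have [dl2 _] := diff_lin_ptw v cPi.
  by have [/differentiable_continuous clp _] := diff_pair_ptw dl1 dl2; exact: clp.
exact: openI o1 o2.
Qed.

Let p10 : polydisc 1 (0 : 'rV[R]_6).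
Proof. by move=> j; rewrite zeta0 /csq /= expr0n addr0 expr1n. Qed.

Let img0 : chart_img c 0. Proof. by rewrite -cq0; exact: chart_img_map. Qed.

Let D0 : D 0.
Proof.
split; rewrite /= ?mul0mx//; split=> /=; rewrite mul0mx//.
by rewrite mul0mx lin_inv0 texp0 act1.
Qed.

Let G_smooth : smooth_on D G.
Proof.
move=> k; apply: (@Ck_on_comp _ _ _ _ _ _ (act_domain act c c) lp F) => //.
- by apply: finite_basis_prod; exact: finite_basis_rV.
- exact: act_domain_open.
- by move=> v [].
- apply: Ck_on_pair => //.
    by apply: (@Ck_on_linear _ _ _ _ _ (mulmxr Lm : {linear 'rV[R]_6 -> 'rV[R]_2})) => //; exact: cL.
  by apply: (@Ck_on_linear _ _ _ _ _ (mulmxr Pi : {linear 'rV[R]_6 -> 'rV[R]_6})) => //; exact: cPi.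
- exact: act_smooth.
Qed.

Let F0 : act_domain act c c (0, 0).
Proof. by split=> //=; rewrite lin_inv0 texp0 act1. Qed.

Let F_diff : differentiable F (0, 0).
Proof.
have Fs : Ck_on 1 (act_domain act c c) F := act_smooth act Ac Ac 1%N.
exact: Ck_on_diff Fs F0.
Qed.

Let F_diffl X : 'd F (0, 0) (X, 0) = X *m xi.
Proof.
have [d1 E1] := diff_id_ptw (0 : 'rV[R]_2); have [d2 E2] := diff_cst_ptw (0 : 'rV[R]_6) (0 : 'rV[R]_2).
have [d3 E3] := diff_pair_ptw d1 d2; have [d4 E4] := diff_comp_ptw d3 F_diff.
have nE : \forall Y \near (0 : 'rV[R]_2), F (Y, 0) = orb Y.
  by apply: filterE => Y; rewrite /F /= lin_inv0.
have [_ E] := near_eq_diff_ptw nE d4.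
rewrite xiE; apply: esym; apply: etrans (E X) _; apply: etrans (E4 X) _.
by apply: congr1; apply: etrans (E3 X) _; congr pair; [exact: E1|exact: E2].
Qed.

Let F_diffr v : 'd F (0, 0) (0, v) = v.
Proof.
have [d1 E1] := diff_id_ptw (0 : 'rV[R]_6); have [d2 E2] := diff_cst_ptw (0 : 'rV[R]_2) (0 : 'rV[R]_6).
have [d3 E3] := diff_pair_ptw d2 d1; have [d4 E4] := diff_comp_ptw d3 F_diff.
have nE : \forall y \near (0 : 'rV[R]_6), F (0, y) = y.
  apply: filterS (open_nbhs_nbhs (conj (chart_img_open Ac) img0)) => y cy.
  by rewrite /F /= texp0 act1 chart_invK.
have [_ E] := near_eq_diff_ptw nE d4.
apply: etrans _ (etrans (esym (E v)) (E1 v)); apply: esym; apply: etrans (E4 v) _.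
by apply: congr1; apply: etrans (E3 v) _; congr pair; [exact: E2|exact: E1].
Qed.

Let G_jacobian : 'J G 0 = 1%:M.
Proof.
have [dl1 El1] := diff_lin_ptw (0 : 'rV[R]_6) cL.
have [dl2 El2] := diff_lin_ptw (0 : 'rV[R]_6) cPi.
have [d3 E3] := diff_pair_ptw dl1 dl2.
have lp0 : lp 0 = (0, 0) by rewrite /lp !mul0mx.
have dF : differentiable F (lp 0) by rewrite lp0; exact: F_diff.
have [d4 E4] := diff_comp_ptw d3 dF.
apply/row_matrixP => k; rewrite !rowE mulmx1; set v := delta_mx 0 k.
apply: etrans (jacobianE _ _ _) _; apply: etrans (E4 v) _.
have -> : 'd (fun w : 'rV[R]_6 => (mulmxr Lm w, mulmxr Pi w)) 0 v = (v *m Lm, 0) + (0, v *m Pi).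
  apply: etrans (E3 v) _; rewrite /= [RHS](_ : _ = (v *m Lm, v *m Pi)); last first.
    by congr pair; rewrite /= ?addr0 ?add0r.
  by congr pair; [exact: El1|exact: El2].
apply: etrans (diff_base _ _ lp0) _; apply: etrans (linearD _ _ _) _.
apply: etrans (congr2 +%R (F_diffl _) (F_diffr _)) _.
by rewrite /Pi mulmxBr mulmx1 mulmxA addrC subrK.
Qed.

Lemma slice_coordinates : exists (Q : set 'rV[R]_6) (g : 'rV[R]_6 -> 'rV[R]_6),
  [/\ open Q /\ Q `<=` D, Q 0,
      forall Q' : set 'rV[R]_6, open Q' -> Q' `<=` Q -> open (G @` Q')
    & forall v, Q v -> g (G v) = v].
Proof.
have uJ : 'J G 0 \in unitmx by rewrite G_jacobian unitmx1.
by have [Q [g [h1 h2 h3 h4 _]]] := inverse_function D_open D0 G_smooth uJ; exists Q, g.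
Qed.

Let xiPi : xi *m Pi = 0. Proof. by rewrite /Pi mulmxBr mulmx1 mulmxA xiL subrr. Qed.

Let PiL : Pi *m Lm = 0. Proof. by rewrite /Pi mulmxBl mul1mx LxiL subrr. Qed.

Let PiPi : Pi *m Pi = Pi. Proof. by rewrite {2}/Pi mulmxBr mulmx1 mulmxA PiL mul0mx subr0. Qed.

Let PiD a : stab act q a -> act_jacobian act a c c q *m Pi = Pi *m act_jacobian act a c c q.
Proof.
move=> aq; rewrite /Pi mulmxBr mulmxBl mulmx1 mul1mx mulmxA LD//; congr (_ - _).
rewrite -mulmxA; congr (_ *m _); apply/row_matrixP => k; rewrite !rowE mulmxA.
by rewrite xi_fix.
Qed.

(** The part of [Y] in the Lie algebra of the stabiliser is moved into [b], giving [b'], which sends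
    [s] to the slice point [s']. Then [s' + Y *m xi] and [s] have the same image under [G];
    injectivity kills the displacement along the orbit, and only [b'] remains. *)
Let stab_inj Q g Y b s : Q `<=` D -> (forall v, Q v -> g (G v) = v) ->
  stab act q b -> s *m Pi = s -> polydisc 1 s -> Q s ->
  (forall b', stab act q b' -> Q (s *m act_jacobian act b' c c q + Y *m xi)) ->
  act (texp Y * b) (chart_inv c s) = chart_inv c s -> stab act q (texp Y * b).
Proof.
move=> QD gK bq sPi s1 Qs Qs' fixs.
pose Z := Y - Y *m xi *m Lm.
have Zq : stab act q (texp Z).
  have /(xi_stab Z)/(_ 1) : Z *m xi = 0 by rewrite /Z mulmxBl -!mulmxA (mulmxA xi) xiL subrr.
  by rewrite scale1r.
have b'q := stabM Zq bq; set b' := texp Z * b in b'q.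
have aE : texp Y * b = texp (Y *m xi *m Lm) * b'.
  by rewrite /b' mulrA -texpD /Z addrC subrK.
have Qv := Qs' b' b'q; set s' := s *m _ in Qv.
have [_ _ eqv _ _] := L; have [Tb' _] := b'q.
have [bd bE] := eqv b' _ b'q (lin_inv_dom L s1).
have cs' : chart_map c (act b' (chart_inv c s)) = s'.
  by apply: zeta_inj => i; rewrite bE (lin_invK L s1) (zeta_act_jacobian _ _ L b'q).
have is' : chart_inv c s' = act b' (chart_inv c s) by rewrite -cs' chart_mapK.
have s'Pi : s' *m Pi = s' by rewrite /s' -mulmxA PiD// mulmxA sPi.
have PiL' (x : 'rV[R]_6) : x *m Pi = x -> x *m Lm = 0.
  by move=> <-; rewrite -mulmxA PiL mulmx0.
have vL : (s' + Y *m xi) *m Lm = Y *m xi *m Lm by rewrite mulmxDl (PiL' _ s'Pi) add0r.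
have GE : G (s' + Y *m xi) = G s.
  have vPi : (s' + Y *m xi) *m Pi = s' by rewrite mulmxDl s'Pi -(mulmxA Y xi Pi) xiPi mulmx0 addr0.
  rewrite /G /lp /F /= vL vPi (PiL' _ sPi) sPi.
  rewrite texp0 act1 is' -actM; [|exact: T2_texp|exact: Tb'].
  by rewrite -aE fixs.
have vs : s' + Y *m xi = s by rewrite -(gK _ Qv) GE gK.
have : Y *m xi *m Lm = 0 by rewrite -vL vs; exact: PiL'.
by rewrite aE => ->; rewrite texp0 mul1r.
Qed.

Lemma slice_of_inverse : exists Sl : set 'rV[R]_6,
  [/\ [/\ Sl 0, Sl `<=` polydisc 1 & forall s, Sl s -> s *m Pi = s],
      forall s (t : R), 0 <= t <= 1 -> Sl s -> Sl (t *: s),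
      open [set p | exists a s, [/\ T2 a, Sl s & p = act a (chart_inv c s)]]
    & forall s a, Sl s -> stab act (chart_inv c s) a -> stab act q a].
Proof.
have [Q [g [[oQ QD] Q0 imQ gK]]] := slice_coordinates.
have /nbhs_ballP[d /= d0 dQ] : nbhs (0 : 'rV[R]_6) Q by exact: open_nbhs_nbhs.
(* One half of [d] is spent on the slice point moved by the stabiliser, the other on the
   displacement [Y *m xi] along the orbit. *)
have d2 : 0 < d / 2 by rewrite divr_gt0.
have [rho rho_gt0 rhod] := @polydisc_nbhs R _ (nbhsx_ballx (0 : 'rV[R]_6) _ d2).
have cxi : continuous (mulmxr xi : 'rV[R]_2 -> 'rV[R]_6) := @linear_rV_continuous _ _ _ _.
have /nbhs_ballP[e /= e0 exi] : nbhs (0 : 'rV[R]_2) ((mulmxr xi : 'rV[R]_2 -> 'rV[R]_6) @^-1` ball (0 : 'rV[R]_6) (d / 2)).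
  by apply: cxi; rewrite /= mul0mx; exact: nbhsx_ballx.
have [V [oV Vq] VP] := near_stab e0.
pose B := polydisc rho `&` polydisc 1 `&` Q `&` (chart_img c `&` chart_inv c @^-1` V).
have oB : open B.
  by apply: openI; [apply: openI => //; apply: openI; exact: polydisc_open|exact: open_img_inv].
have rho0 : polydisc rho (0 : 'rV[R]_6).
  by move=> i; rewrite zeta0 /csq /= expr0n addr0 exprn_gt0.
have B0 : B 0 by split; [split=> //; split|split=> //; rewrite /= lin_inv0].
have nB : nbhs (0 : 'rV[R]_6) (Q `&` (mulmxr Pi : 'rV[R]_6 -> 'rV[R]_6) @^-1` B).
  apply: filterI; first exact: open_nbhs_nbhs.
  by apply: (@cPi 0); rewrite /= mul0mx; exact: open_nbhs_nbhs.
have [r r0 rB] := polydisc_nbhs nB.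
(* The slice is the projection of an open polydisc on which [G] is open, so its translates by the
   torus are the translates of an open set. *)
pose Sl : set 'rV[R]_6 := [set s | exists2 v, polydisc r v & s = v *m Pi].
have SlB s : Sl s -> B s by move=> [v /rB[_ vB] ->].
have SlPi s : Sl s -> s *m Pi = s by move=> [v _ ->]; rewrite -mulmxA PiPi.
exists Sl; split.
- split=> //; last by move=> s /SlB[[[]]].
  by exists 0; rewrite ?mul0mx// => i; rewrite zeta0 /csq /= expr0n addr0 exprn_gt0.
- move=> s t /andP[t0 t1] [v vr ->]; exists (t *: v); last by rewrite scalemxAl.
  move=> i; rewrite zetaZ csqM; apply: le_lt_trans (vr i).
  by rewrite ler_piMl ?csq_ge0// /csq /= expr0n addr0 expr_le1.
- pose U := chart_dom c `&` chart_map c @^-1` (G @` polydisc r).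
  have oU : open U.
    by apply: open_dom_map => //; apply: imQ; [exact: polydisc_open|move=> v /rB[]].
  rewrite [X in open X](_ : _ = \bigcup_(a in @T2 R) act a @` U); last first.
    have Gd v : polydisc r v -> chart_dom c (act (texp (v *m Lm)) (chart_inv c (v *m Pi))).
      by move=> /rB[/QD [_ [_ ?]] _].
    apply/seteqP; split=> [p [a [s [Ta [v vr ->] ->]]]|p [a Ta [u [ud [v vr uE]] <-]]].
      pose u := act (texp (v *m Lm)) (chart_inv c (v *m Pi)).
      exists (a * texp (- (v *m Lm))); first by apply: T2M => //; exact: T2_texp.
      exists u; first by split; [exact: Gd|exists v].
      by rewrite actM//; [rewrite act_texpNK|exact: T2_texp].
    exists (a * texp (v *m Lm)), (v *m Pi); split.
    + by apply: T2M => //; exact: T2_texp.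
    + by exists v.
    rewrite actM//; last exact: T2_texp.
    congr (act _ _); rewrite -(chart_mapK Ac ud) -uE.
    by rewrite /G /F /= chart_mapK//; exact: Gd.
  by apply: bigcup_open => a Ta; exact: act_image_open.
- move=> s a Sls ast; have [[[srho s1] Qs] [_ Vs]] := SlB _ Sls.
  have [Y [b [Ye bq aE]]] := VP _ a Vs ast; rewrite aE.
  apply: (stab_inj QD gK bq (SlPi _ Sls) s1 Qs); last by rewrite -aE; case: ast.
  move=> b' b'q; apply: dQ; rewrite -ball_normE /= sub0r normrN.
  have h1 : ball (0 : 'rV[R]_6) (d / 2) (s *m act_jacobian act b' c c q).
    apply: rhod => i; have [_ _ _ chi1 _] := L.
    by rewrite (zeta_act_jacobian _ _ L b'q) csqM (csq_S1 (chi1 _ _ b'q)) mul1r; exact: srho.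
  have h2 : ball (0 : 'rV[R]_6) (d / 2) (Y *m xi).
    by apply: exi; rewrite -ball_normE /= sub0r normrN.
  move: h1 h2; rewrite -!ball_normE /= !sub0r !normrN => h1 h2.
  by rewrite (splitr d); apply: le_lt_trans (ler_normD _ _) _; exact: ltrD.
Qed.
End Slice.

(** Besides the inclusion of stabilisers, it records that [Pi] kills the orbit directions and fixes
    the slice, which makes the two transverse, and that [Sl] is star-shaped, which later provides
    paths. *)
Lemma slice : exists (Pi : 'M[R]_6) (Sl : set 'rV[R]_6),
  [/\ xi *m Pi = 0,
      [/\ Sl 0, Sl `<=` polydisc 1 & forall s, Sl s -> s *m Pi = s],
      forall s (t : R), 0 <= t <= 1 -> Sl s -> Sl (t *: s),
      open [set p | exists a s, [/\ T2 a, Sl s & p = act a (chart_inv c s)]]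
    & forall s a, Sl s -> stab act (chart_inv c s) a -> stab act q a].
Proof.
have [Lm [xiL LxiL LD]] := equivariant_inverse.
have [Sl [h1 h2 h3 h4]] := slice_of_inverse xiL LxiL LD.
by exists (1%:M - Lm *m xi), Sl; split=> //; rewrite mulmxBr mulmx1 mulmxA xiL subrr.
Qed.

(** Modulo the Lie algebra of the stabiliser, [Y] equals [Y *m xi *m Lm]. If [texp Y] fixes [q],
    then [G] takes the same value at [Y *m xi] and at 0, and it is injective near 0. *)
Lemma stab_discrete : exists2 e : R, 0 < e & forall Y, `|Y| < e -> stab act q (texp Y) -> Y *m xi = 0.
Proof.
have [Lm [xiL LxiL LD]] := equivariant_inverse.
have [Q [g [[oQ QD] Q0 imQ gK]]] := slice_coordinates Lm.
have cxi : continuous (mulmxr xi : 'rV[R]_2 -> 'rV[R]_6) := @linear_rV_continuous _ _ _ _.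
have /nbhs_ballP[e /= e0 exi] : nbhs (0 : 'rV[R]_2) ((mulmxr xi : 'rV[R]_2 -> 'rV[R]_6) @^-1` Q).
  by apply: cxi; rewrite /= mul0mx; exact: open_nbhs_nbhs.
exists e => // Y Ye Yq.
have Q1 : Q (Y *m xi) by apply: exi; rewrite -ball_normE /= sub0r normrN.
apply: etrans (esym (gK _ Q1)) (etrans _ (gK _ Q0)); congr g.
have E1 : Y *m xi *m (1%:M - Lm *m xi) = 0.
  by rewrite -mulmxA mulmxBr mulmx1 mulmxA xiL subrr mulmx0.
rewrite /= !mul0mx E1.
rewrite lin_inv0 texp0 act1.
have /(xi_stab (Y *m xi *m Lm - Y))/(_ 1) : (Y *m xi *m Lm - Y) *m xi = 0.
  by rewrite mulmxBl -!mulmxA (mulmxA xi) xiL subrr.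
rewrite scale1r => Zq; congr (chart_map c _).
have [_ E] := stabM Zq Yq; rewrite -[RHS]E -texpD subrK //.
Qed.
End Orbit.

(** * Closed subgroups of the circle *)

Section Trigonometric.
Context {R : realType}.
Implicit Types (s t : R^o).

Lemma cos_diff t : differentiable (cos : R^o -> R^o) t /\ forall v, 'd (cos : R^o -> R^o) t v = - sin t * v :> R.
Proof.
have [d E] := @is_derive_cos R t; have df : differentiable (cos : R^o -> R^o) t by apply/derivable1_diffP.
split=> // v; have -> : v = v *: (1 : R^o) by rewrite /GRing.scale /= mulr1.
apply: etrans (linearZ _ _) _; rewrite -deriveE//; apply: etrans (congr1 _ E) _.
by rewrite /GRing.scale /= mulr1 mulrC.
Qed.

Lemma sin_diff t : differentiable (sin : R^o -> R^o) t /\ forall v, 'd (sin : R^o -> R^o) t v = cos t * v :> R.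
Proof.
have [d E] := @is_derive_sin R t; have df : differentiable (sin : R^o -> R^o) t by apply/derivable1_diffP.
split=> // v; have -> : v = v *: (1 : R^o) by rewrite /GRing.scale /= mulr1.
apply: etrans (linearZ _ _) _; rewrite -deriveE//; apply: etrans (congr1 _ E) _.
by rewrite /GRing.scale /= mulr1 mulrC.
Qed.

Lemma cos_sin_smooth k : Ck_on k [set: R^o] (cos : R^o -> R^o) /\ Ck_on k [set: R^o] (sin : R^o -> R^o).
Proof.
have oT : open [set: R^o] by exact: openT.
elim: k => [|k [IHc IHs]].
  split=> t _; apply: differentiable_continuous; [exact: (cos_diff t).1|exact: (sin_diff t).1].
split.
  apply: (@Ck_on_step _ _ _ _ _ _ (fun t v => (- v : R^o) * sin t)) => //.
  - by move=> t _; exact: (cos_diff t).1.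
  - by move=> t v _; apply: etrans ((cos_diff t).2 v) _; rewrite mulrC mulrN mulNr.
  - by move=> v; apply: Ck_on_mul => //; exact: Ck_on_cst.
apply: (@Ck_on_step _ _ _ _ _ _ (fun t v => (v : R^o) * cos t)) => //.
- by move=> t _; exact: (sin_diff t).1.
- by move=> t v _; apply: etrans ((sin_diff t).2 v) _; rewrite mulrC.
- by move=> v; apply: Ck_on_mul => //; exact: Ck_on_cst.
Qed.

Lemma diff0_cst (f : R^o -> R^o) : (forall t, differentiable f t /\ 'd f t 1 = 0) -> forall t, f t = f 0.
Proof.
move=> df t; apply/eqP; rewrite -subr_eq0; apply/eqP.
have [u _] := @MVT_diff R R^o f 0 t (fun u _ => (df (0 + u *: t)).1).
rewrite add0r => ->.
have t1E : t = t *: (1 : R^o) by rewrite /GRing.scale /= mulr1.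
apply: etrans (congr1 ('d f (0 + u *: t)) t1E) _.
by apply: etrans (linearZ _ _) _; apply: etrans (congr1 _ (df _).2) _; exact: mulr0.
Qed.

(** Differentiating the homomorphism law gives a linear equation with constant coefficients [al] and
    [be], and the modulus 1 forces [al = 0]. Its solution with value 1 at 0 is [cis (be * t)]. *)
Lemma one_parameter (u : R -> R[i]) : (forall s t, u (s + t) = u s * u t) ->
  (forall t, S1 (u t)) ->
  (forall t : R^o, differentiable (fun t : R^o => complex.Re (u t) : R^o) t) ->
  (forall t : R^o, differentiable (fun t : R^o => complex.Im (u t) : R^o) t) ->
  exists b : R, forall t, u t = cis (b * t).
Proof.
have key0 (x y : R) : 0 = (1 * x + x * 1) + (0 * y + y * 0) -> x = 0 by lra.
move=> uM u1 da db.
have [a aE] : exists a : R^o -> R^o, (fun t : R^o => complex.Re (u t) : R^o) = a by eexists.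
have [b bE] : exists b : R^o -> R^o, (fun t : R^o => complex.Im (u t) : R^o) = b by eexists.
rewrite aE in da; rewrite bE in db.
have uE t : u t = (a t +i* b t)%C by rewrite -aE -bE /=; case: (u t).
have aD s t : a (s + t) = a s * a t - b s * b t.
  by have := uM s t; rewrite !uE => -[].
have bD s t : b (s + t) = a s * b t + b s * a t.
  by have := uM s t; rewrite !uE => -[_ ->].
have u0 : u 0 = 1.
  have := uM 0 0; rewrite addr0 -[X in X = _]mulr1 => /(mulfI (S1_neq0 (u1 0))).
  by [].
have a0 : a 0 = 1 by have := uE 0; rewrite u0 => -[].
have b0 : b 0 = 0 by have := uE 0; rewrite u0 => -[].
have [al alE] : exists al : R, 'd a 0 1 = al by eexists.
have [be beE] : exists be : R, 'd b 0 1 = be by eexists.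
have dcst (k : R^o) (f : R^o -> R^o) t : differentiable f t -> differentiable (fun y => k * f y : R^o) t /\
    'd (fun y => k * f y : R^o) t 1 = k * 'd f t 1 :> R.
  move=> df; have [dk Ek] := diff_cst_ptw k t; have [d E] := diff_mul_ptw dk df; split; first exact: d.
  apply: etrans (E 1) _.
  apply: etrans (congr1 (fun z : R => k * 'd f t 1 + z * f t) (Ek 1)) _.
  by rewrite mul0r; exact: addr0.
have shift (f : R^o -> R^o) (t0 : R^o) : differentiable f t0 ->
    differentiable (fun t => f (t0 + t *: (1 : R^o))) (0 : R^o) /\
    'd (fun t => f (t0 + t *: (1 : R^o))) (0 : R^o) 1 = 'd f t0 1.
  move=> df; have [d1 E1] := diff_line_ptw t0 (1 : R^o) 0.
  have l0 : t0 + (0 : R^o) *: (1 : R^o) = t0 by rewrite scale0r addr0.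
  have df' : differentiable f ((fun t : R^o => t0 + t *: (1 : R^o)) 0) by rewrite /= l0.
  have [d2 E2] := diff_comp_ptw d1 df'; split; first exact: d2.
  apply: etrans (E2 1) _; apply: etrans (diff_base _ _ l0) _.
  by apply: congr1; apply: etrans (E1 1) _; rewrite scale1r.
have one t : t *: (1 : R^o) = t by rewrite /GRing.scale /= mulr1.
have a' (t : R^o) : 'd a t 1 = a t * al - b t * be :> R.
  have [d1 E1] := dcst (a t) a 0 (da 0); have [d2 E2] := dcst (b t) b 0 (db 0).
  have [d3 E3] := diffB_ptw d1 d2; have [d4 E4] := shift a t (da t).
  have nE : \forall s \near (0 : R^o), a t * a s - b t * b s = a (t + s *: (1 : R^o)).
    by apply: filterE => s; rewrite one aD.
  have [_ E5] := near_eq_diff_ptw nE d3.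
  apply: etrans (esym E4) _; apply: etrans (E5 1) _; apply: etrans (E3 1) _.
  exact: (congr2 (fun x y : R => x - y) (etrans E1 (congr1 _ alE)) (etrans E2 (congr1 _ beE))).
have b' (t : R^o) : 'd b t 1 = a t * be + b t * al :> R.
  have [d1 E1] := dcst (a t) b 0 (db 0); have [d2 E2] := dcst (b t) a 0 (da 0).
  have [d3 E3] := diffD_ptw d1 d2; have [d4 E4] := shift b t (db t).
  have nE : \forall s \near (0 : R^o), a t * b s + b t * a s = b (t + s *: (1 : R^o)).
    by apply: filterE => s; rewrite one bD.
  have [_ E5] := near_eq_diff_ptw nE d3.
  apply: etrans (esym E4) _; apply: etrans (E5 1) _; apply: etrans (E3 1) _.
  exact: (congr2 (fun x y : R => x + y) (etrans E1 (congr1 _ beE)) (etrans E2 (congr1 _ alE))).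
have al0 : al = 0.
  have [d1 E1] := diff_mul_ptw (da 0) (da 0); have [d2 E2] := diff_mul_ptw (db 0) (db 0).
  have [d3 E3] := diffD_ptw d1 d2; have [dc Ec] := diff_cst_ptw (1 : R^o) (0 : R^o).
  have nE : \forall s \near (0 : R^o), a s * a s + b s * b s = 1.
    by apply: filterE => s; have /S1P := u1 s; rewrite uE !expr2.
  have [_ E] := near_eq_diff_ptw nE d3.
  have E1' := etrans (E1 1) (congr2 (fun x y : R => a 0 * x + y * a 0) alE alE).
  have E2' := etrans (E2 1) (congr2 (fun x y : R => b 0 * x + y * b 0) beE beE).
  have := etrans (esym (Ec 1)) (etrans (E 1) (etrans (E3 1) (congr2 (fun x y : R => x + y) E1' E2'))).
  by rewrite a0 b0; exact: key0.
have scaled (f : R^o -> R^o) (t : R^o) : differentiable f (be * t) ->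
    differentiable (fun t => f (be * t)) t /\ 'd (fun t => f (be * t)) t 1 = 'd f (be * t) be.
  move=> df; have [d1 E1] := dcst be (fun t => t) t (diff_id_ptw t).1.
  have [d2 E2] := diff_comp_ptw d1 df; split; first exact: d2.
  apply: etrans (E2 1) _; apply: congr1; apply: etrans E1 _.
  by apply: etrans (congr1 _ ((diff_id_ptw t).2 1)) _; exact: mulr1.
have [C CE] : exists C : R^o -> R^o, (fun t => cos (be * t)) = C by eexists.
have [Sn SnE] : exists Sn : R^o -> R^o, (fun t => sin (be * t)) = Sn by eexists.
have dC t : differentiable C t /\ 'd C t 1 = - Sn t * be :> R.
  rewrite -CE -SnE; have [d E] := scaled _ t (cos_diff (be * t)).1; split; first exact: d.
  have E' := (cos_diff (be * t)).2 be.
  apply: etrans E _.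
  apply: etrans E' _.
  by [].
have dS t : differentiable Sn t /\ 'd Sn t 1 = C t * be :> R.
  rewrite -CE -SnE; have [d E] := scaled _ t (sin_diff (be * t)).1; split; first exact: d.
  have E' := (sin_diff (be * t)).2 be.
  apply: etrans E _.
  apply: etrans E' _.
  by [].
have C0 : C 0 = 1 by rewrite -CE mulr0 cos0.
have Sn0 : Sn 0 = 0 by rewrite -SnE mulr0 sin0.
(* With [r0] below, these are the real and imaginary parts of [u t] times the conjugate of
   [cis (be * t)]; their derivatives vanish, so this product stays equal to 1. *)
have p1 t : a t * C t + b t * Sn t = 1 :> R.
  have := @diff0_cst (fun t => a t * C t + b t * Sn t : R^o) _ t; rewrite a0 b0 C0 mul0r mulr1 addr0; apply.
  move=> s; have [d1 E1] := diff_mul_ptw (da s) (dC s).1; have [d2 E2] := diff_mul_ptw (db s) (dS s).1.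
  have [d3 E3] := diffD_ptw d1 d2; split; first exact: d3.
  have F1 := etrans (E1 1) (congr2 (fun x y : R => a s * x + y * C s) (dC s).2 (a' s)).
  have F2 := etrans (E2 1) (congr2 (fun x y : R => b s * x + y * Sn s) (dS s).2 (b' s)).
  apply: etrans (E3 1) _; apply: etrans (congr2 (fun x y : R => x + y) F1 F2) _; rewrite al0.
  move: (a s : R) (b s : R) (C s : R) (Sn s : R) => *; ring.
have r0 t : b t * C t - a t * Sn t = 0 :> R.
  have := @diff0_cst (fun t => b t * C t - a t * Sn t : R^o) _ t; rewrite b0 Sn0 mul0r mulr0 subr0; apply.
  move=> s; have [d1 E1] := diff_mul_ptw (db s) (dC s).1; have [d2 E2] := diff_mul_ptw (da s) (dS s).1.
  have [d3 E3] := diffB_ptw d1 d2; split; first exact: d3.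
  have F1 := etrans (E1 1) (congr2 (fun x y : R => b s * x + y * C s) (dC s).2 (b' s)).
  have F2 := etrans (E2 1) (congr2 (fun x y : R => a s * x + y * Sn s) (dS s).2 (a' s)).
  apply: etrans (E3 1) _; apply: etrans (congr2 (fun x y : R => x - y) F1 F2) _; rewrite al0.
  move: (a s : R) (b s : R) (C s : R) (Sn s : R) => *; ring.
exists be => t; have CS : C t ^+ 2 + Sn t ^+ 2 = 1 by rewrite -CE -SnE; exact: cos2Dsin2.
have key (x y z w : R) : x * z + y * w = 1 -> y * z - x * w = 0 -> z ^+ 2 + w ^+ 2 = 1 -> x = z /\ y = w.
  move=> h1 h2 h3; split.
    have -> : x = (x * z + y * w) * z - (y * z - x * w) * w + x * (1 - (z ^+ 2 + w ^+ 2)) by ring.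
    by rewrite h1 h2 h3; ring.
  have -> : y = (x * z + y * w) * w + (y * z - x * w) * z + y * (1 - (z ^+ 2 + w ^+ 2)) by ring.
  by rewrite h1 h2 h3; ring.
by rewrite uE; have [-> ->] := key _ _ _ _ (p1 t) (r0 t) CS; rewrite -CE -SnE.
Qed.
End Trigonometric.

(** * Stabilisers with an injective weight: circles and cyclic groups *)

Section TorusCharacter.
Context {R : realType} {M : manifold R 6} {act : torus_action M}.
Implicit Types (X Y : 'rV[R]_2) (a b : R[i] * R[i]).

Lemma texp_line0 X : (forall t : R, texp (t *: X) = 1) -> X = 0.
Proof.
(* This time brings [t *: X] into the ball on which [texp] takes the value 1 at 0 only. *)
move=> X1; pose t : R := pi / (`|X| + 1).
have n0 : 0 < `|X| + 1 by rewrite ltr_wpDl.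
have t0 : 0 < t by rewrite divr_gt0 ?pi_gt0.
have : t *: X = 0.
  apply: texp_inj0 => //; rewrite normrZ gtr0_norm// /t mulrAC ltr_pdivrMr//.
  have := pi_gt0 R; have := normr_ge0 X; nra.
by move/eqP; rewrite scaler_eq0 gt_eqF//= => /eqP.
Qed.

(** Weights come from an algebraic diagonalisation and carry no regularity of their own. It is read
    off from the smooth action on the point whose complex coordinates are all [1/2]: the weight is
    twice the [i]-th coordinate of the moved point. *)
Lemma char_one_parameter q c (chi : 'I_3 -> R[i] * R[i] -> R[i]) i X : linearized act q c chi ->
  (forall t : R, stab act q (texp (t *: X))) ->
  exists b : R, forall t, chi i (texp (t *: X)) = cis (b * t).
Proof.
move=> L stX; have [[[Ac qc] c0] imE eqv chi1 [_ chiM]] := L.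
pose x0 : 'rV[R]_6 := of_zeta (fun=> (2^-1 : R)%:C%C).
have x01 : polydisc 1 x0.
  by move=> j; rewrite of_zetaK /csq /=; lra.
have p0d := lin_inv_dom L x01.
pose F (t : R^o) : 'rV[R]_6 := chart_map c (act (texp (t *: X)) (chart_inv c x0)).
have oT : open [set: R^o] by exact: openT.
have Fs : smooth_on [set: R^o] F.
  move=> k; apply: (@Ck_on_comp _ _ _ _ _ _ (act_domain act c c) (fun t : R^o => (t *: X, x0))
    (fun Xx => chart_map c (act (texp Xx.1) (chart_inv c Xx.2)))) => //.
  - by apply: finite_basis_prod; exact: finite_basis_rV.
  - exact: act_domain_open.
  - move=> t _; split=> /=; first by rewrite imE.
    by have [] := eqv _ _ (stX t) p0d.
  - by apply: Ck_on_pair => //; [apply: Ck_on_scale => //; [exact: Ck_on_id|exact: Ck_on_cst]|exact: Ck_on_cst].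
  - exact: act_smooth.
have FE t : zeta i (F t) = chi i (texp (t *: X)) * (2^-1 : R)%:C%C.
  by have [_ ->] := eqv _ _ (stX t) p0d; rewrite (lin_invK L x01) of_zetaK.
have FRe t : complex.Re (chi i (texp (t *: X))) = 2 * F t 0 (@lshift 3 3 i).
  have := congr1 (@complex.Re R) (FE t); rewrite /=; case: (chi i _) => x y /= ->.
  by rewrite mulr0 subr0 mulrCA mulfV ?mulr1// pnatr_eq0.
have FIm t : complex.Im (chi i (texp (t *: X))) = 2 * F t 0 (@rshift 3 3 i).
  have := congr1 (@complex.Im R) (FE t); rewrite /=; case: (chi i _) => x y /= ->.
  by rewrite mulr0 add0r mulrCA mulfV ?mulr1// pnatr_eq0.
have dcoord (l : 'I_6) (t : R^o) : differentiable (fun t : R^o => 2 * F t 0 l : R^o) t.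
  have H : Ck_on 1 [set: R^o] (fun t : R^o => 2 * F t 0 l : R^o).
    by apply: Ck_on_mul => //; [exact: Ck_on_cst|apply: Ck_on_coord => //; exact: Fs].
  exact: Ck_on_diff H I.
apply: one_parameter.
- by move=> s t; rewrite scalerDl texpD; apply: chiM; exact: stX.
- by move=> t; apply: chi1; exact: stX.
- move=> t; have -> : (fun t : R^o => complex.Re (chi i (texp (t *: X))) : R^o) =
      (fun t : R^o => 2 * F t 0 (@lshift 3 3 i) : R^o) by apply/funext => s; rewrite FRe.
  exact: dcoord.
- move=> t; have -> : (fun t : R^o => complex.Im (chi i (texp (t *: X))) : R^o) =
      (fun t : R^o => 2 * F t 0 (@rshift 3 3 i) : R^o) by apply/funext => s; rewrite FIm.
  exact: dcoord.
Qed.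

Variables (q : M) (chi : R[i] * R[i] -> R[i]).
Hypotheses (chiM : forall a b, stab act q a -> stab act q b -> chi (a * b) = chi a * chi b).
Hypotheses (chi1 : forall a, stab act q a -> S1 (chi a)).
Hypotheses (chiI : forall a, stab act q a -> chi a = 1 -> a = 1).

Lemma char_1 : chi 1 = 1.
Proof.
have s1 := stab_1 act q.
have := chiM s1 s1; rewrite mulr1 -[X in X = _]mulr1 => /(mulfI (S1_neq0 (chi1 s1))).
by [].
Qed.

Lemma char_inj a b : stab act q a -> stab act q b -> chi a = chi b -> a = b.
Proof.
move=> aq bq ab; have [X _ Xb] := texp_surj (proj1 bq).
have Xq : stab act q (texp X) by rewrite Xb.
have b'q := stabV Xq.
have : a * texp (- X) = 1.
  apply: chiI; first exact: stabM.
  by rewrite chiM// ab -Xb -chiM// texpNM char_1.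
move/(congr1 ( *%R^~ b)); rewrite mul1r -mulrA [texp _ * b]mulrC -{1}Xb texpNM mulr1.
by [].
Qed.

Section Circle.
Hypothesis chiP : forall X, (forall t : R, stab act q (texp (t *: X))) ->
  exists b : R, forall t, chi (texp (t *: X)) = cis (b * t).

(** Along the line of [X0] the weight is [cis] with a non-zero speed, so it is already onto the
    circle; being injective on the stabiliser, it is an isomorphism. Its inverse is [f], which is
    smooth as it does not depend on the chosen argument [th]. *)
Lemma circle_of_char X0 : X0 != 0 -> (forall t : R, stab act q (texp (t *: X0))) ->
  is_circle (stab act q) /\ has_dim (stab act q) 1.
Proof.
move=> X00 stX; have [be chiE] := chiP stX.
have be0 : be != 0.
  apply: contra X00 => /eqP b0; apply/eqP/texp_line0 => t; apply: chiI => //.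
  by rewrite chiE b0 mul0r cis0.
have thE t : chi (texp ((t / be) *: X0)) = cis t by rewrite chiE mulrCA mulfV// mulr1.
split.
  have /choice [th thP] : forall z : R[i], exists t : R, S1 z -> cis t = z.
    by move=> z; have [/cis_surj[t [_ tz]]|nz] := pselect (S1 z); [exists t|exists 0].
  pose f (z : R[i]) := texp ((th z / be) *: X0).
  have fq z : stab act q (f z) by exact: stX.
  have chif z : S1 z -> chi (f z) = z by move=> z1; rewrite thE thP.
  exists f; split.
  - move=> z w z1 w1; apply: char_inj => //; first exact: stabM.
    by rewrite chiM// !chif//; exact: S1M.
  - by move=> z w z1 w1 fzw; rewrite -(chif z z1) fzw chif.
  - have fE t : f (cis t) = texp ((t / be) *: X0).
      by apply: char_inj => //; rewrite chif ?thE//; exact: S1_cis.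
    move=> k; apply: Ck_on_rV => [|j]; first exact: openT.
    have oT : open [set: R^o] by exact: openT.
    have [Ckc Cks] := @cos_sin_smooth R k.
    have lin (l : R) : Ck_on k [set: R^o] (fun t : R^o => t * l : R^o).
      by apply: Ck_on_mul => //; [exact: Ck_on_id|exact: Ck_on_cst].
    have Cc (l : R) : Ck_on k [set: R^o] (fun t : R^o => cos (t * l) : R^o).
      by apply: (@Ck_on_comp _ _ _ _ _ _ _ (fun t : R^o => t * l : R^o) (cos : R^o -> R^o) _ _ oT) => //; exact: finite_basis_R.
    have Cs (l : R) : Ck_on k [set: R^o] (fun t : R^o => sin (t * l) : R^o).
      by apply: (@Ck_on_comp _ _ _ _ _ _ _ (fun t : R^o => t * l : R^o) (sin : R^o -> R^o) _ _ oT) => //; exact: finite_basis_R.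
    have mE (t : R) i : ((t / be) *: X0) 0 i = t * (be^-1 * X0 0 i) by rewrite mxE mulrA.
    have -> : (fun t : R^o => real_coords (f (cis t)) 0 j : R^o) =
        (fun t : R^o => [:: cos (t * (be^-1 * X0 0 0)); sin (t * (be^-1 * X0 0 0));
                        cos (t * (be^-1 * X0 0 1)); sin (t * (be^-1 * X0 0 1))]`_j : R^o).
      by apply/funext => t; rewrite fE /real_coords mxE /= !mE.
    by case: j => [[|[|[|[|j]]]] //= _].
  - apply/seteqP; split=> [_ [z _ <-] //|a aq]; exists (chi a); first exact: chi1.
    by apply: char_inj => //; rewrite chif//; exact: chi1.
  - by move=> a [].
(* The generated space is a square matrix with the row space of [X0], the form in which [has_dim]
   describes a Lie algebra. *)
exists <<X0>>%MS; split; first by rewrite genmxE rank_rV X00.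
apply/seteqP; split=> X /=; rewrite genmxE; last first.
  by move=> /sub_rVP[k ->] t; rewrite scalerA; exact: stX.
move=> stX'; have [b' chiE'] := chiP stX'.
suff : X - (b' / be) *: X0 = 0 by move/eqP; rewrite subr_eq0 => /eqP ->; exact: scalemx_sub.
apply: texp_line0 => t.
have E : texp (t *: (X - (b' / be) *: X0)) = texp (t *: X) * texp ((- (t * b') / be) *: X0).
  by rewrite -texpD scalerBr scalerA mulrA -scaleNr mulNr.
by rewrite E; apply: chiI; [exact: stabM|rewrite chiM// thE chiE' -cisD mulrC subrr cis0].
Qed.
End Circle.

Section Cyclic.
Variable e : R.
Hypotheses (e0 : 0 < e) (disc : forall Y, `|Y| < e -> stab act q (texp Y) -> Y = 0).

(** A pigeonhole argument: the square of lifts is cut into cells of side less than [e], and two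
    stabiliser elements with lifts in the same cell have a quotient that discreteness forces to be
    1. *)
Lemma discrete_bounded : exists N : nat, forall s : seq (R[i] * R[i]),
  uniq s -> (forall a, a \in s -> stab act q a) -> (size s <= N)%N.
Proof.
have /choice [X XP] : forall a : R[i] * R[i], exists X, stab act q a -> tbox X /\ texp X = a.
  move=> a; have [[Ta _]|na] := pselect (stab act q a); last by exists 0.
  by have [X Xb Xa] := texp_surj Ta; exists X.
pose w : R := pi *+ 2.
have w0 : 0 < w by rewrite mulrn_wgt0// pi_gt0.
pose n := (Num.trunc (w / e)).+1.
have n0 : (0 : R) < n%:R by rewrite ltr0n.
have wn : w / n%:R < e by rewrite ltr_pdivrMr// mulrC -ltr_pdivrMr//; exact: truncnS_gt.
(* There are [n.+1] indices for [n] subdivisions because the closed side of the square contains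
   [2 pi], whose index is [n]. *)
pose cell (a : R[i] * R[i]) : {ffun 'I_2 -> 'I_n.+1} := [ffun i => inord (Num.trunc (X a 0 i * (n%:R / w)))].
exists #|{: {ffun 'I_2 -> 'I_n.+1}}| => s us sq.
rewrite -(size_map cell) -(card_uniqP _) ?max_card//.
rewrite map_inj_in_uniq// => a b /sq aq /sq bq cab.
have [Xa aE] := XP a aq; have [Xb bE] := XP b bq.
suff : X a - X b = 0 by move/eqP; rewrite subr_eq0 => /eqP E; rewrite -aE -bE E.
apply: disc; last first.
  by rewrite texpD aE; apply: stabM => //; apply: stabV; rewrite bE.
apply: le_lt_trans wn; apply: norm_rV_le => [|i]; first by rewrite divr_ge0// ltW.
have := congr1 (fun h : {ffun 'I_2 -> 'I_n.+1} => h i) cab; rewrite !ffunE => /(congr1 val) /=.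
have bnd (Y : 'rV[R]_2) : tbox Y -> 0 <= Y 0 i * (n%:R / w) /\ (Num.trunc (Y 0 i * (n%:R / w))%R < n.+1)%N.
  move=> /(_ i); rewrite /= in_itv /= => /andP[y0 y1].
  have yn : 0 <= Y 0 i * (n%:R / w) by rewrite mulr_ge0// divr_ge0// ltW.
  split=> //; rewrite ltnS -(ler_nat R); have /andP[tY _] := truncn_itv yn; apply: le_trans tY _.
  by rewrite mulrA ler_pdivrMr// mulrC ler_pM2l.
have [a0 an] := bnd _ Xa; have [b0 bn] := bnd _ Xb.
rewrite !inordK// => tab.
have /andP[ta1 ta2] := truncn_itv a0; have /andP[tb1 tb2] := truncn_itv b0.
rewrite tab in ta1 ta2; rewrite !mxE.
have -> : X a 0 i - X b 0 i = (X a 0 i * (n%:R / w) - X b 0 i * (n%:R / w)) * (w / n%:R).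
  have wn1 : (n%:R / w) * (w / n%:R) = 1 by rewrite mulrA divfK ?gt_eqF// divff// gt_eqF.
  by rewrite -mulrBl -mulrA wn1 mulr1.
have wn0 : 0 <= w / n%:R by rewrite divr_ge0// ltW.
rewrite normrM (ger0_norm wn0) ler_piMl//; rewrite -natr1 in ta2 tb2.
by rewrite ler_norml; apply/andP; split; lra.
Qed.

(* A finite group with an injective character of order n is the group of the n-th roots
   of unity. *)
Lemma cyclic_of_char : stab act q <> [set 1] -> exists2 k, (1 < k)%N & iso_Zk (stab act q) k.
Proof.
move=> nt; have [N sN] := discrete_bounded.
pose good k := `[< exists s : seq (R[i] * R[i]), [/\ uniq s, forall a, a \in s -> stab act q a & size s = k] >].
have ex0 : exists k, good k by exists 0%N; apply/asboolP; exists [::].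
have gN k : good k -> (k <= N)%N by move=> /asboolP[s [us sq <-]]; exact: sN.
case: (ex_maxnP ex0 gN) => n /asboolP[s [us sq sn]] nmax.
have sall a : stab act q a -> a \in s.
  move=> aq; apply: contraT => nas; suff : (n.+1 <= n)%N by rewrite ltnn.
  apply: nmax; apply/asboolP; exists (a :: s); split; rewrite /= ?nas ?sn// => b.
  by rewrite inE => /orP[/eqP ->|/sq].
have [a [aq a1]] : exists a, stab act q a /\ a <> 1.
  apply: contrapT => H; apply: nt; apply/seteqP; split=> [a aq /=|_ ->]; last exact: stab_1.
  by apply: contrapT => a1; apply: H; exists a.
have n1 : (1 < n)%N.
  rewrite -sn; have u2 : uniq [:: 1; a] by rewrite /= inE andbT; apply/eqP => E; apply: a1.
  apply: (uniq_leq_size u2) => b; rewrite !inE => /orP[/eqP ->|/eqP ->]; apply: sall => //.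
  exact: stab_1.
have n0 : (0 < n)%N by apply: ltn_trans n1.
pose cs := map chi s.
have ucs : uniq cs by rewrite map_inj_in_uniq// => b d /sq bq /sq dq; exact: char_inj.
(* Multiplication by [chi b] permutes the [n] values of the weight; comparing the products of all
   the values before and after gives the power. *)
have root b : b \in s -> chi b ^+ n = 1.
  move=> /sq bq; have uz : uniq (map ( *%R (chi b)) cs).
    by rewrite map_inj_uniq//; apply: mulfI; exact: S1_neq0 (chi1 bq).
  have sub : {subset map ( *%R (chi b)) cs <= cs}.
    move=> _ /mapP[_ /mapP[d ds ->] ->]; rewrite -chiM//; last exact: sq.
    by apply: map_f; apply: sall; apply: stabM => //; exact: sq.
  have [_ mE] := uniq_min_size uz sub (eq_leq (esym (size_map _ _))).
  have pE : \prod_(z <- map ( *%R (chi b)) cs) z = \prod_(z <- cs) z := perm_big _ (uniq_perm uz ucs mE).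
  move: pE; rewrite big_map big_split /= big_const_seq count_predT iter_mulr_1 size_map sn.
  rewrite -[X in _ = X]mul1r => /mulIf; apply.
  by rewrite prodf_seq_neq0; apply/allP => _ /mapP[d ds ->] /=; exact: S1_neq0 (chi1 (sq _ ds)).
pose om : R[i] := cis (pi *+ 2 / n%:R).
have omX k : om ^+ k = cis (k%:R * (pi *+ 2 / n%:R)).
  elim: k => [|k IH]; first by rewrite mul0r cis0.
  rewrite exprS IH /om; move: (pi *+ 2 / n%:R) => t.
  by rewrite -cisD -[k.+1%:R]natr1 mulrDl mul1r addrC.
have nR0 : (n%:R : R) != 0 by rewrite pnatr_eq0 -lt0n.
have omn : om ^+ n = 1.
  by rewrite omX mulrC divfK// /cis cos2pi sin2pi.
(* Otherwise [om] and the [n] values of the weight would be [n.+1] distinct roots of unity of order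
   dividing [n]. *)
have omcs : om \in cs.
  apply: contraT => no; suff : (n.+1 <= n)%N by rewrite ltnn.
  have -> : n.+1 = size (om :: cs) by rewrite /= size_map sn.
  apply: (max_unity_roots n0); last by rewrite /= no.
  apply/allP => z; rewrite inE => /orP[/eqP ->|/mapP[b bs ->]]; rewrite unity_rootE; apply/eqP => //.
  exact: root.
have [h hs hE] := mapP omcs; have hq := sq _ hs.
have hXq k : stab act q (h ^+ k).
  by elim: k => [|k IH]; [exact: stab_1|rewrite exprS; exact: stabM].
have chX k : chi (h ^+ k) = om ^+ k.
  elim: k => [|k IH]; first exact: char_1.
  by rewrite exprS chiM// IH -hE exprS.
have hn : h ^+ n = 1 by apply: chiI => //; rewrite chX.
(* The type ['Z_n] has [n] elements only when [n] is at least 2, which is where the non-trivial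
   stabiliser enters. *)
have ZnE : (Zp_trunc n).+2 = n by case: n n1 {nmax sn root om omX nR0 omn omcs hE chX hn n0} => [|[]].
pose f (x : 'Z_n) : R[i] * R[i] := h ^+ x.
have fI : injective f.
  move=> x y /(congr1 chi); rewrite !chX !omX => xy; apply/val_inj/eqP.
  have xn : (x < n)%N by rewrite -{2}ZnE; exact: ltn_ord.
  have yn : (y < n)%N by rewrite -{2}ZnE; exact: ltn_ord.
  have w0 : (0 : R) < pi *+ 2 by rewrite mulrn_wgt0// pi_gt0.
  have nRp : (0 : R) < n%:R by rewrite ltr0n.
  have : cis ((x%:R - y%:R) * (pi *+ 2 / n%:R) : R) = 1.
    by rewrite mulrBl cisD xy -cisD subrr cis0.
  move/cis_periodic_inj => H; have /eqP : (x%:R - y%:R) * (pi *+ 2 / n%:R) = 0 :> R.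
    apply: H; rewrite normrM (ger0_norm (_ : 0 <= pi *+ 2 / n%:R)) ?divr_ge0 ?ltW//.
    rewrite mulrCA gtr_pMr// ltr_pdivrMr// mul1r ltr_norml.
    have xR : (x%:R : R) < n%:R by rewrite ltr_nat.
    have yR : (y%:R : R) < n%:R by rewrite ltr_nat.
    have := ler0n R x; have := ler0n R y; move=> *; apply/andP; split; lra.
  rewrite mulf_eq0 (gt_eqF (_ : 0 < pi *+ 2 / n%:R)) ?divr_gt0 ?ltr0n// orbF subr_eq0.
  by rewrite eqr_nat.
exists n => //; exists f; split=> //.
- move=> x y; have vE : nat_of_ord (x + y) = ((x + y)%N %% n)%N by apply: (congr1 (modn (x + y)) ZnE).
  by rewrite /f -exprD vE; exact: expr_mod.
- apply/seteqP; split=> [_ [x _ <-]|b bq]; first exact: hXq.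
  have uf : uniq (map f (enum 'Z_n)) by rewrite map_inj_uniq// enum_uniq.
  have fs : {subset map f (enum 'Z_n) <= s} by move=> _ /mapP[x _ ->]; apply: sall; exact: hXq.
  have sz : (size s <= size (map f (enum 'Z_n)))%N by rewrite size_map -cardE card_ord ZnE sn.
  have [_ mE] := uniq_min_size uf fs sz.
  by have := sall b bq; rewrite -mE => /mapP[x _ ->]; exists x.
Qed.
End Cyclic.
End TorusCharacter.

Section Dimension.
Context {R : realType}.
Implicit Types H : set (R[i] * R[i]).

Lemma has_dim_uniq H d d' : has_dim H d -> has_dim H d' -> d = d'.
Proof.
move=> [A [<- EA]] [A' [<- EA']].
have sub (B B' : 'M[R]_2) : [set X : 'rV[R]_2 | (X <= B)%MS] `<=` [set X | (X <= B')%MS] -> (B <= B')%MS.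
  by move=> h; apply/row_subP => i; apply: h; exact: row_sub.
by apply/eqP; rewrite eqn_leq !mxrankS//; apply: sub; rewrite -EA -EA'.
Qed.

Lemma has_dim_trivial : has_dim [set (1 : R[i] * R[i])] 0.
Proof.
exists 0; rewrite mxrank0; split=> //; apply/seteqP; split=> X /=.
  by move=> h; rewrite (texp_line0 h) sub0mx.
by rewrite submx0 => /eqP -> t; rewrite scaler0 texp0.
Qed.

Lemma has_dim_torus : has_dim (@T2 R) 2.
Proof.
exists 1%:M; rewrite mxrank1; split=> //; apply/seteqP; split=> X /= _; first exact: submx1.
by move=> t; exact: T2_texp.
Qed.
End Dimension.

Lemma path_connected_set (R : realType) (T : topologicalType) (A : set T) (x0 : T) :
  (forall x, A x -> exists gam : R -> T, [/\ gam 0 = x0, gam 1 = x,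
     forall t, 0 <= t <= 1 -> A (gam t) & forall t, 0 <= t <= 1 -> {for t, continuous gam}]) ->
  connected A.
Proof.
move=> pA.
have /choice [gam gamP] : forall x, exists gam : R -> T, A x -> [/\ gam 0 = x0, gam 1 = x,
     forall t, 0 <= t <= 1 -> A (gam t) & forall t, 0 <= t <= 1 -> {for t, continuous gam}].
  move=> x; have [Ax|nA] := pselect (A x); last by exists (fun=> x0).
  by have [g gP] := pA x Ax; exists g.
have -> : A = \bigcup_(x in A) gam x @` `[0, 1].
  apply/seteqP; split=> [x Ax|y [x Ax [t]]].
    by exists x => //; exists 1; [rewrite /= in_itv /= ler01 lexx|have [] := gamP x Ax].
  by rewrite /= in_itv /= => t01 <-; have [_ _ + _] := gamP x Ax; apply.
apply: bigcup_connected.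
  exists x0 => x Ax; exists 0; first by rewrite /= in_itv /= ler01 lexx.
  by have [] := gamP x Ax.
move=> x Ax; apply: connected_continuous_connected; first exact: segment_connected.
apply: continuous_in_subspaceT => t /set_mem; rewrite /= in_itv /= => t01.
by have [_ _ _] := gamP x Ax; apply.
Qed.

(** * The three cases *)

Section Cases.
Context {R : realType} {M : manifold R 6} {S : su3_structure M} {act : torus_action M}.
Hypotheses (symm : two_torus_symmetry S act) (eff : effective act).
Notation C := (R[i]).
Implicit Types (p q : M) (a b : C * C) (i j k : 'I_3).

Lemma stab_torus q : (forall X, stab act q (texp X)) -> stab act q = @T2 R.
Proof.
move=> h; apply/seteqP; split=> [a []//|a /texp_surj [X _ <-]]; exact: h.
Qed.

Lemma two_of_three (z : 'I_3 -> C) i j : i != j -> \prod_k z k = 1 -> z i = 1 -> z j = 1 -> forall k, z k = 1.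
Proof.
move=> ij pz zi zj k; have [-> //|ki] := eqVneq k i; have [-> //|kj] := eqVneq k j.
rewrite -[LHS]mulr1 -[RHS]pz (bigD1 k)//=; congr (_ * _); rewrite big1// => l lk.
suff h : l = i \/ l = j by case: h => ->.
clear -ij ki kj lk; case: i j k l ij ki kj lk => [[|[|[|?]]] ?] [[|[|[|?]]] ?] [[|[|[|?]]] ?] [[|[|[|?]]] ?] //= *;
  solve [by left; apply/val_inj|by right; apply/val_inj].
Qed.

Lemma faithful_pair q c chi a i j : linearized act q c chi -> stab act q a -> i != j ->
  chi i a = 1 -> chi j a = 1 -> a = 1.
Proof.
move=> L aq ij ai aj; have [_ _ _ _ [chip _]] := L.
by apply: (isotropy_faithful symm eff L aq); exact: two_of_three ij (chip a aq) ai aj.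
Qed.

(** As the stabiliser is not the whole torus, some orbit direction has a non-zero coordinate [i0],
    and invariance of that direction makes this weight 1. Were another weight trivial on all of [H],
    an element of [H] other than 1 would have two weights equal to 1. *)
Lemma one_trivial_weight q (H : set (C * C)) : H `<=` stab act q -> (exists2 a, H a & a <> 1) ->
  stab act q <> @T2 R ->
  exists c chi i0, [/\ linearized act q c chi, forall a, stab act q a -> chi i0 a = 1
    & forall j, j != i0 -> exists2 a, H a & chi j a != 1].
Proof.
move=> Hq [a0 Ha0 a01] nT; have [c [chi L]] := linearized_chart symm q.
have [X [i0 nz]] : exists X : 'rV[R]_2, exists i0, zeta i0 (X *m @xi _ _ act q c) <> 0.
  apply: contrapT => h; apply: nT; apply: stab_torus => X.
  have /(xi_stab L)/(_ 1) : X *m @xi _ _ act q c = 0; last by rewrite scale1r.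
  apply: zeta_inj => i; rewrite zeta0; apply: contrapT => nz; apply: h; by exists X, i.
exists c, chi, i0; split=> // [a aq|j ji0].
  by have [|] := xi_zeta L X i0 aq.
apply: contrapT => h; apply: a01; apply: (faithful_pair L (Hq _ Ha0) ji0).
  by apply: contrapT => n1; apply: h; exists a0 => //; apply/eqP.
by have [|] := xi_zeta L X i0 (Hq _ Ha0).
Qed.

Lemma nontrivial_stab q : stab act q <> [set 1] -> exists2 a, stab act q a & a <> 1.
Proof.
move=> nt; apply: contrapT => h; apply: nt; apply/seteqP; split=> [a aq /=|_ ->]; last exact: stab_1.
by apply: contrapT => a1; apply: h; exists a.
Qed.

(* Some direction of the orbit is moved, so some weight [i0] is trivial on the stabiliser;
   the product of the weights being 1, each of the other two is faithful. *)
Lemma isolated_stabiliser p : stab act p <> [set 1] -> stab act p <> @T2 R ->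
  exists c chi i0 (Pi : 'M[R]_6) (Sl : set 'rV[R]_6),
  let W := [set q | exists a s, [/\ T2 a, Sl s & q = act a (chart_inv c s)]] in
  [/\ linearized act p c chi /\ @xi _ _ act p c *m Pi = 0,
      (forall j a, j != i0 -> stab act p a -> chi j a = 1 -> a = 1) /\
      (forall (X : 'rV[R]_2) j, j != i0 -> zeta j (X *m @xi _ _ act p c) = 0),
      open W /\ torbit act p `<=` W,
      forall s, Sl s -> s *m Pi = s /\
        ((forall j, j != i0 -> zeta j s = 0) /\ stab act (chart_inv c s) = stab act p \/
         stab act (chart_inv c s) = [set 1])
    & totally_geodesic_complex_surface S [set q | W q /\ stab act q = stab act p]].
Proof.
move=> nt nT; set H := stab act p in nt nT *.
have [a0 Ha0 a01] := nontrivial_stab nt.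
have [c [chi [i0 [L chi0 chij]]]] := one_trivial_weight (@subset_refl _ H) (ex_intro2 _ _ a0 Ha0 a01) nT.
have [Pi [Sl [xiPi [Sl0 Slp SlPi] Slt oW Slst]]] := slice L.
set W := [set q | _] in oW.
have inv0 := lin_inv0 L; have Ac := lin_atlas L.
have fixs s : Sl s -> (forall j, j != i0 -> zeta j s = 0) -> H `<=` stab act (chart_inv c s).
  move=> Sls sz a Ha; split; first by case: Ha.
  apply/(lin_fix L Ha (lin_inv_dom L (Slp _ Sls))) => i; rewrite (lin_invK L (Slp _ Sls)).
  by have [->|/sz] := eqVneq i i0; [left; exact: chi0|right].
have fj j a : j != i0 -> H a -> chi j a = 1 -> a = 1.
  by move=> ji Ha ja; apply: (faithful_pair L Ha ji ja); exact: chi0.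
have not1 q : H `<=` stab act q -> stab act q <> [set 1].
  by move=> Hq E; apply: a01; have := Hq _ Ha0; rewrite E.
have dich s : Sl s -> (forall j, j != i0 -> zeta j s = 0) /\ stab act (chart_inv c s) = H \/
         stab act (chart_inv c s) = [set 1].
  move=> Sls; have [sz|] := pselect (forall j, j != i0 -> zeta j s = 0).
    left; split=> //; apply/seteqP; split; last exact: fixs.
    by move=> a; exact: Slst.
  move=> /existsNP[j /not_implyP[ji nz]]; right; apply/seteqP; split=> [a ast /=|_ ->]; last exact: stab_1.
  have Ha := Slst _ _ Sls ast; have [_ aE] := ast; apply: (fj j a ji Ha).
  have /(lin_fix L Ha (lin_inv_dom L (Slp _ Sls)))/(_ j) := aE.
  by rewrite (lin_invK L (Slp _ Sls)) => -[].
have orbW : torbit act p `<=` W.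
  by move=> _ [a Ta <-]; exists a, 0; rewrite inv0.
exists c, chi, i0, Pi, Sl; split=> //.
- split=> // X j ji; have [a Ha nj] := chij j ji.
  by have [E|//] := xi_zeta L X j Ha; rewrite E eqxx in nj.
- by move=> s Sls; split; [exact: SlPi|exact: dich].
(* Stabilisers in [W] are either [H] or trivial, so having stabiliser [H] amounts to being fixed by
   [H]; the results on fixed-point sets then apply. *)
rewrite -/W; have NE : [set q | W q /\ stab act q = H] = [set q | W q /\ forall a, H a -> act a q = q].
  apply/seteqP; split=> q [Wq Hq]; split=> //; first by move=> a; rewrite -Hq => -[].
  have [a [s [Ta Sls qE]]] := Wq; have sq : stab act q = stab act (chart_inv c s) by rewrite qE stab_act.
  have Hsub : H `<=` stab act q by move=> b Hb; split; [case: Hb|exact: Hq].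
  by rewrite sq; have [[]|E] := dich _ Sls => //; case: (not1 _ Hsub); rewrite sq.
rewrite NE; apply: fixed_surface => //.
- by move=> a [].
- move=> q Nq; have [Wq Hq] := Nq; move: (Nq); rewrite -[X in X q]NE => -[_ stq].
  have Hq' : H `<=` stab act q by rewrite stq.
  have nTq : stab act q <> @T2 R by rewrite stq.
  have [c' [chi' [i1 [L' h1 h2]]]] := one_trivial_weight Hq' (ex_intro2 _ _ a0 Ha0 a01) nTq.
  exists c', chi', i1; split=> // a Ha; apply: h1; by rewrite stq.
- by exists p; split=> [|a []//]; apply: orbW; exists 1; [exact: T2_1|exact: act1].
rewrite -NE; apply: (@path_connected_set _ _ _ p) => q [[a [s [Ta Sls qE]]] stq].
have sts : stab act (chart_inv c s) = H by rewrite -stq qE stab_act.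
have [[sz _]|E] := dich _ Sls; last by case: nt; rewrite -sts.
have [X _ XE] := texp_surj Ta.
(* The path shrinks the slice point to the centre and the lift of the torus element to 0 at the same
   time; each point of it keeps the stabiliser [H], since the coordinates other than [i0] remain
   zero. *)
exists (fun t => act (texp (t *: X)) (chart_inv c (t *: s))); split.
- by rewrite !scale0r texp0 act1 inv0.
- by rewrite !scale1r XE qE.
- move=> t t01; have Slts := Slt s t t01 Sls; split.
    by exists (texp (t *: X)), (t *: s); split=> //; exact: T2_texp.
  rewrite stab_act; last exact: T2_texp.
  have [[]//|E] := dich _ Slts; case: (@not1 (chart_inv c (t *: s))) => //; apply: fixs => // j ji.
  by rewrite zetaZ sz// mulr0.
move=> t t01; have Slts := Slt s t t01 Sls; have [_ imE _ _ _] := L.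
apply: act_cvg2; first by apply: cvgZr_tmp; exact: cvg_id.
apply: (@cvg_comp _ _ _ (fun t : R => t *: s) (chart_inv c)); last first.
  by apply: chart_inv_cvg => //; rewrite imE; exact: Slp.
by apply: cvgZr_tmp; exact: cvg_id.
Qed.

Lemma other_index i : exists j, j != i.
Proof. by case: i => [[|m] im]; [exists (Ordinal (isT : 1 < 3)%N)|exists ord0]. Qed.

Lemma circle_stabiliser p : has_dim (stab act p) 1 ->
  is_circle (stab act p) /\
  exists W : set M,
  [/\ open W, torbit act p `<=` W,
      forall q, W q -> stab act q = [set 1] \/ stab act q = stab act p
    & totally_geodesic_complex_surface S [set q | W q /\ stab act q = stab act p]].
Proof.
move=> d1.
have nt : stab act p <> [set 1] by move=> E; rewrite E in d1; have := has_dim_uniq d1 has_dim_trivial.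
have nT : stab act p <> @T2 R by move=> E; rewrite E in d1; have := has_dim_uniq d1 has_dim_torus.
have [c [chi [i0 [Pi [Sl [[L _] [fj _] [oW orbW] Slst tg]]]]]] := isolated_stabiliser nt nT.
have [j ji] := other_index i0; have [_ _ _ chi1 [_ chiM]] := L.
split.
  have [A [rA LA]] := d1.
  have [k Ak] : exists k : 'I_2, row k A != 0.
    apply: contrapT => h; suff A0 : A = 0 by rewrite A0 mxrank0 in rA.
    apply/row_matrixP => k; rewrite row0; apply/eqP; apply: contrapT => n0; apply: h.
    by exists k; apply/negP.
  have stA : forall t : R, stab act p (texp (t *: row k A)).
    have : lie_algebra (stab act p) (row k A) by rewrite LA /=; exact: row_sub.
    by [].
  have [] // := @circle_of_char _ _ act p (chi j) _ _ _ _ (row k A) Ak stA.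
  - by move=> a b; exact: chiM.
  - by move=> a; exact: chi1.
  - by move=> a aq; exact: fj.
  - by move=> X; exact: char_one_parameter L.
exists [set q | exists a s, [/\ T2 a, Sl s & q = act a (chart_inv c s)]]; split=> //.
move=> q [a [s [Ta Sls ->]]]; rewrite stab_act//.
by have [_ [[_ ->]|->]] := Slst s Sls; [right|left].
Qed.

(** With a discrete stabiliser the infinitesimal action is injective and its image, of real
    dimension two, fills the complex line of the trivial weight. The slice meets that line at 0
    only, so the surface of points with stabiliser [stab act p] is the orbit itself. *)
Lemma finite_stabiliser p : has_dim (stab act p) 0 -> stab act p <> [set 1] ->
  [/\ exists2 k, (1 < k)%N & iso_Zk (stab act p) k,
      totally_geodesic_complex_surface S (torbit act p)
    & exists W : set M,
      [/\ open W, torbit act p `<=` W,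
          forall a q, T2 a -> W q -> W (act a q)
        & forall q, W q -> ~ torbit act p q -> stab act q = [set 1]]].
Proof.
move=> d0 nt.
have nT : stab act p <> @T2 R by move=> E; rewrite E in d0; have := has_dim_uniq d0 has_dim_torus.
have [c [chi [i0 [Pi [Sl [[L xiPi] [fj xij] [oW orbW] Slst tg]]]]]] := isolated_stabiliser nt nT.
have [j ji] := other_index i0; have [_ _ _ chi1 [_ chiM]] := L.
have xi_inj (X : 'rV[R]_2) : X *m @xi _ _ act p c = 0 -> X = 0.
  move=> /(xi_stab L) stX; have [A [/eqP rA LA]] := d0.
  have : lie_algebra (stab act p) X by [].
  by rewrite LA /=; move: rA; rewrite mxrank_eq0 => /eqP ->; rewrite submx0 => /eqP.
have s0 s : Sl s -> (forall j, j != i0 -> zeta j s = 0) -> s = 0.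
  move=> Sls sz; have [sPi _] := Slst s Sls.
  suff [X XE] : exists X : 'rV[R]_2, X *m @xi _ _ act p c = s by rewrite -sPi -XE -mulmxA xiPi mulmx0.
  pose lr (k : 'I_2) : 'I_6 := if k == 0 then @lshift 3 3 i0 else @rshift 3 3 i0.
  (* The two columns of the infinitesimal action along the complex line [i0]; the others vanish, so
     injectivity makes this square block invertible. *)
  pose B : 'M[R]_2 := \matrix_(i, k) (@xi _ _ act p c) i (lr k).
  have XB (X : 'rV[R]_2) (k : 'I_2) : (X *m B) 0 k = (X *m @xi _ _ act p c) 0 (lr k).
    by rewrite !mxE; apply: eq_bigr => i _; rewrite mxE.
  have uB : B \in unitmx.
    rewrite -row_free_unit -kermx_eq0; apply/eqP/row_matrixP => k; rewrite row0.
    apply: xi_inj; apply: zeta_inj => i; rewrite zeta0.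
    have [->|/xij //] := eqVneq i i0; set X := row k _.
    have X0 : X *m B = 0 by rewrite /X -row_mul mulmx_ker row0.
    by rewrite /zeta -(XB X 0) -(XB X 1) X0 !mxE.
  exists ((\row_k s 0 (lr k)) *m invmx B); apply: zeta_inj => i.
  have [->|ii0] := eqVneq i i0; last by rewrite sz// xij.
  by rewrite /zeta -(XB _ 0) -(XB _ 1) mulmxKV// !mxE.
have inv0 := lin_inv0 L.
have orbE : torbit act p = [set q | [set q | exists a s, [/\ T2 a, Sl s & q = act a (chart_inv c s)]] q
    /\ stab act q = stab act p].
  apply/seteqP; split=> [q oq|q [[a [s [Ta Sls ->]]]]].
    by split; [exact: orbW|case: oq => a Ta <-; exact: stab_act].
  rewrite stab_act// => E; have [_ [[sz _]|E1]] := Slst s Sls; last by case: nt; rewrite -E.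
  by rewrite (s0 s Sls sz) inv0; exists a.
split.
- have [e e0 disc] := stab_discrete L.
  apply: (@cyclic_of_char _ _ act p (chi j) _ _ _ e e0) => //.
  + by move=> a b; exact: chiM.
  + by move=> a; exact: chi1.
  + by move=> a aq; exact: fj.
  + by move=> Y Ye Yq; apply: xi_inj; exact: disc.
- by rewrite orbE.
exists [set q | exists a s, [/\ T2 a, Sl s & q = act a (chart_inv c s)]]; split=> //.
- by move=> a _ Ta [b [s [Tb Sls ->]]]; exists (a * b), s; split=> //; [exact: T2M|rewrite actM].
move=> q Wq nq; have [a [s [Ta Sls qE]]] := Wq; rewrite qE stab_act//.
have [_ [[_ E]|//]] := Slst s Sls; case: nq; rewrite orbE; split=> //.
by rewrite qE stab_act.
Qed.

(** * Fixed points of the whole torus *)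

Section FixedPoint.
Variable p : M.
Hypothesis stabp : stab act p = @T2 R.
Variables (c : chart R 6 M) (chi : 'I_3 -> C * C -> C).
Hypothesis L : linearized act p c chi.

Let Ac : atlas c := lin_atlas L.

Let Tp a : T2 a -> stab act p a. Proof. by rewrite stabp. Qed.

Let h01 : 0 < (2^-1 : R) < 1. Proof. by apply/andP; split; lra. Qed.

Let half1 x : @polydisc R 2^-1 x -> polydisc 1 x.
Proof. by move=> xh i; apply: lt_le_trans (xh i) _; have := h01; nra. Qed.

Let stabE q : chart_dom c q ->
  stab act q = [set a | T2 a /\ forall i, chi i a = 1 \/ zeta i (chart_map c q) = 0].
Proof.
move=> qc; apply/seteqP; split=> a [Ta]; first by move/(lin_fix L (Tp Ta) qc).
by move=> h; split=> //; apply/(lin_fix L (Tp Ta) qc).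
Qed.

Let chiP i (X : 'rV[R]_2) : exists b : R, forall t, chi i (texp (t *: X)) = cis (b * t).
Proof. by apply: (char_one_parameter i L) => t; apply: Tp; exact: T2_texp. Qed.

(** Composed with [texp], the weight is [cis] of a linear form on R^2 with coefficients [b0] and
    [b1]; the vector [(b1, - b0)] is in its kernel, and the first basis vector is taken when
    [b0 = 0]. *)
Lemma kernel_line i : exists2 X0 : 'rV[R]_2, X0 != 0 & forall t : R, chi i (texp (t *: X0)) = 1.
Proof.
pose e (k : 'I_2) : 'rV[R]_2 := delta_mx 0 k.
have [b0 B0] := chiP i (e 0); have [b1 B1] := chiP i (e 1).
have [_ _ _ _ [_ chiM]] := L.
have [b00|b0n] := eqVneq b0 0.
  exists (e 0) => [|t]; last by rewrite B0 b00 mul0r cis0.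
  by apply/eqP => /(congr1 (fun v : 'rV[R]_2 => v 0 0)); rewrite !mxE !eqxx => /eqP; rewrite oner_eq0.
exists (b1 *: e 0 - b0 *: e 1) => [|t].
  apply/eqP => /(congr1 (fun v : 'rV[R]_2 => v 0 1)); rewrite !mxE /= mulr0 mulr1 add0r => /eqP.
  by rewrite oppr_eq0 (negPf b0n).
have -> : t *: (b1 *: e 0 - b0 *: e 1) = (t * b1) *: e 0 + (- (t * b0)) *: e 1.
  by rewrite scalerBr !scalerA scaleNr.
rewrite texpD chiM; try by apply: Tp; exact: T2_texp.
by rewrite B0 B1 -cisD (_ : _ + _ = 0) ?cis0//; ring.
Qed.

(** The radius is half of that of the chart, so that the closures of the axes, taken in [M], stay
    inside the chart. *)
Let W : set M := chart_dom c `&` chart_map c @^-1` polydisc 2^-1.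

Definition axis i : set M :=
  [set q | [/\ W q, zeta i (chart_map c q) != 0 & forall j, j != i -> zeta j (chart_map c q) = 0]].

Let stab_axis i q : axis i q -> stab act q = [set a | T2 a /\ chi i a = 1].
Proof.
move=> [[qc _] zi zj]; rewrite stabE//; apply/seteqP; split=> a [Ta h]; split=> //.
  by have [//|/eqP] := h i; rewrite (negPf zi).
by move=> k; have [->|/zj] := eqVneq k i; [left|right].
Qed.

Let axis_pair i j a : j != i -> T2 a -> chi i a = 1 -> chi j a = 1 -> a = 1.
Proof. by move=> ji Ta ai aj; exact: (faithful_pair L (Tp Ta) ji aj ai). Qed.

Lemma axis_circle i q : axis i q -> is_circle (stab act q) /\ has_dim (stab act q) 1.
Proof.
move=> qi; have [X0 X00 X0i] := kernel_line i; have [j ji] := other_index i.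
have [_ _ _ chi1 [_ chiM]] := L; have sE := stab_axis qi.
apply: (@circle_of_char _ _ act q (chi j) _ _ _ _ X0 X00).
- by move=> a b; rewrite sE => -[Ta _] [Tb _]; apply: chiM; exact: Tp.
- by move=> a; rewrite sE => -[Ta _]; apply: chi1; exact: Tp.
- by move=> a; rewrite sE => -[Ta ai]; exact: axis_pair ji Ta ai.
- by move=> X _; exact: chiP.
by move=> t; rewrite sE; split; [exact: T2_texp|exact: X0i].
Qed.

Lemma axis_trichotomy q : W q -> [\/ q = p, exists i, axis i q | stab act q = [set 1]].
Proof.
move=> Wq; have [qc qh] := Wq.
have [[i [j [ij zi zj]]]|h2] := pselect (exists i j, [/\ j != i,
    zeta i (chart_map c q) != 0 & zeta j (chart_map c q) != 0]).
  apply: Or33; rewrite stabE//; apply/seteqP; split=> [a [Ta h]|_ ->].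
    apply: (axis_pair ij Ta); first by have [//|/eqP] := h i; rewrite (negPf zi).
    by have [//|/eqP] := h j; rewrite (negPf zj).
  split; first exact: T2_1.
  move=> i0; left; have [_ _ _ chi1 [_ chiM]] := L; have T1 := Tp T2_1.
  have := chiM 1 1 i0 T1 T1; rewrite mulr1 -[X in X = _]mulr1 => /(mulfI (S1_neq0 (chi1 1 i0 T1))).
  by [].
have [[i zi]|h1] := pselect (exists i, zeta i (chart_map c q) != 0).
  apply: Or32; exists i; split=> // j ji; apply/eqP; apply: contrapT => zj; apply: h2.
  by exists i, j; split=> //; exact/negP.
apply: Or31; apply: (lin_inj L qc (lin_dom L)) => i.
have [[_ ->] _ _ _ _] := L; rewrite zeta0; apply/eqP; apply: contrapT => zi; apply: h1.
by exists i; apply/negP.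
Qed.

Let pt i (r : R) (th : R) : 'rV[R]_6 := of_zeta (fun k => if k == i then r%:C%C * cis th else 0).

Let csq_cis (r th : R) : csq (r%:C%C * cis th) = r ^+ 2.
Proof. by rewrite csqM (csq_S1 (S1_cis th)) mulr1 /csq /= expr0n addr0. Qed.

Let csq0 : csq (0 : C) = 0. Proof. by rewrite /csq /= expr0n addr0. Qed.

Let pt_polydisc i r th e : 0 < r < e -> polydisc e (pt i r th).
Proof.
move=> /andP[r0 re] k; rewrite of_zetaK; case: ifP => _; last by rewrite csq0 exprn_gt0// (lt_trans r0).
by rewrite csq_cis; nra.
Qed.

Let pt_axis i r th : 0 < r < 2^-1 -> axis i (chart_inv c (pt i r th)).
Proof.
move=> rh; have ph := pt_polydisc i th rh; have p1 := half1 ph; have /andP[r0 _] := rh.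
split; first by split; [exact: lin_inv_dom L _ p1|rewrite /= (lin_invK L p1)].
  rewrite (lin_invK L p1) of_zetaK eqxx; apply/eqP => /(congr1 csq); rewrite csq_cis csq0 => /eqP.
  by rewrite sqrf_eq0 gt_eqF.
by move=> j /negPf ji; rewrite (lin_invK L p1) of_zetaK ji.
Qed.

Let axis_polar i q : axis i q -> exists r th, 0 < r < 2^-1 /\ q = chart_inv c (pt i r th).
Proof.
move=> [[qc qh] zi zj]; set z := zeta i _ in zi; pose r := Num.sqrt (csq z).
have zp : 0 < csq z.
  by rewrite lt_def csq_ge0 andbT; apply: contra zi => /eqP/csq_eq0 ->.
have r0 : 0 < r by rewrite sqrtr_gt0.
have rr : r ^+ 2 = csq z by rewrite sqr_sqrtr// ltW.
have rc0 : r%:C%C != 0 :> C by apply/eqP => -[] E; rewrite E ltxx in r0.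
have [th [_ thE]] : exists t, 0 <= t <= pi *+ 2 /\ cis t = (r^-1)%:C%C * z.
  apply: cis_surj; apply/S1P; rewrite -/(csq _) csqM -rr /csq /= expr0n addr0 -exprMn mulVf ?expr1n//.
  by rewrite gt_eqF.
exists r, th; split.
  have rhE : (r < 2^-1) = (r ^+ 2 < 2^-1 ^+ 2).
    by rewrite ltr_pXn2r// nnegrE ltW//; case/andP: h01.
  by rewrite r0 rhE rr; exact: qh.
have ptE : pt i r th = chart_map c q.
  apply: zeta_inj => k; rewrite of_zetaK; have [->|/zj ->//] := eqVneq k i.
  rewrite thE mulrA -/z; have -> : r%:C%C * (r^-1)%:C%C = 1 :> C.
    apply/eqP; rewrite eq_complex /=; apply/andP; split; apply/eqP.
      by rewrite mulr0 subr0 mulfV// gt_eqF.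
    by rewrite mulr0 mul0r addr0.
  by rewrite mul1r.
by rewrite ptE chart_mapK.
Qed.

(** An axis is a punctured disc. A path that is affine in the polar coordinates, radius and angle,
    avoids the centre and joins any point to the one of radius [1/4] and angle 0. *)
Lemma axis_connected i : connected (axis i).
Proof.
have q4 : 0 < (4^-1 : R) < 2^-1 by apply/andP; split; lra.
apply: (@path_connected_set _ _ _ (chart_inv c (pt i 4^-1 0))) => q /axis_polar[r [th [rh ->]]].
pose rho (t : R) : R := 4^-1 + t * (r - 4^-1).
have rhoh t : 0 <= t <= 1 -> 0 < rho t < 2^-1.
  move=> /andP[t0 t1]; have /andP[r0 r2] := rh; rewrite /rho; apply/andP; split; nra.
exists (fun t => chart_inv c (pt i (rho t) (t * th))); split.
- by rewrite /rho !mul0r addr0.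
- by rewrite /rho !mul1r addrC subrK.
- by move=> t t01; apply: pt_axis; exact: rhoh.
move=> t t01; have [_ imE _ _ _] := L.
apply: (@cvg_comp _ _ _ (fun t : R => pt i (rho t) (t * th)) (chart_inv c)); last first.
  by apply: chart_inv_cvg => //; rewrite imE; apply: half1; apply: pt_polydisc; exact: rhoh.
have oT : open [set: R^o] by exact: openT.
have [Cc Cs] := @cos_sin_smooth R 0.
have Cid : Ck_on 0 [set: R^o] (fun t : R^o => t) by exact: Ck_on_id.
have Crho : Ck_on 0 [set: R^o] (rho : R^o -> R^o).
  apply: (Ck_on_add oT (Ck_on_cst _ _ (4^-1 : R^o))).
  by apply: Ck_on_mul => //; exact: Ck_on_cst.
have Cth : Ck_on 0 [set: R^o] (fun t : R^o => t * th : R^o).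
  by apply: Ck_on_mul => //; exact: Ck_on_cst.
have Ccos : Ck_on 0 [set: R^o] (fun t : R^o => cos (t * th) : R^o).
  exact: (@Ck_on_comp _ _ _ _ _ _ _ (fun t : R^o => t * th : R^o) (cos : R^o -> R^o) finite_basis_R oT oT).
have Csin : Ck_on 0 [set: R^o] (fun t : R^o => sin (t * th) : R^o).
  exact: (@Ck_on_comp _ _ _ _ _ _ _ (fun t : R^o => t * th : R^o) (sin : R^o -> R^o) finite_basis_R oT oT).
suff : Ck_on 0 [set: R^o] (fun t : R^o => pt i (rho t) (t * th)) by move/(_ t I).
apply: Ck_on_rV => // j.
have [k ->] := unsplit_surj j.
have C0 : Ck_on 0 [set: R^o] (fun _ : R^o => 0 : R^o) by exact: Ck_on_cst.
case: k => k.
  have -> : (fun t : R^o => pt i (rho t) (t * th) 0 (unsplit (inl k : 'I_3 + 'I_3)) : R^o) =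
      (fun t : R^o => if k == i then rho t * cos (t * th) else 0 : R^o).
    apply/funext => s; rewrite /pt /of_zeta /= (@row_mxEl _ 1 3 3) mxE; case: ifP => //= _.
    by rewrite mul0r subr0.
  by case: (k == i); [exact: Ck_on_mul oT Crho Ccos|exact: C0].
have -> : (fun t : R^o => pt i (rho t) (t * th) 0 (unsplit (inr k : 'I_3 + 'I_3)) : R^o) =
    (fun t : R^o => if k == i then rho t * sin (t * th) else 0 : R^o).
  apply/funext => s; rewrite /pt /of_zeta /= (@row_mxEr _ 1 3 3) mxE; case: ifP => //= _.
  by rewrite mul0r addr0.
by case: (k == i); [exact: Ck_on_mul oT Crho Csin|exact: C0].
Qed.

(** The fixed-point set of the kernel of [chi i] would contain the centre [p]; intersecting with the
    open set [W'], where [zeta i] does not vanish, leaves exactly the axis. The kernel is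
    non-trivial because it contains a one-parameter subgroup. *)
Lemma axis_surface i : totally_geodesic_complex_surface S (axis i).
Proof.
pose K : set (C * C) := [set a | T2 a /\ chi i a = 1].
pose W' : set M := chart_dom c `&` chart_map c @^-1` (polydisc 2^-1 `&` [set x | 0 < csq (zeta i x)]).
have [a0 Ka0 a01] : exists2 a, K a & a <> 1.
  have [X0 X00 X0i] := kernel_line i; apply: contrapT => h; case/eqP: X00; apply: texp_line0 => t.
  apply: contrapT => n1; apply: h; exists (texp (t *: X0)) => //; split; [exact: T2_texp|exact: X0i].
have NE : axis i = [set q | W' q /\ forall a, K a -> act a q = q].
  apply/seteqP; split=> q [].
    move=> Wq zi zj; have [qc qh] := Wq; split.
      split=> //; split=> //=; rewrite lt_def csq_ge0 andbT; apply: contra zi => /eqP/csq_eq0 ->.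
      by [].
    move=> a Ka; have := stab_axis (And3 Wq zi zj : axis i q).
    by move=> /(congr1 (fun A : set (C * C) => A a)) E; have [] : stab act q a by rewrite E.
  move=> [qc [qh zi]] Kq; split=> [//| |j ji].
    by apply: contraTneq zi => ->; rewrite csq0 ltxx.
  have [Ta ai] := Ka0; have /(lin_fix L (Tp Ta) qc)/(_ j)[aj|//] := Kq _ Ka0.
  by case: a01; exact: axis_pair ji Ta ai aj.
rewrite NE; apply: fixed_surface => //.
- by move=> a [].
- apply: open_dom_map => //; apply: openI; first exact: polydisc_open.
  apply: (open_comp (D := [set t : R | 0 < t])) => [x _|]; [exact: csq_zeta_continuous|exact: open_gt].
- move=> q; rewrite -[X in X q]NE => qi; have sE := stab_axis qi.
  have Kq : K `<=` stab act q by rewrite sE.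
  have nT : stab act q <> @T2 R.
    by move=> E; have [_] := axis_circle qi; rewrite E => d; have := has_dim_uniq d has_dim_torus.
  have [c' [chi' [i1 [L' h1 h2]]]] := one_trivial_weight Kq (ex_intro2 _ _ a0 Ka0 a01) nT.
  by exists c', chi', i1; split=> // a Ka; apply: h1; exact: Kq.
- rewrite -NE; exists (chart_inv c (pt i 4^-1 0)); apply: pt_axis; apply/andP; split; lra.
- by rewrite -NE; exact: axis_connected.
Qed.

(** A compact piece of a complex coordinate line containing the coordinates of the axis. Its image
    in the Hausdorff space [M] is compact, hence closed, and so bounds the closure of the axis in
    all of [M]. *)
Let F i : set 'rV[R]_6 := [set x | forall j : 'I_6, (if (j == @lshift 3 3 i) || (j == @rshift 3 3 i)
  then `[- 2^-1, 2^-1]%classic else [set (0 : R)]) (x 0 j)].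

Let F_zeta i x k : F i x -> k != i -> zeta k x = 0.
Proof.
move=> Fx ki; have := Fx (@lshift 3 3 k); have := Fx (@rshift 3 3 k).
rewrite (@eq_lshift 3 3) (@eq_rshift 3 3) (@eq_lrshift 3 3) (@eq_rlshift 3 3) (negPf ki) /=.
by rewrite /zeta => -> ->.
Qed.

Let F_polydisc i x : F i x -> polydisc 1 x.
Proof.
move=> Fx k; have [->|ki] := eqVneq k i; last by rewrite (F_zeta Fx ki) csq0 expr1n.
have := Fx (@lshift 3 3 i); have := Fx (@rshift 3 3 i); rewrite !eqxx orbT /=.
by rewrite !in_itv /= => /andP[a1 a2] /andP[b1 b2]; rewrite /csq /zeta /= expr1n; nra.
Qed.

Let axis_closure i : closure (axis i) `<=` chart_inv c @` F i.
Proof.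
have cF : compact (F i).
  apply: (@rV_compact R 6 (fun j : 'I_6 => if (j == @lshift 3 3 i) || (j == @rshift 3 3 i)
    then `[- 2^-1, 2^-1]%classic else [set (0 : R)])) => j.
  by case: ifP => _; [exact: segment_compact|exact: compact_set1].
have [_ imE _ _ _] := L.
have cl : closed (chart_inv c @` F i).
  apply: compact_closed; first exact: mfd_hausdorff.
  apply: continuous_compact => //; apply: continuous_in_subspaceT => x /set_mem Fx.
  by apply: chart_inv_cvg => //; rewrite imE; exact: F_polydisc Fx.
suff sub : axis i `<=` chart_inv c @` F i by move=> q /(closureS sub); exact: cl.
move=> q [[qc qh] zi zj]; exists (chart_map c q); last by rewrite chart_mapK.
move=> j; have [k ->] := unsplit_surj j.
have := qh i; rewrite /csq /zeta /= => hi.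
case: k => k /=; rewrite ?(@eq_lshift 3 3) ?(@eq_rshift 3 3) ?(@eq_lrshift 3 3) ?(@eq_rlshift 3 3) ?orbF /=.
  have [->|/zj[-> _] //] := eqVneq k i; rewrite /= in_itv /=; apply/andP; split; nra.
have [->|/zj[_ ->] //] := eqVneq k i; rewrite /= in_itv /=; apply/andP; split; nra.
Qed.

Let closure_axis i : closure (axis i) p.
Proof.
move=> U nU; have [[Ac' cp0] imE _ _ _] := L; have p0 := lin_inv0 L.
have img0 : chart_img c 0 by rewrite -cp0; apply: chart_img_map; case: Ac'.
have nV : nbhs (0 : 'rV[R]_6) (chart_inv c @^-1` U) by apply: chart_inv_cvg => //; rewrite p0.
have [r r0 rU] := polydisc_nbhs nV.
(* The first bound puts the point in the given neighbourhood of [p], the second keeps it on the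
   axis, whose radius is [1/2]. *)
pose s := Num.min (r / 2) 4^-1; have s0 : 0 < s by rewrite lt_min divr_gt0//=; lra.
have sr : s < r by apply: (@le_lt_trans _ _ (r / 2)); [rewrite ge_min lexx|rewrite ltr_pdivrMr// ltr_pMr// ltr1n].
have sh : s < 2^-1 by apply: (@le_lt_trans _ _ 4^-1); [rewrite ge_min lexx orbT|lra].
exists (chart_inv c (pt i s 0)); split; first by apply: pt_axis; rewrite s0.
by apply: rU; apply: pt_polydisc; rewrite s0.
Qed.

Lemma fixed_point_neighbourhood : exists W : set M,
  [/\ open W, W p,
      forall q, W q -> q <> p -> stab act q = [set 1] \/ is_circle (stab act q)
    & exists N : 'I_3 -> set M,
      [/\ forall i, totally_geodesic_complex_surface S (N i),
          [set q | W q /\ has_dim (stab act q) 1] = \bigcup_i N i,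
          forall i j, i != j -> N i `&` N j = set0
        & forall i j, i != j -> closure (N i) `&` closure (N j) = [set p]]].
Proof.
have [[_ cp0] _ _ _ _] := L.
exists W; split.
- by apply: open_dom_map => //; exact: polydisc_open.
- split; first exact: lin_dom L.
  by rewrite /= cp0 => i; rewrite zeta0 csq0 exprn_gt0//; case/andP: h01.
- move=> q Wq qp; have [//|[i qi]|E] := axis_trichotomy Wq; [right|by left].
  exact: (axis_circle qi).1.
exists axis; split.
- exact: axis_surface.
- apply/seteqP; split=> [q [Wq d1]|q [i _ qi]]; last by split; [case: qi|exact: (axis_circle qi).2].
  have [qp|[i qi]|E] := axis_trichotomy Wq.
  + by rewrite qp stabp in d1; have := has_dim_uniq d1 has_dim_torus.
  + by exists i.
  + by rewrite E in d1; have := has_dim_uniq d1 has_dim_trivial.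
- move=> i j ij; apply/seteqP; split=> // q [[_ zi _] [_ _ zj]].
  by have := zj i ij => /eqP; rewrite (negPf zi).
move=> i j ij; apply/seteqP; split=> [q [/axis_closure[x Fx xq] /axis_closure[y Fy yq]]|_ ->].
  have xy : x = y.
    by rewrite -(lin_invK L (F_polydisc Fx)) xq -yq (lin_invK L (F_polydisc Fy)).
  rewrite /= -xq; have -> : x = 0; last exact: lin_inv0 L.
  apply: zeta_inj => k; rewrite zeta0; have [->|ki] := eqVneq k i; last exact: F_zeta Fx ki.
  by rewrite xy; apply: F_zeta Fy ij.
by split; exact: closure_axis.
Qed.
End FixedPoint.
End Cases.

Theorem theorem2p3 (R : realType) (M : manifold R 6) (S : su3_structure M)
    (act : torus_action M) (symm : two_torus_symmetry S act)
    (eff : effective act) (p : M) :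
  [/\ has_dim (stab act p) 2 ->
        stab act p = @T2 R /\
        exists W : set M,
        [/\ open W, W p,
            forall q, W q -> q <> p ->
              stab act q = [set 1] \/ is_circle (stab act q)
          & exists N : 'I_3 -> set M,
            [/\ forall i, totally_geodesic_complex_surface S (N i),
                [set q | W q /\ has_dim (stab act q) 1] = \bigcup_i N i,
                forall i j, i != j -> N i `&` N j = set0
              & forall i j, i != j ->
                  closure (N i) `&` closure (N j) = [set p]]],
      has_dim (stab act p) 1 ->
        is_circle (stab act p) /\
        exists W : set M,
        [/\ open W, torbit act p `<=` W,
            forall q, W q ->
              stab act q = [set 1] \/ stab act q = stab act p
          & totally_geodesic_complex_surface S
              [set q | W q /\ stab act q = stab act p]]
    & has_dim (stab act p) 0 -> stab act p <> [set 1] ->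
        [/\ exists2 k, (1 < k)%N & iso_Zk (stab act p) k,
            totally_geodesic_complex_surface S (torbit act p)
          & exists W : set M,
            [/\ open W, torbit act p `<=` W,
                forall a q, T2 a -> W q -> W (act a q)
              & forall q, W q -> ~ torbit act p q -> stab act q = [set 1]]]].
Proof.
split; [|exact: circle_stabiliser|exact: finite_stabiliser].
move=> [A [rA LA]]; have stabp : stab act p = @T2 R.
  apply: stab_torus => X; have : lie_algebra (stab act p) X.
    by rewrite LA /=; apply: submx_full; rewrite /row_full rA.
  by move/(_ 1); rewrite scale1r.
split=> //; have [c [chi L]] := linearized_chart symm p.
exact: fixed_point_neighbourhood L.
Qed.
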